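(* Let $W_n$ be the probability that two permutations of size $n$, taken uniformly and independently at random, have the same cycle type. Then, as $n\to\infty$, $$W_n=\frac{W(1)}{n^2}+O\left(\frac{\log n}{n^3}\right),\qquad W(1)=\prod_{k\ge1}I\left(\frac{1}{k^2}\right)\doteq 4.26340\,35141\,52669,$$ where $I(z)=\sum_{n\ge0}\frac{z^n}{n!^2}$. Furthermore, this probability admits a full asymptotic expansion with oscillating coefficients.
   Context: The cycle type of a permutation is the (unordered) multiset formed with the lengths of the cycles in its decomposition into cycles. The generating function of $(W_n)$ is $W(z):=\sum_{n\ge0}W_nz^n=\prod_{k=1}^\infty I\left(\frac{z^k}{k^2}\right)$. The symbol $\doteq$ indicates a numerical approximation. A sequence $(f_n)$ is said to admit a full asymptotic expansion with oscillating coefficients if it is of the form $f_n\sim\sum_{r\ge0}\frac{P_r(n)}{n^{\alpha_r}}$ ($n\to\infty$), where the exponents $\alpha_r$ increase to $+\infty$ and each $P_r(n)$ is a polynomial in $\log n$ whose coefficients are periodic functions of $n$. *)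

(* Defs.v *)
From HB Require Import structures.
From mathcomp Require Import all_boot all_order all_algebra.
From mathcomp Require Import fingroup perm finmap multiset.
From mathcomp Require Import all_classical all_reals all_analysis.

Set Implicit Arguments.
Unset Strict Implicit.
Unset Printing Implicit Defensive.

Import Order.TTheory GRing.Theory Num.Theory.
Import numFieldNormedType.Exports.

Local Open Scope classical_set_scope.
Local Open Scope mset_scope.
Local Open Scope ring_scope.

(* [porbits s] contains the singleton orbits, so fixed points count as cycles
   of length 1. *)
Definition cycle_type (n : nat) (s : 'S_n) : {mset nat} :=
  seq_mset [seq #|c| | c : {set 'I_n} <- enum (porbits s)].

Definition same_cycle_type_prob (R : realType) (n : nat) : R :=
  #|[pred st : 'S_n * 'S_n | cycle_type st.1 == cycle_type st.2]|%:R
    / #|{: 'S_n * 'S_n}|%:R.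

Definition same_cycle_type_gf (R : realType) (z : R) : R :=
  limn (series (fun n => same_cycle_type_prob R n * z ^+ n)).

Definition I_fun (R : realType) (z : R) : R :=
  limn (series (fun n => z ^+ n / n`!%:R ^+ 2)).

(* The library's [periodic] needs a group as domain, which [nat] is not. *)
Definition periodic_seq (R : realType) (u : nat -> R) : Prop :=
  exists2 p : nat, (0 < p)%N & forall n, u (n + p)%N = u n.

(* [n |-> (P n).[x]] is a polynomial in [x], of degree bounded independently of
   [n], whose coefficients are periodic functions of [n] (the period may depend
   on the coefficient). *)
Definition poly_with_periodic_coefs (R : realType) (P : nat -> {poly R}) : Prop :=
  (exists d : nat, forall n, (size (P n) <= d)%N) /\
  (forall j : nat, periodic_seq (fun n => (P n)`_j)).

(* f n ~ \sum_r P_r(n) / n ^ alpha_r in the sense of Poincare: truncating after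
   the term of index N leaves an error o(n ^ - alpha_N). As alpha is strictly
   increasing and P_r(n) is polynomial in log n, this is the same as an error
   O((log n) ^ d / n ^ alpha_(N+1)), for some d depending on N. *)
Definition full_oscillating_expansion (R : realType) (f : nat -> R) : Prop :=
  exists (alpha : nat -> R) (P : nat -> nat -> {poly R}),
    [/\ {homo alpha : r s / (r < s)%N >-> r < s},
        alpha @ \oo --> +oo,
        forall r, poly_with_periodic_coefs (P r) &
        forall N : nat,
          (fun n => f n - \sum_(r < N.+1) (P r n).[ln n%:R] / n%:R `^ alpha r)
            =o_\oo (fun n => (n%:R `^ alpha N)^-1)].

(* Main.v *)
(* Put theta = z d/dz and write theta I = B I. As I has no zero in a disk of radius
   larger than 1, the coefficients b_m of B decay exponentially. The cycle index
   gives W = \prod_k I(z^k / k^2), hence theta W = h W with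
   h_n = \sum_(m | n) b_m m^(2m-1) / n^(2m-1), a combination of periodic
   sequences times powers of 1/n; that is, n W_n = \sum_j h_(n-j) W_j.

   Consider the span of the sequences obtained from the unit of the convolution
   product by dividing by n and by convolving with a periodic sequence and then
   dividing by n (coefficients of multiple polylogarithms at roots of unity). It is
   closed under convolution, by the shuffle product. Measuring errors by
   \sum_n |e_n| (n+1)^a < oo, each use of the recurrence improves the accuracy with
   which W is approximated by this span, so W is in it up to any power of 1/n.
   Summation by parts of Euler-Maclaurin type expands the elements of the span in
   terms (log n)^i / n^r with periodic coefficients.

   For the leading term, the recurrence and h_n = 1/n + O(1/n^2) first give
   W_n = O(1/n^2), and then n^2 W_n = \sum_(j < n) W_j + O(log n / n).

   The decimals come from integer arithmetic for the first 300 factors of W(1), and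
   from a rational function T with T(k-1) ~ I(1/k^2) T(k), which telescopes, for the
   others. *)

(* Here [log W] is the sum of the [(b_m / m) Li_{2m}(z^m)], whose singularities are spread over the
   roots of unity; moving a contour across the unit circle is not an option, so everything happens
   on real coefficient sequences. The summands get smoother as [m] grows, hence for a given accuracy
   only finitely many of them enter [h] and the rest is an error term.

   Convolution with a periodic sequence costs slightly more than one power of [n], and the division
   by [n] that always follows returns exactly one. This balance, with an arbitrarily small loss, is
   what lets words and errors be multiplied together; weighted l1 norms keep the products of errors
   free of logarithms.

   The bootstrap yields a separate approximant for each accuracy, while a full expansion is a single
   family [P_r] serving all truncations. Uniqueness glues them: along a residue class the periodic
   coefficients are constant while [ln n] tends to infinity, so a polynomial in [ln n] that becomes
   small must vanish. *)
From Stdlib Require Import ZArith Lia.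

(** * Exact integer arithmetic behind the decimals of [W(1)] *)

Section IntegerArithmetic.
Local Open Scope Z_scope.

(* [fst / snd] is the partial sum [\sum_(i <= j) 1 / (i!^2 x^i)] of [I (1 / x)]. *)
Fixpoint I_frac (x : Z) (j : nat) : Z * Z :=
  match j with
  | O => (1, 1)
  | S j' => let (n, d) := I_frac x j' in
            let m := Z.of_nat (S j') * Z.of_nat (S j') * x in (n * m + 1, d * m)
  end.

(** Fixed-point scale: each of the 300 rounded factors costs a few units in the last place, far
    below the 15 decimals wanted. *)
Definition fixed_one := 10 ^ 30.

(* Bounds of [fixed_one * \prod_(i <= k) I (1 / i^2)], rounded outwards. *)
Fixpoint I_prod_bounds (k : nat) : Z * Z :=
  match k with
  | O => (fixed_one, fixed_one)
  | S k' => let (l, u) := I_prod_bounds k' in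
            let (n, d) := I_frac (Z.of_nat (S k') * Z.of_nat (S k')) 14 in
            (l * n / d, u * (n + 1) / d + 1)
  end.

(** A single controlled unfolding; plain simplification would also expand [I_frac] to depth 14. *)
Lemma I_prod_boundsS k l u n d : I_prod_bounds k = (l, u) ->
  I_frac (Z.of_nat (S k) * Z.of_nat (S k)) 14 = (n, d) ->
  I_prod_bounds (S k) = (l * n / d, u * (n + 1) / d + 1).
Proof.
intros E F.
change (I_prod_bounds (S k)) with
  (let (l, u) := I_prod_bounds k in
   let (n, d) := I_frac (Z.of_nat (S k) * Z.of_nat (S k)) 14 in
   (l * n / d, u * (n + 1) / d + 1)).
now rewrite E, F.
Qed.

(* [tail_num w y / tail_den w y] approximates [\prod_(k > (y - 1) / 2) I (1 / k^2)]:
   it is [(1 + u) / (1 - u)] for [u = 1/y - 1/y^3 + (w / 10^4) / y^5], and the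
   exact expansion of [u] continues with [w / 10^4 = 103/45 = 2.28888...]. *)
Definition tail_num (w y : Z) := 10000 * (y ^ 5 + y ^ 4 - y ^ 2) + w.
Definition tail_den (w y : Z) := 10000 * (y ^ 5 - y ^ 4 + y ^ 2) - w.

Local Ltac nonneg := repeat (apply Z.add_nonneg_nonneg || apply Z.mul_nonneg_nonneg
  || assumption || (compute; discriminate)).

Lemma I_frac4 x :
  I_frac x 4 = (576 * x ^ 4 + 576 * x ^ 3 + 144 * x ^ 2 + 16 * x + 1, 576 * x ^ 4).
Proof.
cbv [I_frac]; change (Z.of_nat 1) with 1; change (Z.of_nat 2) with 2.
change (Z.of_nat 3) with 3; change (Z.of_nat 4) with 4.
f_equal; ring.
Qed.

(** Cleared of denominators, this is [T(k-1) <= I(1/k^2) T(k)] with [y = 2 k + 1]. As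
    [T(-y) = 1 / T(y)], the difference of the two sides is even in [k], hence a polynomial in [k^2];
    re-expanded at [301^2 = 90601] it has only positive coefficients. The parameter [22888] lies
    just below the exact [22888.88...]. *)
Lemma tail_step_lower k : 301 <= k ->
  tail_num 22888 (2 * k - 1) * tail_den 22888 (2 * k + 1) * snd (I_frac (k * k) 4)
  <= tail_den 22888 (2 * k - 1) * tail_num 22888 (2 * k + 1) * fst (I_frac (k * k) 4).
Proof.
intro hk; apply Zle_0_minus_le; rewrite I_frac4; unfold tail_num, tail_den, fst, snd.
assert (ht : 0 <= k * k - 90601) by nia.
set (t := k * k - 90601) in ht.
match goal with |- 0 <= ?e => replace e with
  (569755688197169786258881751284962574272 + t * (41445097074098700789355973955412992
   + t * (1246080022063824169582493842432 + t * (19845902453663878029766656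
   + t * (176768033503907840000 + t * (835534192640000 + t * 1638400000))))))
  by (unfold t; ring) end.
clearbody t; nonneg.
Qed.

(** The same with the opposite rounding: [22890] lies above the exact value, and [fst + 1] accounts
    for the neglected terms of [I]. *)
Lemma tail_step_upper k : 301 <= k ->
  tail_den 22890 (2 * k - 1) * tail_num 22890 (2 * k + 1) * (fst (I_frac (k * k) 4) + 1)
  <= tail_num 22890 (2 * k - 1) * tail_den 22890 (2 * k + 1) * snd (I_frac (k * k) 4).
Proof.
intro hk; apply Zle_0_minus_le; rewrite I_frac4; unfold tail_num, tail_den, fst, snd.
assert (ht : 0 <= k * k - 90601) by nia.
set (t := k * k - 90601) in ht.
match goal with |- 0 <= ?e => replace e with
  (1468564984660478397939245665517509369800 + t * (93548163227971112668922207482507200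
   + t * (2479041294313540013167646011200 + t * (34977689039499228593209600
   + t * (277086910194764800000 + t * (1168316620800000 + t * 2048000000))))))
  by (unfold t; ring) end.
clearbody t; nonneg.
Qed.

Lemma tail_den_pos w y : 601 <= y -> 0 <= w <= 22890 -> 0 < tail_den w y.
Proof.
intros hy hw; unfold tail_den.
assert (0 <= y ^ 4 * (y - 601)) by (apply Z.mul_nonneg_nonneg; [apply Z.pow_nonneg|]; lia).
assert (0 <= y ^ 4) by (apply Z.pow_nonneg; lia).
replace (y ^ 5) with (y ^ 4 * y) in * by ring.
nia.
Qed.

Lemma tail_den_le_num w y : 601 <= y -> 0 <= w -> tail_den w y <= tail_num w y.
Proof.
intros hy hw; unfold tail_den, tail_num.
assert (0 <= y ^ 2 * (y * y - 1)) by (apply Z.mul_nonneg_nonneg; nia).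
replace (y ^ 4) with (y ^ 2 * (y * y)) by ring.
nia.
Qed.

(** Amounts to [T <= 1 + 4 / y]: the tail factor tends to 1, so the telescoped products tend to
    [W(1)]. *)
Lemma tail_num_le w y : 601 <= y -> 0 <= w <= 22890 ->
  tail_num w y * y <= tail_den w y * (y + 4).
Proof.
intros hy hw; apply Zle_0_minus_le; unfold tail_den, tail_num.
assert (0 <= y ^ 3 * (y * (y - 2))) by (apply Z.mul_nonneg_nonneg; nia).
assert (0 <= y ^ 2 * (y - 601)) by (apply Z.mul_nonneg_nonneg; nia).
assert (0 <= y * (y - 601)) by (apply Z.mul_nonneg_nonneg; nia).
assert (0 <= (22890 - w) * y) by (apply Z.mul_nonneg_nonneg; lia).
nia.
Qed.

(** [601 = 2 * 300 + 1]. Between the parameters [22888] and [22890] the tail factor changes by about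
    [5e-18], which is fine enough to fix 15 decimals. *)
Lemma gf_lower : 4263403514152669 * fixed_one * tail_den 22888 601
  <= fst (I_prod_bounds 300) * tail_num 22888 601 * 10 ^ 15.
Proof. apply Zle_bool_imp_le; vm_compute; reflexivity. Qed.

Lemma gf_upper : snd (I_prod_bounds 300) * tail_num 22890 601 * 10 ^ 15
  < 4263403514152670 * fixed_one * tail_den 22890 601.
Proof. apply Z.ltb_lt; vm_compute; reflexivity. Qed.

End IntegerArithmetic.

From mathcomp Require Import all_boot all_order all_algebra.
From mathcomp Require Import fingroup perm.
From mathcomp Require Import ring lra zify.

Set Implicit Arguments.
Unset Strict Implicit.
Unset Printing Implicit Defensive.

(** * Inserting a point into a cycle of a permutation *)

Section CycleTypeCount.
Variable T : finType.
Implicit Types (A C : {set T}) (s : {perm T}) (x y z : T) (m : nat -> nat).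

Lemma porbit_sub_stable s C z : (forall w, w \in C -> s w \in C) -> z \in C ->
  porbit s z \subset C.
Proof.
move=> hC zC; apply/subsetP => _ /porbitP[i ->].
by elim: i => [|i IH]; rewrite ?expg0 ?perm1 // expgSr permM hC.
Qed.

Lemma porbit_perm1 s z w : w \in porbit s z -> s w \in porbit s z.
Proof.
rewrite -!eq_porbit_mem => /eqP <-.
by have /= -> := porbit_perm s 1 w; rewrite ?expg1.
Qed.

Section Insert.
Variables (x y : T) (s : {perm T}).
Hypothesis sx : s x = x.
Let t : {perm T} := (tperm x y * s)%g.

(** Products of permutations act from left to right, so [t] sends [y] to [x] and [x] to [s y]: the
    fixed point [x] is spliced into the cycle of [y], right after [y]. For [y = x] nothing
    changes. *)
Lemma insertE w : t w = if w == x then s y else if w == y then x else s w.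
Proof.
rewrite permM; case: tpermP => [->|->|/eqP/negPf-> /eqP/negPf->] //.
  by rewrite eqxx.
by rewrite sx; case: eqP => [->|_]; rewrite ?sx ?eqxx.
Qed.

Lemma insert_porbit : porbit t y = x |: porbit s y.
Proof.
apply/eqP; rewrite eqEsubset; apply/andP; split.
  apply: porbit_sub_stable; last by rewrite !inE porbit_id orbT.
  move=> w; rewrite !inE insertE; have [_ _|wx /= wy] := eqVneq w x.
    by rewrite porbit_perm1 ?porbit_id ?orbT.
  by have [_|_] := eqVneq w y; rewrite ?eqxx // porbit_perm1 ?orbT.
have xt : x \in porbit t y.
  have -> : x = t y by rewrite insertE; case: eqP => [->|]; rewrite ?sx ?eqxx.
  by rewrite porbit_perm1 // porbit_id.
rewrite subUset sub1set xt; apply: porbit_sub_stable; last exact: porbit_id.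
move=> w wt; have := porbit_perm1 wt; rewrite insertE.
case: eqP => [->|_]; first by rewrite sx.
case: eqP => [-> _|//].
by have := porbit_perm1 xt; rewrite insertE eqxx.
Qed.

Lemma insert_porbit_other z : z \notin x |: porbit s y -> porbit t z = porbit s z.
Proof.
move=> hz; have zx : z != x by apply: contraNneq hz => ->; rewrite !inE eqxx.
have xz : x \notin porbit s z.
  apply: contraNN hz => xz; have : z \in porbit s x by rewrite porbit_sym.
  suff /subsetP h : porbit s x \subset [set x] by move/h; rewrite !inE => ->.
  by apply: porbit_sub_stable => [w|]; rewrite !inE // => /eqP ->; rewrite sx.
have yz : y \notin porbit s z.
  by apply: contraNN hz => yz; rewrite !inE [_ \in porbit s y]porbit_sym yz orbT.
have st w : w \in porbit s z -> t w = s w.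
  move=> wz; rewrite insertE; case: eqP => [wx|_]; first by rewrite -wx wz in xz.
  by case: eqP => [wy|//]; rewrite -wy wz in yz.
have sub : porbit t z \subset porbit s z.
  apply: porbit_sub_stable; last exact: porbit_id.
  by move=> w wz; rewrite st // porbit_perm1.
apply/eqP; rewrite eqEsubset sub; apply: porbit_sub_stable; last exact: porbit_id.
by move=> w wz; rewrite -st ?porbit_perm1 //; exact: (subsetP sub).
Qed.

End Insert.

(** Points rather than cycles, because a subset of the ground set is easier to split than a set of
    orbits; dividing by [j] recovers the number of cycles. *)
Definition points_of_size A s j := #|[set z in A | #|porbit s z| == j]|.

(** Only points of [x |: porbit s y] change their orbit: [k] of them leave a cycle of length [k]
    (none if [y = x], where [k = 0]) and [k.+1] enter one of length [k.+1]. Both corrections are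
    added, which avoids truncated subtraction. *)
Lemma points_of_size_insert A s x y i : x \notin A -> perm_on A s -> y \in x |: A ->
  let k := #|porbit s y :\ x| in
  (points_of_size (x |: A) (tperm x y * s)%g i + (i == k) * k
   = points_of_size A s i + (i == k.+1) * k.+1)%N.
Proof.
move=> xA sA yA k; have sx := out_perm sA xA.
set C := x |: porbit s y.
set K := porbit s y :\ x in k *.
have CK : C = x |: K by apply/setP => z; rewrite !inE; case: eqP.
have CE : #|C| = k.+1 by rewrite CK cardsU1 !inE eqxx.
have tC z : z \in C -> porbit (tperm x y * s) z = C.
  rewrite /C -insert_porbit // => zC.
  by apply/eqP; rewrite eq_porbit_mem.
have sS w : w \in x |: A -> s w \in x |: A.
  rewrite !inE => /orP[/eqP ->|wA]; first by rewrite sx eqxx.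
  by rewrite perm_closed // wA orbT.
have CS : C \subset x |: A.
  by rewrite subUset sub1set !inE eqxx /= porbit_sub_stable.
have KA : K \subset A.
  apply/subsetP => z; rewrite !inE => /andP[zx zy].
  have : z \in x |: A by apply: (subsetP CS); rewrite !inE zy orbT.
  by rewrite !inE (negPf zx).
have sK z : z \in K -> #|porbit s z| = k.
  rewrite !inE => /andP[zx zy].
  have -> : porbit s z = porbit s y by apply/eqP; rewrite eq_porbit_mem.
  suff xy : x \notin porbit s y.
    by rewrite /k; congr #|pred_of_set _|; apply/setP => w; rewrite !inE;
      case: eqP => // ->; rewrite (negPf xy).
  apply: contraNN zx => xy; have : z \in porbit s x.
    by have /eqP -> : porbit s x == porbit s y by rewrite eq_porbit_mem.
  suff /subsetP h : porbit s x \subset [set x] by move/h; rewrite !inE.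
  by apply: porbit_sub_stable => [w|]; rewrite !inE // => /eqP ->; rewrite sx.
rewrite /points_of_size -(cardsID C) -[in RHS](cardsID C).
set U := _ :&: C; set V := _ :\: C; set U' := _ :&: C; set V' := _ :\: C.
have -> : V = V'.
  apply/setP => z; rewrite 2!inE [RHS]inE; case: (boolP (z \in C)) => //= zC.
  rewrite !inE insert_porbit_other //.
  by move: zC; rewrite !inE negb_or => /andP[/negPf ->].
have -> : #|U| = ((i == k.+1) * k.+1)%N.
  have -> : U = if i == k.+1 then C else set0.
    apply/setP => z; rewrite in_setI; have [zC|zC] := boolP (z \in C); last first.
      by rewrite andbF; case: eqP => _; rewrite ?(negPf zC) ?inE.
    have := subsetP CS z zC; rewrite in_set => ->; rewrite tC // CE eq_sym andbT.
    by case: eqP => _; rewrite ?zC ?inE.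
  by case: eqP => _; rewrite ?mul1n ?cards0.
have -> : #|U'| = ((i == k) * k)%N.
  have -> : U' = if i == k then K else set0.
    apply/setP => z; rewrite in_setI in_set; have [zK|zK] := boolP (z \in K).
      rewrite (subsetP KA z zK) sK // eq_sym /= CK in_setU zK orbT andbT.
      by case: eqP => _; rewrite ?zK ?inE.
    rewrite CK in_setU1; have [zx|zx] := eqVneq z x.
      by rewrite zx (negPf xA) /=; case: eqP => _; rewrite !inE ?eqxx.
    by rewrite /= (negPf zK) andbF; case: eqP => _; rewrite ?in_set0 ?(negPf zK).
  by case: eqP => _; rewrite ?mul1n ?cards0.
by rewrite addnAC [RHS]addnAC (addnC (_ * k)).
Qed.

(** Permutations of [x |: A] are sorted by the preimage [y] of [x]; cancelling [tperm x y] leaves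
    one that fixes [x]. *)
Lemma sum_perm_on_insert A x (F : {perm T} -> nat) : x \notin A ->
  (\sum_(s | perm_on (x |: A) s) F s
   = \sum_(y in x |: A) \sum_(s | perm_on A s) F (tperm x y * s)%g)%N.
Proof.
move=> xA; rewrite (partition_big (fun s => (s^-1)%g x) (mem (x |: A))) /=; last first.
  by move=> s sA; rewrite perm_closed ?setU11 // perm_onV.
apply: eq_bigr => y yA.
rewrite (reindex_inj (mulgI (tperm x y))) /=; apply: eq_bigl => s.
have tS : perm_on (x |: A) (tperm x y).
  apply/subsetP => z; rewrite inE; apply: contraNT => zS.
  by rewrite tpermD //; apply: contraNneq zS => <-; rewrite ?setU11.
apply/andP/idP => [[ts /eqP yE]|sA].
  have sS : perm_on (x |: A) s by rewrite -[s](mulKg (tperm x y)) tpermV perm_onM.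
  have sx : s x = x.
    have : (tperm x y * s)%g y = x by rewrite -{2}yE permKV.
    by rewrite permM tpermR.
  apply/subsetP => z zs; have := subsetP sS z zs; rewrite !inE => /orP[/eqP zx|//].
  by move: zs; rewrite inE zx sx eqxx.
have sx := out_perm sA xA; split.
  apply: perm_onM => //; apply/subsetP => z /(subsetP sA) zA.
  by rewrite inE zA orbT.
by rewrite -(inj_eq (@perm_inj _ (tperm x y * s)%g)) permKV permM tpermR sx.
Qed.

End CycleTypeCount.

(** * Cauchy's formula for the number of permutations of a given cycle type *)

Section CycleTypeFormula.
Variables (T : finType) (b : nat).
Hypothesis Tb : #|T| <= b.
Implicit Types (A : {set T}) (s : {perm T}) (x y z : T) (m : nat -> nat).

Definition has_type A s m := [forall j : 'I_b.+1, points_of_size A s j == j * m j].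

(** The order of the centralizer of a permutation of type [m]; index 0 contributes 1 when
    [m 0 = 0]. *)
Definition type_weight m := \prod_(j < b.+1) (j ^ m j * (m j)`!).

Definition type_size m := \sum_(j < b.+1) j * m j.

(* The type left after removing a point from a cycle of length [k.+1] in a permutation
   of type [m]. *)
Definition type_upd m k : nat -> nat := fun j =>
  if j == k.+1 then (m j).-1 else if (j == k) && (0 < k) then (m j).+1 else m j.

Lemma type_upd_succ m k : type_upd m k k.+1 = (m k.+1).-1.
Proof. by rewrite /type_upd eqxx. Qed.

Lemma type_upd_same m k : type_upd m k k = if 0 < k then (m k).+1 else m k.
Proof. by rewrite /type_upd ltn_eqF // eqxx. Qed.

Lemma type_upd_other m k j : j != k.+1 -> j != k -> type_upd m k j = m j.
Proof. by rewrite /type_upd => /negPf-> /negPf->. Qed.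

(** The number of places where the removed point can be put back: after any point of a [k]-cycle of
    the reduced type or, for [k = 0], on its own as a fixed point. *)
Definition type_mult m k := if k == 0 then 1 else k * (m k).+1.

(** Only the factors of index [k] and [k.+1] differ. This is the identity that makes
    [#|A|! / type_weight m] satisfy the recursion [count_type_rec]. *)
Lemma type_weight_upd m k : k < b -> 0 < m k.+1 ->
  type_weight m * type_mult m k = type_weight (type_upd m k) * (k.+1 * m k.+1).
Proof.
move=> kb mk.
have k1b : k.+1 < b.+1 by [].
have kb1 : k < b.+1 by exact: ltnW.
rewrite /type_weight (bigD1 (Ordinal k1b)) //= [in RHS](bigD1 (Ordinal k1b)) //=.
rewrite (bigD1 (Ordinal kb1)) /=; last by rewrite -val_eqE /= ltn_eqF.
rewrite [in RHS](bigD1 (Ordinal kb1)) /=; last by rewrite -val_eqE /= ltn_eqF.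
rewrite type_upd_succ type_upd_same.
have -> : \prod_(i < b.+1 | (i != Ordinal k1b) && (i != Ordinal kb1))
      (i ^ type_upd m k i * (type_upd m k i)`!) =
    \prod_(i < b.+1 | (i != Ordinal k1b) && (i != Ordinal kb1)) (i ^ m i * (m i)`!).
  apply: eq_bigr => i /andP[]; rewrite -!val_eqE /= => i1 i2.
  by rewrite type_upd_other.
rewrite /type_mult; case: (m k.+1) mk => // p _ /=; rewrite expnS factS.
move: (\prod_(_ < _ | _) _) => P.
case: k {kb k1b kb1} => [|k] /=; first by nia.
by rewrite expnS factS; nia.
Qed.

Lemma type_size_upd m k : k < b -> 0 < m k.+1 ->
  (type_size (type_upd m k)).+1 = type_size m.
Proof.
move=> kb mk.
have k1b : k.+1 < b.+1 by [].
have kb1 : k < b.+1 by exact: ltnW.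
rewrite /type_size (bigD1 (Ordinal k1b)) //= [in RHS](bigD1 (Ordinal k1b)) //=.
rewrite (bigD1 (Ordinal kb1)) /=; last by rewrite -val_eqE /= ltn_eqF.
rewrite [in RHS](bigD1 (Ordinal kb1)) /=; last by rewrite -val_eqE /= ltn_eqF.
have -> : \sum_(i < b.+1 | (i != Ordinal k1b) && (i != Ordinal kb1)) i * type_upd m k i =
    \sum_(i < b.+1 | (i != Ordinal k1b) && (i != Ordinal kb1)) i * m i.
  apply: eq_bigr => i /andP[]; rewrite -!val_eqE /= => i1 i2.
  by rewrite type_upd_other.
rewrite type_upd_succ type_upd_same.
move: (\sum_(_ < _ | _) _) => S; case: (m k.+1) mk => // p _ /=.
by case: k {kb k1b kb1} => [|k] /=; nia.
Qed.

Lemma has_type_insert A s x y m : x \notin A -> perm_on A s -> y \in x |: A ->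
  let k := #|porbit s y :\ x| in k < b ->
  has_type (x |: A) (tperm x y * s)%g m = (0 < m k.+1) && has_type A s (type_upd m k).
Proof.
move=> xA sA yA k kb.
have h i : points_of_size (x |: A) (tperm x y * s)%g i + (i == k) * k
    = points_of_size A s i + (i == k.+1) * k.+1 := points_of_size_insert i xA sA yA.
have h1 := h k.+1; rewrite eqxx gtn_eqF // mul0n addn0 mul1n in h1.
have h0 := h k; rewrite eqxx ltn_eqF // mul0n addn0 mul1n in h0.
have h2 i : i != k.+1 -> i != k ->
    points_of_size (x |: A) (tperm x y * s)%g i = points_of_size A s i.
  by move=> /negPf i1 /negPf i0; have := h i; rewrite i1 i0 !mul0n !addn0.
have k1b : k.+1 < b.+1 by [].
have kb1 : k < b.+1 by exact: ltnW.
apply/forallP/andP => [H|[mk /forallP H] i].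
  have mk : 0 < m k.+1.
    have := eqP (H (Ordinal k1b)); rewrite /= h1.
    by case: (m k.+1) => //; rewrite muln0; lia.
  split=> //; apply/forallP => i; apply/eqP.
  have [ik1|ik1] := eqVneq (i : nat) k.+1.
    have := eqP (H i); rewrite ik1 h1 type_upd_succ.
    by case: (m k.+1) mk => // p _ /=; lia.
  have [ik|ik] := eqVneq (i : nat) k.
    have := eqP (H i); rewrite ik type_upd_same -h0 => ->.
    by case: (k) => [|k'] /=; lia.
  by rewrite type_upd_other // -(eqP (H i)) h2.
apply/eqP; have [ik1|ik1] := eqVneq (i : nat) k.+1.
  have := eqP (H i); rewrite ik1 h1 type_upd_succ.
  by case: (m k.+1) mk => // p _ /=; lia.
have [ik|ik] := eqVneq (i : nat) k.
  have := eqP (H i); rewrite ik type_upd_same -h0.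
  by case: (k) => [|k'] /=; lia.
by have := eqP (H i); rewrite h2 // type_upd_other.
Qed.

Lemma card_porbit_setD1 A s x k : x \notin A -> perm_on A s ->
  #|[set y in x |: A | #|porbit s y :\ x| == k]| =
  if k == 0 then 1 else points_of_size A s k.
Proof.
move=> xA sA; have sx := out_perm sA xA.
have px : porbit s x = [set x].
  apply/eqP; rewrite eqEsubset sub1set porbit_id andbT.
  by apply: porbit_sub_stable => [w|]; rewrite !inE // => /eqP ->; rewrite sx.
have pA y : y \in A -> porbit s y :\ x = porbit s y.
  move=> yA; apply/setP => w; rewrite !inE; case: eqP => // ->.
  apply/esym/negbTE; rewrite porbit_sym px inE; apply: contraNneq xA => <-//.
have [->|k0] := eqVneq k 0.
  rewrite -(cards1 x); congr #|pred_of_set _|; apply/setP => y; rewrite !inE.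
  have [->|yx] := eqVneq y x; first by rewrite px setDv cards0.
  case yA: (y \in A) => //=; rewrite pA //; exact/negbTE/card_porbit_neq0.
apply: eq_card => y; rewrite !inE.
have [->|yx] := eqVneq y x; last by case yA: (y \in A) => //=; rewrite pA.
by rewrite px setDv cards0 (negPf xA) eq_sym (negPf k0).
Qed.

(** The sum is sorted by the length [k.+1] of the cycle through [x]; removing [x] gives type
    [type_upd m k], and [type_mult m k] insertions lead back. *)
Lemma count_type_rec A x m : x \notin A ->
  \sum_(s | perm_on (x |: A) s) has_type (x |: A) s m =
  \sum_(k < b) (0 < m k.+1) * (type_mult m k *
     \sum_(s | perm_on A s) has_type A s (type_upd m k)).
Proof.
move=> xA; rewrite sum_perm_on_insert // exchange_big /=.
under [RHS]eq_bigr do rewrite big_distrr /= big_distrr /=.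
rewrite [RHS]exchange_big /=; apply: eq_bigr => s sA.
have kb y : y \in x |: A -> #|porbit s y :\ x| < b.
  move=> yA; apply: leq_trans Tb; apply: (@leq_trans #|x |: A|); last exact: max_card.
  have /subsetP h : porbit s y \subset x |: A.
    apply: porbit_sub_stable => // w; rewrite !inE => /orP[/eqP ->|wA].
      by rewrite (out_perm sA xA) eqxx.
    by rewrite perm_closed // wA orbT.
  rewrite cardsU1 xA add1n ltnS; apply: subset_leq_card; apply/subsetP => z.
  by rewrite !inE => /andP[/negPf zx /h]; rewrite !inE zx.
transitivity (\sum_(y in x |: A) \sum_(k < b | (k == #|porbit s y :\ x| :> nat))
    (0 < m k.+1) * has_type A s (type_upd m k)).
  apply: eq_bigr => y yA; rewrite has_type_insert ?kb //.
  by rewrite (big_pred1 (Ordinal (kb y yA))) ?mulnb.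
rewrite (exchange_big_dep xpredT) //=; apply: eq_bigr => k _.
rewrite sum_nat_const mulnCA; congr (_ * _).
have -> : #|[pred y in x |: A | k == #|porbit s y :\ x| :> nat]| =
    #|[set y in x |: A | #|porbit s y :\ x| == k]|.
  by apply: eq_card => y; rewrite !inE [_ == k :> nat]eq_sym.
rewrite card_porbit_setD1 // /type_mult; case: eqP => // k0.
case ht: (has_type _ _ _); last by rewrite !muln0.
have kb1 : k < b.+1 := leqW (ltn_ord k).
have /eqP := forallP ht (Ordinal kb1); rewrite /= => ->; rewrite !muln1 /type_upd.
by rewrite ltn_eqF // eqxx lt0n; case: eqP k0.
Qed.

(** Induction on [#|A|]: by [type_weight_upd] the summand of index [k] becomes [k.+1 * m k.+1 * a!],
    and these add up to [type_size m * a!]. *)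
Lemma count_type A m : m 0 = 0 -> type_size m = #|A| ->
  (\sum_(s | perm_on A s) has_type A s m) * type_weight m = #|A|`!.
Proof.
have [a Aa] : exists a, #|A| = a by exists #|A|.
elim: a A Aa m => [|a IH] A Aa m m0; rewrite Aa => szm.
  have mj (j : 'I_b.+1) : m j = 0.
    have [->|j0] := eqVneq (nat_of_ord j) 0; first by [].
    have : j * m j <= 0 by rewrite -szm /type_size (bigD1 j) //= leq_addr.
    by rewrite leqn0 muln_eq0 (negPf j0) => /eqP.
  have A0 : A = set0 by apply/eqP; rewrite -cards_eq0 Aa.
  have -> : type_weight m = 1 by apply: big1 => j _; rewrite mj.
  rewrite muln1.
  rewrite (big_pred1 1%g); last first.
    move=> s /=; apply/idP/eqP => [sA|->]; last exact: perm_on1.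
    by apply: (perm_on_id sA); rewrite Aa.
  apply/eqP; rewrite eqb1; apply/forallP => j; rewrite mj muln0.
  by rewrite /points_of_size cards_eq0 A0; apply/eqP/setP => z; rewrite !inE.
have [x xA] : exists x, x \in A by apply/card_gt0P; rewrite Aa.
have AE : A = x |: (A :\ x) by rewrite setD1K.
have xA' : x \notin A :\ x by rewrite !inE eqxx.
have A'a : #|A :\ x| = a by move: Aa; rewrite (cardsD1 x) xA => -[].
rewrite AE count_type_rec // big_distrl /=.
transitivity (\sum_(k < b) k.+1 * m k.+1 * a`!); last first.
  rewrite -big_distrl factS -szm /type_size big_ord_recl /= mul0n add0n.
  by congr (_ * _); apply: eq_bigr.
apply: eq_bigr => k _; case: (posnP (m k.+1)) => [->|mk]; first by rewrite muln0.
rewrite mul1n mulnAC [_ * type_weight m]mulnC type_weight_upd // mulnAC mulnC.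
congr (_ * _); rewrite mulnC -A'a; apply: IH => //.
  by rewrite /type_upd; case: (k : nat).
by apply: succn_inj; rewrite type_size_upd // szm A'a.
Qed.

End CycleTypeFormula.

Require Import Defs.
From mathcomp Require Import finmap multiset.
From mathcomp Require Import all_classical all_reals all_analysis.
From mathcomp Require Import ssrZ.
From mathcomp Require polyrcf.

Import Order.TTheory GRing.Theory Num.Theory.
Import numFieldNormedType.Exports.

Local Open Scope classical_set_scope.
Local Open Scope ring_scope.

(** * Convolution of sequences and the Euler operator *)

Section CauchyProduct.
Variable R : realType.
Implicit Types f g h : nat -> R.

Definition conv f g : nat -> R := fun n => \sum_(i < n.+1) f i * g (n - i)%N.
Definition unit0 : nat -> R := fun n => (n == 0)%:R.
Definition theta f : nat -> R := fun n => n%:R * f n.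
(** Division by zero gives 0, so the entry of index 0 is erased: [divn_seq] inverts [theta] up to
    the constant term. *)
Definition divn_seq f : nat -> R := fun n => f n / n%:R.

(** Each coefficient is one of a product of truncations, which transfers the ring laws from
    polynomials. *)
Lemma conv_poly N f g n : (n < N)%N ->
  conv f g n = ((\poly_(i < N) f i) * (\poly_(i < N) g i))`_n.
Proof.
move=> nN; rewrite coefM; apply: eq_bigr => i _; rewrite !coef_poly.
have iN : (i < N)%N by have := ltn_ord i; lia.
by rewrite iN (leq_ltn_trans (leq_subr _ _) nN).
Qed.

Lemma convC f g : conv f g = conv g f.
Proof. by apply/funext => n; rewrite !(@conv_poly n.+1) // mulrC. Qed.

Lemma convA f g h : conv f (conv g h) = conv (conv f g) h.
Proof.
apply/funext => n.
set P := fun u : nat -> R => \poly_(i < n.+1) u i.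
transitivity (P f * (P g * P h))`_n.
  rewrite coefM; apply: eq_bigr => i _.
  by rewrite coef_poly ltn_ord -conv_poly // ltnS leq_subr.
rewrite mulrA coefM; apply: eq_bigr => i _.
by rewrite -conv_poly // coef_poly ltnS leq_subr.
Qed.

Lemma conv1f g : conv unit0 g = g.
Proof.
apply/funext => n; rewrite /conv big_ord_recl /unit0 /= mul1r subn0 big1 ?addr0//.
by move=> i _; rewrite mul0r.
Qed.

Lemma convf1 g : conv g unit0 = g.
Proof. by rewrite convC conv1f. Qed.

Lemma convDl f g h : conv (fun n => f n + g n) h = fun n => conv f h n + conv g h n.
Proof.
by apply/funext => n; rewrite -big_split; apply: eq_bigr => i _; rewrite mulrDl.
Qed.

Lemma convZl a f g : conv (fun n => a * f n) g = fun n => a * conv f g n.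
Proof. by apply/funext => n; rewrite mulr_sumr; apply: eq_bigr => i _; rewrite mulrA. Qed.

Lemma convDr f g h : conv h (fun n => f n + g n) = fun n => conv h f n + conv h g n.
Proof. by rewrite convC convDl !(convC h). Qed.

Lemma convZr a f g : conv g (fun n => a * f n) = fun n => a * conv g f n.
Proof. by rewrite convC convZl !(convC g). Qed.

Lemma convBl f g h : conv (fun n => f n - g n) h = fun n => conv f h n - conv g h n.
Proof.
by apply/funext => n; rewrite -sumrB; apply: eq_bigr => i _; rewrite mulrBl.
Qed.

Lemma convBr f g h : conv h (fun n => f n - g n) = fun n => conv h f n - conv h g n.
Proof. by rewrite convC convBl !(convC h). Qed.

Lemma conv_coef0 f g : conv f g 0%N = f 0%N * g 0%N.
Proof. by rewrite /conv big_ord1. Qed.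

Lemma theta_conv f g :
  theta (conv f g) = fun n => conv (theta f) g n + conv f (theta g) n.
Proof.
apply/funext => n; rewrite /theta /conv mulr_sumr -big_split /=.
apply: eq_bigr => i _.
have -> : n%:R = i%:R + (n - i)%:R :> R.
  by rewrite -natrD subnKC // -ltnS.
by ring.
Qed.

Lemma divn_theta f : divn_seq (theta f) = fun n => f n - f 0%N * unit0 n.
Proof.
apply/funext => -[|n]; rewrite /divn_seq /theta /unit0 /= ?mul0r ?mulr1 ?subrr//.
by rewrite mulr0 subr0 mulrAC divff ?mul1r ?pnatr_eq0.
Qed.

Lemma theta_divn f : theta (divn_seq f) = fun n => f n - f 0%N * unit0 n.
Proof.
apply/funext => -[|n]; rewrite /divn_seq /theta /unit0 /= ?mul0r ?mulr1 ?subrr//.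
by rewrite mulr0 subr0 mulrCA divff ?mulr1 ?pnatr_eq0.
Qed.

Lemma divn_seqD f g : divn_seq (fun n => f n + g n) = fun n => divn_seq f n + divn_seq g n.
Proof. by apply/funext => n; rewrite /divn_seq mulrDl. Qed.

Lemma divn_seqB f g : divn_seq (fun n => f n - g n) = fun n => divn_seq f n - divn_seq g n.
Proof. by apply/funext => n; rewrite /divn_seq mulrBl. Qed.

(* Integration by parts for the Euler operator [theta]. *)
Lemma conv_divn f g : f 0%N * g 0%N = 0 ->
  conv f g = divn_seq (fun n => conv (theta f) g n + conv f (theta g) n).
Proof.
move=> fg0; rewrite -theta_conv divn_theta; apply/funext => n.
by rewrite conv_coef0 fg0 mul0r subr0.
Qed.

End CauchyProduct.

(** * Weighted summability as a measure of decay *)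

Section WeightedSummability.
Variable R : realType.
Implicit Types (a b c x y : R) (e f g : nat -> R).

(** The shift to [n.+1] keeps the weight positive at 0 and makes it submultiplicative for [a >= 0]
    ([wt_sub]). *)
Definition wt a (n : nat) : R := n.+1%:R `^ a.

Lemma wt_gt0 a n : 0 < wt a n.
Proof. by rewrite powR_gt0 // ltr0Sn. Qed.

Lemma wt_ge0 a n : 0 <= wt a n. Proof. exact/ltW/wt_gt0. Qed.

Lemma wtD a b n : wt (a + b) n = wt a n * wt b n.
Proof. by rewrite /wt powRD // pnatr_eq0 implybT. Qed.

Lemma wt0 n : wt 0 n = 1. Proof. by rewrite /wt powRr0. Qed.

Lemma wt1 n : wt 1 n = n.+1%:R. Proof. by rewrite /wt powRr1. Qed.

Lemma wtN a n : wt (- a) n = (wt a n)^-1. Proof. by rewrite /wt powRN. Qed.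

Lemma wtn m n : wt m%:R n = n.+1%:R ^+ m.
Proof. by rewrite /wt powR_mulrn. Qed.

Lemma wt_le a b n : a <= b -> wt a n <= wt b n.
Proof. by move=> ab; rewrite ler_powR // ler1n. Qed.

Lemma wt_mono a j n : 0 <= a -> (j <= n)%N -> wt a j <= wt a n.
Proof. by move=> a0 jn; rewrite /wt ge0_ler_powR ?nnegrE // ler_nat ltnS. Qed.

Lemma wt_anti a j n : a <= 0 -> (j <= n)%N -> wt a n <= wt a j.
Proof.
move=> a0 jn; rewrite -(opprK a) !(wtN (- a)) lef_pV2 ?posrE ?wt_gt0 //.
by rewrite wt_mono // oppr_ge0.
Qed.

Lemma wt_sub a j k : 0 <= a -> wt a (j + k) <= wt a j * wt a k.
Proof.
move=> a0; rewrite /wt -powRM // ge0_ler_powR ?nnegrE ?mulr_ge0 //.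
by rewrite -natrM ler_nat; nia.
Qed.

(** For [a >= 0] this condition is stable under [conv] without loss ([wsum_convp]), whereas
    pointwise bounds [O(n^-a)] with [a <= 1] are not. *)
Definition wsum a e := exists C, forall N, \sum_(n < N) `|e n| * wt a n <= C.

Lemma wsum_ge0 a e : wsum a e ->
  exists2 C, 0 <= C & forall N, \sum_(n < N) `|e n| * wt a n <= C.
Proof. by move=> [C hC]; exists C => //; have := hC 0%N; rewrite big_ord0. Qed.

Lemma wsum_dom a e f C : 0 <= C -> (forall n, `|f n| <= C * `|e n|) ->
  wsum a e -> wsum a f.
Proof.
move=> C0 fe [D hD]; exists (C * D) => N.
apply: (le_trans _ (ler_wpM2l C0 (hD N))); rewrite mulr_sumr.
by apply: ler_sum => i _; rewrite mulrA ler_wpM2r // wt_ge0.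
Qed.

Lemma wsum0 a : wsum a (fun _ => 0).
Proof. by exists 0 => N; rewrite big1 // => i _; rewrite normr0 mul0r. Qed.

Lemma wsumD a e f : wsum a e -> wsum a f -> wsum a (fun n => e n + f n).
Proof.
move=> [C hC] [D hD]; exists (C + D) => N.
apply: (le_trans _ (lerD (hC N) (hD N))); rewrite -big_split /=.
by apply: ler_sum => i _; rewrite -mulrDl ler_wpM2r ?wt_ge0 // ler_normD.
Qed.

Lemma wsumZ a c e : wsum a e -> wsum a (fun n => c * e n).
Proof.
by apply: (@wsum_dom _ _ _ `|c|) => // n; rewrite normrM.
Qed.

Lemma wsum_le a b e : a <= b -> wsum b e -> wsum a e.
Proof.
move=> ab [C hC]; exists C => N; apply: le_trans (hC N).
by apply: ler_sum => i _; rewrite ler_wpM2l // wt_le.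
Qed.

Lemma ler_sum_widen (u : nat -> R) m n : (forall i, 0 <= u i) -> (m <= n)%N ->
  \sum_(i < m) u i <= \sum_(i < n) u i.
Proof.
move=> u0 mn; rewrite -!(big_mkord xpredT u) (big_cat_nat (leq0n m) mn) /=.
by rewrite lerDl sumr_ge0.
Qed.

Lemma wsum_eventually a e f n0 : (forall n, (n0 <= n)%N -> e n = f n) ->
  wsum a e -> wsum a f.
Proof.
move=> ef he.
pose d n := if (n < n0)%N then `|f n - e n| else 0.
have hd : wsum a d.
  exists (\sum_(n < n0) `|d n| * wt a n) => N.
  have h n : 0 <= `|d n| * wt a n by rewrite mulr_ge0 // wt_ge0.
  apply: (le_trans (ler_sum_widen h (leq_maxr n0 N))).
  rewrite -!(big_mkord xpredT (fun n => `|d n| * wt a n)).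
  rewrite (big_cat_nat (leq0n n0) (leq_maxl n0 N)) /=.
  rewrite (@big_nat_cond _ _ _ n0) [X in _ + X]big1 ?addr0 //.
  by move=> i /andP[/andP[ni _] _]; rewrite /d ltnNge ni normr0 mul0r.
have hd2 : wsum a (fun n => `|e n| + d n).
  by apply: wsumD hd; apply: wsum_dom ler01 _ he => n; rewrite normr_id mul1r.
apply: wsum_dom ler01 _ hd2 => n; rewrite mul1r [X in _ <= X]ger0_norm; last first.
  by rewrite addr_ge0 // /d; case: ifP.
rewrite /d; case: ltnP => [_|n0n]; last by rewrite addr0 ef.
by rewrite -[X in `|X|](subrK (e n)) addrC (le_trans (ler_normD _ _)) // addrC.
Qed.

Lemma wsum_unit0 a : wsum a (@unit0 R).
Proof.
apply: (@wsum_eventually _ (fun=> 0) _ 1); last exact: wsum0.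
by case.
Qed.

Lemma sum_triangle (F : nat -> nat -> R) N :
  \sum_(n < N) \sum_(j < n.+1) F j (n - j)%N
  = \sum_(j < N) \sum_(k < N - j) F j k.
Proof.
elim: N => [|N IH]; first by rewrite !big_ord0.
rewrite big_ord_recr /= IH [in RHS]big_ord_recr /= subSnn big_ord1.
rewrite [in LHS](big_ord_recr N) /= subnn addrA -big_split /=; congr (_ + _).
apply: eq_bigr => j _; rewrite subSn; last exact/ltnW/ltn_ord.
by rewrite big_ord_recr.
Qed.

Lemma sum_triangle_le (F : nat -> nat -> R) N : (forall j k, 0 <= F j k) ->
  \sum_(n < N) \sum_(j < n.+1) F j (n - j)%N <= \sum_(j < N) \sum_(k < N) F j k.
Proof.
move=> F0; rewrite sum_triangle; apply: ler_sum => j _.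
by apply: (ler_sum_widen (F0 j)); rewrite leq_subr.
Qed.

(** Three independent exponents, since a periodic sequence is summable only against weights of
    exponent below [-1]. *)
Lemma wsum_conv a b c e f : (forall j k, wt c (j + k) <= wt a j * wt b k) ->
  wsum a e -> wsum b f -> wsum c (conv e f).
Proof.
move=> hw /wsum_ge0[C C0 hC] /wsum_ge0[D D0 hD]; exists (C * D) => N.
pose F j k := (`|e j| * wt a j) * (`|f k| * wt b k).
have F0 j k : 0 <= F j k by rewrite !mulr_ge0 ?wt_ge0.
apply: (@le_trans _ _ (\sum_(n < N) \sum_(j < n.+1) F j (n - j)%N)).
  apply: ler_sum => n _; rewrite /conv.
  apply: le_trans (ler_wpM2r (wt_ge0 _ _) (ler_norm_sum _ _ _)) _.
  rewrite mulr_suml; apply: ler_sum => j _; rewrite /F normrM.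
  rewrite [X in _ <= X]mulrACA ler_wpM2l ?mulr_ge0 //.
  by have := hw j (n - j)%N; rewrite subnKC // -ltnS.
apply: le_trans (sum_triangle_le _ F0) _.
under eq_bigr => j _ do rewrite -mulr_sumr.
by rewrite -mulr_suml; apply: ler_pM => //; rewrite sumr_ge0 // => i _; rewrite mulr_ge0 ?wt_ge0.
Qed.

Lemma wsum_convp a e f : 0 <= a -> wsum a e -> wsum a f -> wsum a (conv e f).
Proof. by move=> a0; apply: wsum_conv => j k; exact: wt_sub. Qed.

Lemma wsum_divn a e : wsum a e -> wsum (a + 1) (divn_seq e).
Proof.
move=> [C hC]; exists (2 * C) => N; apply: (le_trans _ (ler_wpM2l (ler0n _ 2) (hC N))).
rewrite mulr_sumr; apply: ler_sum => n _.
rewrite wtD wt1 /divn_seq normrM mulrACA [X in _ <= X]mulrC -subr_ge0 -mulrBr.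
rewrite mulr_ge0 ?mulr_ge0 ?wt_ge0 // subr_ge0 normfV ger0_norm //.
case: (n : nat) => [|k]; first by rewrite invr0 mul0r.
by rewrite mulrC ler_pdivrMr // -natrM ler_nat; lia.
Qed.

Lemma wsum_theta a e : wsum a e -> wsum (a - 1) (theta e).
Proof.
move=> [C hC]; exists C => N; apply: le_trans (hC N).
apply: ler_sum => n _; rewrite wtD wtN wt1 /theta normrM ger0_norm //.
rewrite [X in X <= _](_ : _ = `|e n| * wt a n * (n%:R / n.+1%:R)); last by ring.
rewrite ler_piMr ?mulr_ge0 ?wt_ge0 //.
by rewrite ler_pdivrMr // mul1r ler_nat.
Qed.

Lemma wsum_pointwise a e : wsum a e ->
  exists2 C, 0 <= C & forall n, `|e n| <= C * wt (- a) n.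
Proof.
move=> /wsum_ge0[C C0 hC]; exists C => // n.
rewrite wtN ler_pdivlMr ?wt_gt0 //; apply: le_trans (hC n.+1).
by rewrite big_ord_recr /= lerDr sumr_ge0 // => i _; rewrite mulr_ge0 ?wt_ge0.
Qed.

(** A Bernoulli inequality that also covers exponents [a < 1], at the price of [x / (1 + x)] in
    place of [x]. *)
Lemma powR1Dx x a : 0 < x -> 0 < a -> 1 + a * (x / (1 + x)) <= (1 + x) `^ a.
Proof.
move=> x0 a0; have x10 : 0 < 1 + x by rewrite addr_gt0.
have h : x / (1 + x) <= ln (1 + x).
  have := @le_ln1Dx R (- (x / (1 + x))) _.
  have -> : 1 + - (x / (1 + x)) = (1 + x)^-1 by field; lra.
  rewrite lnV ?posrE // lerN2; apply.
  by rewrite ltrN2 ltr_pdivrMr // mul1r; lra.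
rewrite /powR gt_eqF //; apply: le_trans (expR_ge1Dx _).
by rewrite lerD2l ler_pM2l.
Qed.

(** Integral comparison in telescoping form: [a * wt (- (1 + a)) M.+1 <= wt (- a) M - wt (- a)
    M.+1], by [powR1Dx] with [x = 1 / M.+1]. *)
Lemma wsum_zeta a : 0 < a -> exists C, forall N, \sum_(n < N) wt (- (1 + a)) n <= C.
Proof.
move=> a0; exists (1 + a^-1) => N.
suff h M : \sum_(n < M) wt (- (1 + a)) n.+1 <= a^-1 * (1 - wt (- a) M).
  case: N => [|N]; first by rewrite big_ord0 addr_ge0 // invr_ge0 (ltW a0).
  rewrite big_ord_recl lerD //; first by rewrite wtN /wt powR1 invr1.
  apply: le_trans (h N) _; rewrite ler_piMr ?invr_ge0 ?(ltW a0) //.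
  by rewrite gerBl wt_ge0.
elim: M => [|M IH].
  by rewrite big_ord0 wtN /wt powR1 invr1 subrr mulr0.
rewrite big_ord_recr /=; apply: (le_trans (lerD IH (lexx _))).
rewrite -lerBrDl -mulrBr ler_pdivlMl //.
rewrite [X in _ <= X](_ : _ = wt (- a) M - wt (- a) M.+1); last by ring.
rewrite opprD wtD mulrC !wtN wt1.
set y := wt a M; set z := wt a M.+1.
have y0 : 0 < y by exact: wt_gt0.
have z0 : 0 < z by exact: wt_gt0.
have hz : z >= y * (1 + a / M.+2%:R).
  have -> : z = y * (1 + M.+1%:R^-1) `^ a.
    rewrite /y /z /wt -powRM ?addr_ge0 ?invr_ge0 //.
    by rewrite mulrDr mulr1 divff // -natr1.
  rewrite ler_pM2l //; apply: le_trans (powR1Dx _ a0); last by rewrite invr_gt0.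
  rewrite lerD2l ler_pM2l // le_eqVlt; apply/orP; left; apply/eqP.
  rewrite -[M.+2%:R]natr1 -[M.+1%:R]natr1; have hM := ler0n R M.
  field.
  by apply/andP; split; lra.
have -> : y^-1 - z^-1 = (z - y) / y / z by field; rewrite !gt_eqF.
rewrite [X in X <= _](_ : _ = a / M.+2%:R / z); last by ring.
rewrite ler_pM2r ?invr_gt0 // ler_pdivlMr //.
by rewrite lerBrDr mulrC; move: hz; rewrite mulrDr mulr1 addrC.
Qed.

Lemma wsum_power a b C e : a + 1 < b -> (forall n, `|e n| <= C * wt (- b) n) -> wsum a e.
Proof.
move=> ab he; have [D hD] := @wsum_zeta (b - a - 1) ltac:(lra).
have C0 : 0 <= C.
  by rewrite -(@pmulr_lge0 _ (wt (- b) 0%N)) ?wt_gt0 // (le_trans _ (he 0%N)).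
exists (C * D) => N; apply: le_trans (ler_wpM2l C0 (hD N)).
rewrite mulr_sumr; apply: ler_sum => n _.
rewrite (_ : - (1 + (b - a - 1)) = - b + a); last by ring.
by rewrite wtD mulrA ler_wpM2r ?wt_ge0.
Qed.

End WeightedSummability.

(** * The span of multiple polylogarithm coefficients, and the bootstrap *)

Section PolylogSpan.
Variable R : realType.
Implicit Types (a b c : R) (e f g chi v : nat -> R).

Lemma limn_le (u : nat -> R) (l C : R) (n0 : nat) : u @ \oo --> l ->
  (forall n, (n0 <= n)%N -> u n <= C) -> l <= C.
Proof.
move=> ul uC; apply: (ler_cvg_to ul (cvg_cst C)); by exists n0.
Qed.

Lemma cvg_sum_ord N (F : nat -> nat -> R) (l : nat -> R) :
  (forall n, F n @ \oo --> l n) ->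
  (fun M => \sum_(n < N) F n M) @ \oo --> \sum_(n < N) l n.
Proof.
by move=> h; apply: (cvg_big (@add_continuous _)) => i _; exact: h.
Qed.

Lemma periodic_seq_bounded chi : periodic_seq chi ->
  exists2 C, 0 <= C & forall n, `|chi n| <= C.
Proof.
move=> [p p0 hp]; exists (\sum_(i < p) `|chi i|); first exact: sumr_ge0.
move=> n; have -> : chi n = chi (n %% p)%N.
  rewrite {1}(divn_eq n p) addnC; elim: (n %/ p)%N => [|k IH]; first by rewrite addn0.
  by rewrite mulSn addnCA addnC hp.
by rewrite (bigD1 (Ordinal (ltn_pmod n p0))) //= lerDl sumr_ge0.
Qed.

Lemma wsum_periodic chi a : periodic_seq chi -> a < -1 -> wsum a chi.
Proof.
move=> /periodic_seq_bounded[C C0 hC] a1.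
apply: (@wsum_power _ _ 0 C); first lra.
by move=> n; rewrite oppr0 wt0 mulr1.
Qed.

Lemma periodic_cst c : periodic_seq (fun _ => c).
Proof. by exists 1%N. Qed.

Lemma wsum_is_cvg chi e : periodic_seq chi -> wsum 0 e ->
  forall (s : nat -> nat), cvgn (series (fun k => e k * chi (s k))).
Proof.
move=> /periodic_seq_bounded[B B0 hB] [C hC] s.
apply: normed_cvg; apply: nondecreasing_is_cvgn.
  by apply: nondecreasing_series => n _ _; rewrite normr_ge0.
exists (C * B) => _ [N _ <-]; rewrite /= seriesEord /=.
apply: (@le_trans _ _ (\sum_(k < N) `|e k| * B)).
  by apply: ler_sum => k _; rewrite normrM ler_wpM2l.
rewrite -mulr_suml ler_wpM2r //; apply: le_trans (hC N).
by apply: ler_sum => k _; rewrite wt0 mulr1.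
Qed.

(* For [a >= 0] the periodic part is [n |-> \sum_k e k * chi (n - k)]; the argument
   of [chi] is shifted by [p * k] to stay in [nat]. *)
Lemma conv_periodic chi e a eps : periodic_seq chi -> 0 < eps -> wsum a e ->
  exists2 per, periodic_seq per &
    wsum (a - 1 - eps) (fun n => conv chi e n - per n).
Proof.
move=> hchi eps0 he; case: (ltP a 0) => a0.
  (* For [a < 0] no periodic part is needed: the loss [1 + eps] is what [chi] itself costs. *)
  exists (fun=> 0); first exact: periodic_cst.
  under [X in wsum _ X]funext do rewrite subr0.
  apply: (@wsum_conv _ (-1 - eps) a _ _ _ _ (wsum_periodic hchi _) he); last by lra.
  move=> j k; rewrite (_ : a - 1 - eps = -1 - eps + a); last by ring.
  by rewrite wtD ler_pM ?wt_ge0 // wt_anti ?leq_addr ?leq_addl //; lra.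
have he0 : wsum 0 e by exact: wsum_le he.
have [p p0 hp] := hchi.
pose s n k := (n + p.-1 * k)%N.
pose S n M := series (fun k => e k * chi (s n k)) M.
pose per n := limn (S n).
have Sper n : S n @ \oo --> per n by exact: (wsum_is_cvg hchi he0).
exists per.
  exists p => // n; rewrite /per; congr (limn _); apply/funext => M.
  rewrite /S !seriesEord /=; apply: eq_bigr => k _.
  by rewrite /s addnAC hp.
have [B B0 hB] := periodic_seq_bounded hchi.
have [C C0 hC] := wsum_ge0 he.
have [D hD] := wsum_zeta eps0.
exists (B * (C * D)) => N.
(* [n + p.-1 * k] and [n - k] are congruent modulo [p], so the terms with [k <= n] cancel and only
   the tail [k > n] remains. *)
have convE n M : (n < M)%N ->
    conv chi e n - S n M = - \sum_(k < M | (n < k)%N) e k * chi (s n k).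
  move=> nM; rewrite convC /conv /S seriesEord /=.
  rewrite (bigID (fun k : 'I_M => (n < k)%N)) /= opprD addrCA.
  rewrite -[RHS]addr0; congr (_ + _).
  rewrite (big_ord_widen M (fun k => e k * chi (n - k)%N)) //.
  under [X in _ - X]eq_bigl => k do rewrite -leqNgt -ltnS.
  rewrite -sumrB; apply: big1 => k; rewrite ltnS => kn; rewrite -mulrBr.
  have -> : s n k = (n - k + k * p)%N by rewrite /s; nia.
  suff -> : chi (n - k + k * p)%N = chi (n - k)%N by rewrite subrr mulr0.
  elim: (k : nat) (n - k)%N => [|j IH] m; first by rewrite addn0.
  by rewrite mulSn addnCA addnC hp.
pose w n := wt (a - 1 - eps) n.
have w0 n : 0 <= w n by exact: wt_ge0.
(* It suffices to bound the error against the partial sums [S n M], uniformly in [M]. *)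
apply: (@limn_le (fun M => \sum_(n < N) `|conv chi e n - S n M| * w n) _ _ N).
  apply: (@cvg_sum_ord N (fun n M => `|conv chi e n - S n M| * w n)
    (fun n => `|conv chi e n - per n| * w n)) => n.
  apply: cvgM; last exact: cvg_cst.
  by apply: cvg_norm; apply: cvgB; [exact: cvg_cst|exact: Sper].
move=> M NM.
(* In the tail [n < k], so [wt a n <= wt a k] goes to [e]; the leftover [wt (- (1 + eps)) n] makes
   the sum over [n] converge and is the loss in the statement. *)
apply: (@le_trans _ _ (\sum_(k < M) (B * `|e k|) * (wt a k * \sum_(n < N) wt (- (1 + eps)) n))).
  under [X in _ <= X]eq_bigr do rewrite !mulr_sumr.
  rewrite [X in _ <= X]exchange_big /=; apply: ler_sum => n _.
  rewrite convE ?(leq_trans (ltn_ord n)) // normrN.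
  apply: le_trans (ler_wpM2r (w0 _) (ler_norm_sum _ _ _)) _.
  rewrite big_mkcond /= mulr_suml; apply: ler_sum => k _.
  case: ltnP => nk; last by rewrite mul0r !mulr_ge0 ?wt_ge0.
  rewrite normrM (mulrC `|e k|) /w (_ : a - 1 - eps = a + - (1 + eps)); last by ring.
  rewrite wtD ler_pM ?mulr_ge0 ?wt_ge0 //; first by rewrite ler_wpM2r.
  by rewrite ler_wpM2r ?wt_ge0 // wt_mono // ltnW.
rewrite [X in X <= _](_ : _ = B * ((\sum_(k < M) `|e k| * wt a k) * \sum_(n < N) wt (- (1 + eps)) n)).
  rewrite ler_wpM2l // ler_pM ?sumr_ge0 // => i _; rewrite ?mulr_ge0 ?wt_ge0 //.
by rewrite !mulr_suml mulr_sumr; apply: eq_bigr => k _; ring.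
Qed.

(** On generating functions [divn_seq] is integration against [dz / z], and convolution with [chi]
    is multiplication by a rational function with poles at roots of unity; the elements are iterated
    integrals, that is, words in these letters. *)
Inductive polylog_span : (nat -> R) -> Prop :=
| Polylog_unit0 : polylog_span (@unit0 R)
| Polylog_divn f : polylog_span f -> polylog_span (divn_seq f)
| Polylog_conv chi f : periodic_seq chi -> polylog_span f ->
    polylog_span (divn_seq (conv chi f))
| Polylog_comb c f g : polylog_span f -> polylog_span g ->
    polylog_span (fun n => c * f n + g n).

Lemma polylog0 : polylog_span (fun _ => 0).
Proof.
rewrite (_ : (fun _ => 0) = fun n => -1 * @unit0 R n + @unit0 R n).
  exact: Polylog_comb Polylog_unit0 Polylog_unit0.
by apply/funext => n; rewrite mulN1r addNr.
Qed.

Lemma polylogD f g : polylog_span f -> polylog_span g ->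
  polylog_span (fun n => f n + g n).
Proof.
move=> hf hg; rewrite (_ : (fun n => _) = fun n => 1 * f n + g n).
  exact: Polylog_comb.
by apply/funext => n; rewrite mul1r.
Qed.

Lemma polylogZ c f : polylog_span f -> polylog_span (fun n => c * f n).
Proof.
move=> hf; rewrite (_ : (fun n => _) = fun n => c * f n + 0).
  by apply: Polylog_comb => //; exact: polylog0.
by apply/funext => n; rewrite addr0.
Qed.

Lemma polylogB f g : polylog_span f -> polylog_span g ->
  polylog_span (fun n => f n - g n).
Proof.
move=> hf hg; rewrite (_ : (fun n => _) = fun n => -1 * g n + f n).
  exact: Polylog_comb.
by apply/funext => n; rewrite mulN1r addrC.
Qed.

(** One-sided integration by parts: in one term the word loses its outer letter, in the other [g] is
    differentiated. It serves both for two words and for a word against an error. *)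
Lemma conv_divn_l f g : conv (divn_seq f) g =
  divn_seq (fun n => conv f g n - f 0%N * g n + conv (divn_seq f) (theta g) n).
Proof.
rewrite conv_divn; last by rewrite /divn_seq invr0 mulr0 mul0r.
by rewrite theta_divn convBl convZl conv1f.
Qed.

(* The shuffle product of multiple polylogarithms. *)
Lemma polylog_conv f g : polylog_span f -> polylog_span g -> polylog_span (conv f g).
Proof.
move=> hf; elim: hf g => {f}
  [|f hf IH|chi f hchi hf IH|c f1 f2 hf1 IH1 hf2 IH2] g hg.
- by rewrite conv1f.
- elim: hg => {g} [|g hg IHg|chi g hchi hg IHg|c g1 g2 hg1 IHg1 hg2 IHg2].
  + by rewrite convf1; exact: Polylog_divn.
  + rewrite conv_divn_l theta_divn convBr convZr convf1.
    apply: Polylog_divn; apply: polylogD; apply: polylogB.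
    * by apply: IH; exact: Polylog_divn.
    * by apply: polylogZ; exact: Polylog_divn.
    * exact: IHg.
    * by apply: polylogZ; exact: Polylog_divn.
  + rewrite conv_divn_l theta_divn convBr convZr convf1 divn_seqD !divn_seqB.
    rewrite [conv (divn_seq f) (conv chi g)]convA (convC _ chi) -convA.
    have hg' : polylog_span (divn_seq (conv chi g)) by exact: Polylog_conv.
    apply: polylogD; apply: polylogB.
    * by apply: Polylog_divn; apply: IH.
    * by apply: Polylog_divn; apply: polylogZ.
    * exact: Polylog_conv.
    * by apply: Polylog_divn; apply: polylogZ; exact: Polylog_divn.
  + by rewrite convDr convZr; exact: Polylog_comb.
- elim: hg => {g} [|g hg IHg|chi' g hchi' hg IHg|c g1 g2 hg1 IHg1 hg2 IHg2].
  + by rewrite convf1; exact: Polylog_conv.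
  + rewrite conv_divn_l theta_divn convBr convZr convf1 divn_seqD !divn_seqB.
    rewrite -convA.
    have hg' : polylog_span (divn_seq g) by exact: Polylog_divn.
    have hf' : polylog_span (divn_seq (conv chi f)) by exact: Polylog_conv.
    apply: polylogD; apply: polylogB.
    * by apply: Polylog_conv => //; apply: IH.
    * by apply: Polylog_divn; apply: polylogZ.
    * exact: Polylog_divn.
    * by apply: Polylog_divn; apply: polylogZ.
  + rewrite conv_divn_l theta_divn convBr convZr convf1 divn_seqD !divn_seqB.
    rewrite -convA [conv (divn_seq _) (conv chi' g)]convA.
    rewrite [conv (divn_seq _) chi']convC -[conv (conv chi' _) _]convA.
    have hg' : polylog_span (divn_seq (conv chi' g)) by exact: Polylog_conv.
    have hf' : polylog_span (divn_seq (conv chi f)) by exact: Polylog_conv.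
    apply: polylogD; apply: polylogB.
    * by apply: Polylog_conv => //; apply: IH.
    * by apply: Polylog_divn; apply: polylogZ.
    * exact: Polylog_conv.
    * by apply: Polylog_divn; apply: polylogZ.
  + by rewrite convDr convZr; exact: Polylog_comb.
- by rewrite convDl convZl; apply: Polylog_comb; [exact: IH1|exact: IH2].
Qed.

(** A periodic convolution costs a little more than one power of [n], and the division after it
    returns exactly one. *)
Lemma polylog_wsum v eps : 0 < eps -> polylog_span v -> wsum (- eps) v.
Proof.
move=> eps0 hv; elim: hv eps eps0 => {v}
  [|v hv IH|chi v hchi hv IH|c v1 v2 hv1 IH1 hv2 IH2] eps eps0.
- exact: wsum_unit0.
- by apply: wsum_le (wsum_divn (IH _ eps0)); rewrite lerDl.
- have e2 : 0 < eps / 2 by rewrite divr_gt0.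
  rewrite -[- eps](subrK 1); apply: wsum_divn.
  apply: (@wsum_conv _ (-1 - eps / 2) (- (eps / 2))).
  + move=> j k; rewrite (_ : - eps - 1 = (-1 - eps / 2) + - (eps / 2)); last by field.
    by rewrite wtD ler_pM ?wt_ge0 // wt_anti ?leq_addr ?leq_addl //; lra.
  + by apply: wsum_periodic => //; lra.
  + exact: IH.
- by apply: wsumD; [apply: wsumZ; exact: IH1|exact: IH2].
Qed.

Definition near_polylog a f := exists2 v, polylog_span v & wsum a (fun n => f n - v n).

Lemma near_polylog_wsum a f : wsum a f -> near_polylog a f.
Proof.
move=> hf; exists (fun _ => 0); first exact: polylog0.
by under [X in wsum _ X]funext do rewrite subr0.
Qed.

Lemma near_polylog_span a f : polylog_span f -> near_polylog a f.
Proof.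
move=> hf; exists f => //.
by under [X in wsum _ X]funext do rewrite subrr; exact: wsum0.
Qed.

Lemma near_polylogD a f g : near_polylog a f -> near_polylog a g ->
  near_polylog a (fun n => f n + g n).
Proof.
move=> [v hv fv] [w hw gw]; exists (fun n => v n + w n); first exact: polylogD.
rewrite (_ : (fun n => _) = fun n => (f n - v n) + (g n - w n)); first exact: wsumD.
by apply/funext => n; ring.
Qed.

Lemma near_polylogZ a c f : near_polylog a f -> near_polylog a (fun n => c * f n).
Proof.
move=> [v hv fv]; exists (fun n => c * v n); first exact: polylogZ.
rewrite (_ : (fun n => _) = fun n => c * (f n - v n)); first exact: wsumZ.
by apply/funext => n; ring.
Qed.

Lemma near_polylogB a f g : near_polylog a f -> near_polylog a g ->
  near_polylog a (fun n => f n - g n).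
Proof.
move=> hf hg; rewrite (_ : (fun n => _) = fun n => f n + -1 * g n).
  by apply: near_polylogD => //; exact: near_polylogZ.
by apply/funext => n; ring.
Qed.

Lemma near_polylog_le a b f : a <= b -> near_polylog b f -> near_polylog a f.
Proof. by move=> ab [v hv fv]; exists v => //; exact: wsum_le fv. Qed.

Lemma near_polylog_divn a f : near_polylog a f -> near_polylog (a + 1) (divn_seq f).
Proof.
move=> [v hv fv]; exists (divn_seq v); first exact: Polylog_divn.
by rewrite -divn_seqB; exact: wsum_divn.
Qed.

(* Induction on [v], and for fixed [v] on the ceiling [q] of [a]: one step of
   [conv_divn] lowers either the word [v] or the decay rate of [e]. *)
Lemma conv_polylog_wsum v eps a e : polylog_span v -> 0 < eps -> wsum a e ->
  near_polylog (a - eps) (conv v e).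
Proof.
move=> hv; elim: hv eps a e => {v}
  [|v hv IH|chi v hchi hv IH|c v1 v2 hv1 IH1 hv2 IH2] eps a e eps0 he.
- by rewrite conv1f; apply: near_polylog_wsum; apply: wsum_le he; lra.
- have [q aq] : exists q : nat, a <= q%:R.
    by exists (Num.truncn a).+1; exact/ltW/truncnS_gt.
  elim: q a aq e he => [|q IHq] a aq e he.
    (* For [a <= 0] both exponents are nonpositive, so [wsum_conv] applies and the product is a pure
       error. *)
    apply: near_polylog_wsum; apply: (@wsum_conv _ (- eps) a) => //.
      move=> j k; rewrite addrC wtD ler_pM ?wt_ge0 // wt_anti ?leq_addr ?leq_addl //; lra.
    by apply: polylog_wsum => //; exact: Polylog_divn.
  rewrite conv_divn_l -[a - eps](subrK 1); apply: near_polylog_divn.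
  apply: near_polylogD.
    apply: near_polylogB.
      by apply: near_polylog_le (IH _ _ _ eps0 he); lra.
    by apply: near_polylogZ; apply: near_polylog_wsum; apply: wsum_le he; lra.
  rewrite (_ : a - eps - 1 = a - 1 - eps); last by ring.
  apply: IHq; last exact: wsum_theta.
  by rewrite lerBlDr natr1.
- have [q aq] : exists q : nat, a <= q%:R.
    by exists (Num.truncn a).+1; exact/ltW/truncnS_gt.
  elim: q a aq e he => [|q IHq] a aq e he.
    apply: near_polylog_wsum; apply: (@wsum_conv _ (- eps) a) => //.
      move=> j k; rewrite addrC wtD ler_pM ?wt_ge0 // wt_anti ?leq_addr ?leq_addl //; lra.
    by apply: polylog_wsum => //; exact: Polylog_conv.
  rewrite conv_divn_l divn_seqD divn_seqB; apply: near_polylogD; first apply: near_polylogB.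
  (* The loss [eps] is shared between the induction hypothesis and [conv_periodic]. The periodic
     part of the latter, divided by [n], is itself a word: [divn_seq (conv per unit0)]. *)
  + rewrite -convA; have e2 : 0 < eps / 2 by rewrite divr_gt0.
    have [w hw ew] := IH _ _ _ e2 he.
    have [per hper hp] := conv_periodic hchi e2 ew.
    exists (fun n => divn_seq (conv chi w) n + divn_seq per n).
      apply: polylogD; first exact: Polylog_conv.
      by rewrite -[per]convf1; apply: Polylog_conv => //; exact: Polylog_unit0.
    rewrite (_ : (fun n => _) = divn_seq (fun n => conv chi (conv v e) n - (conv chi w n + per n))).
      2: by rewrite divn_seqB divn_seqD.
    rewrite -[a - eps](subrK 1); apply: wsum_divn.
    rewrite (_ : (fun n => _) = fun n => conv chi (fun n => conv v e n - w n) n - per n).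
      by rewrite (_ : _ - _ - _ = a - eps / 2 - 1 - eps / 2) //; field.
    by rewrite convBr; apply/funext => n; ring.
  + rewrite -[a - eps](subrK 1); apply: near_polylog_divn; apply: near_polylogZ.
    by apply: near_polylog_wsum; apply: wsum_le he; lra.
  + rewrite -[a - eps](subrK 1); apply: near_polylog_divn.
    rewrite (_ : a - eps - 1 = a - 1 - eps); last by ring.
    apply: IHq; last exact: wsum_theta.
    by rewrite lerBlDr natr1.
- rewrite convDl convZl; apply: near_polylogD; first apply: near_polylogZ.
    exact: IH1.
  exact: IH2.
Qed.

(** With [h = u + eta] and [W = v + e], the product [conv u v] stays in the span and only [conv u e]
    costs the [1/2]; [eta] is taken one power smaller so that [conv v eta] keeps accuracy [a]. *)
Lemma near_polylog_conv h W a : 0 <= a ->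
  (forall b, near_polylog b h) -> near_polylog a W -> near_polylog (a - 2^-1) (conv h W).
Proof.
move=> a0 hh [v hv We]; have [u hu he] := hh (a + 1).
pose e n := W n - v n; pose eta n := h n - u n.
rewrite (_ : conv h W = fun n => (conv u v n + conv u e n) + (conv v eta n + conv eta e n)).
  apply: near_polylogD; apply: near_polylogD.
  - by apply: near_polylog_span; exact: polylog_conv.
  - by apply: conv_polylog_wsum => //; rewrite invr_gt0.
  - have := @conv_polylog_wsum v 1 (a + 1) eta hv ltr01 he.
    by rewrite addrK; apply: near_polylog_le; rewrite gerBl invr_ge0.
  - apply: near_polylog_wsum; apply: (@wsum_le _ _ a); first by rewrite gerBl invr_ge0.
    by apply: wsum_convp => //; apply: wsum_le he; rewrite lerDl.
have hE : h = fun n => u n + eta n by apply/funext => n; rewrite /eta addrC subrK.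
have WE : W = fun n => v n + e n by apply/funext => n; rewrite /e addrC subrK.
rewrite [in LHS]hE [in LHS]WE; move: (e) (eta) => e' eta'.
rewrite convDl !convDr (convC v).
by apply/funext => n; ring.
Qed.

(* Each pass through [theta W = conv h W] improves the accuracy by [1/2]. *)
Lemma near_polylog_bootstrap h W : theta W = conv h W -> wsum 0 W ->
  (forall b, near_polylog b h) -> forall a, near_polylog a W.
Proof.
move=> hW W0 hh.
suff H q : near_polylog (q%:R / 2) W.
  move=> a; apply: near_polylog_le (H (Num.truncn (2 * a)).+1).
  by rewrite ler_pdivlMr // mulrC; exact/ltW/truncnS_gt.
elim: q => [|q IH]; first by rewrite mul0r; exact: near_polylog_wsum.
rewrite (_ : W = fun n => W 0%N * @unit0 R n + divn_seq (conv h W) n).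
  apply: near_polylogD.
    by apply: near_polylogZ; apply: near_polylog_span; exact: Polylog_unit0.
  rewrite (_ : q.+1%:R / 2 = q%:R / 2 - 2^-1 + 1); last first.
    by rewrite -natr1; field.
  by apply: near_polylog_divn; apply: near_polylog_conv => //; rewrite divr_ge0.
by rewrite -hW divn_theta; apply/funext => n; rewrite addrC subrK.
Qed.

End PolylogSpan.

(** * Expansions in powers of [ln n] and [1 / n] with periodic coefficients *)

Section LogExpansion.
Variable R : realType.
Implicit Types (a b c : R) (e f g t chi : nat -> R) (s r i p : nat).

Lemma ln_nat_ge0 (n : nat) : 0 <= ln (n%:R : R).
Proof. by case: n => [|n]; [rewrite ln0|rewrite ln_ge0 // ler1n]. Qed.

Lemma ln_nat_bound i eps : 0 < eps ->
  exists2 C, 0 <= C & forall n, ln (n%:R : R) ^+ i <= C * wt eps n.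
Proof.
move=> e0; case: i => [|i].
  by exists 1 => // n; rewrite expr0 mul1r -(wt0 R n) wt_le // ltW.
pose d := eps / i.+1%:R; have d0 : 0 < d by rewrite divr_gt0.
exists (d^-1 ^+ i.+1); first by rewrite exprn_ge0 // invr_ge0 ltW.
move=> n; have -> : wt eps n = wt d n ^+ i.+1.
  by rewrite /wt -powR_mulrn ?powR_ge0 // -powRrM /d divfK // pnatr_eq0.
rewrite -exprMn lerXn2r ?nnegrE ?ln_nat_ge0 ?mulr_ge0 ?invr_ge0 ?wt_ge0 ?(ltW d0) //.
apply: (@le_trans _ _ (ln n.+1%:R)).
  case: n => [|n]; first by rewrite ln0 // ln_nat_ge0.
  by rewrite ler_ln ?posrE ?ltr0Sn // ler_nat.
rewrite ler_pdivlMl // /wt -ln_powR; apply/ltW/ln_sublinear.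
by rewrite powR_gt0.
Qed.

Inductive log_span s : (nat -> R) -> Prop :=
| Log_term chi i r : periodic_seq chi -> (s <= r)%N ->
    log_span s (fun n => chi n * ln n%:R ^+ i / n%:R ^+ r)
| Log_add f g : log_span s f -> log_span s g -> log_span s (fun n => f n + g n).

Lemma periodic_comb chi chi' (op : R -> R -> R) :
  periodic_seq chi -> periodic_seq chi' -> periodic_seq (fun n => op (chi n) (chi' n)).
Proof.
move=> [p p0 hp] [q q0 hq]; exists (p * q)%N; first by rewrite muln_gt0 p0.
move=> n; congr op.
  by elim: q {q0 hq} n => [|q IH] n; rewrite ?muln0 ?addn0 // mulnS addnA IH hp.
by elim: p {p0 hp} n => [|p IH] n; rewrite ?mul0n ?addn0 // mulSn addnA IH hq.
Qed.

Lemma log_span_le s s' t : (s' <= s)%N -> log_span s t -> log_span s' t.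
Proof.
move=> ss; elim => [chi i r hchi sr|f g _ IHf _ IHg]; last exact: Log_add.
by apply: Log_term => //; exact: leq_trans sr.
Qed.

Lemma log_span_periodic s chi t : periodic_seq chi -> log_span s t ->
  log_span s (fun n => chi n * t n).
Proof.
move=> hchi; elim => [chi' i r hchi' sr|f g _ IHf _ IHg].
  rewrite (_ : (fun n => _) = fun n => (chi n * chi' n) * ln n%:R ^+ i / n%:R ^+ r).
    by apply: Log_term => //; exact: periodic_comb.
  by apply/funext => n; rewrite !mulrA.
rewrite (_ : (fun n => _) = fun n => chi n * f n + chi n * g n); first exact: Log_add.
by apply/funext => n; rewrite mulrDr.
Qed.

Lemma log_spanZ s c t : log_span s t -> log_span s (fun n => c * t n).
Proof. by apply: log_span_periodic; exact: periodic_cst. Qed.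

Lemma log_spanE s i r : (s <= r)%N -> log_span s (fun n => ln n%:R ^+ i / n%:R ^+ r).
Proof.
move=> sr; rewrite (_ : (fun n => _) = fun n => 1 * ln n%:R ^+ i / n%:R ^+ r).
  by apply: Log_term => //; exact: periodic_cst.
by apply/funext => n; rewrite mul1r.
Qed.

Lemma log_span_per chi : periodic_seq chi -> log_span 0 chi.
Proof.
move=> hchi; rewrite (_ : chi = fun n => chi n * ln n%:R ^+ 0 / n%:R ^+ 0).
  exact: Log_term.
by apply/funext => n; rewrite !expr0 divr1 mulr1.
Qed.

Lemma log_span0 s : log_span s (fun _ => 0).
Proof.
rewrite (_ : (fun _ => 0) = fun n : nat => 0 * (ln n%:R ^+ 0 / n%:R ^+ s)).
  by apply: log_spanZ; exact: log_spanE.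
by apply/funext => n; rewrite mul0r.
Qed.

Lemma log_span_sum s I (l : seq I) (F : I -> nat -> R) :
  (forall j, log_span s (F j)) -> log_span s (fun n => \sum_(j <- l) F j n).
Proof.
move=> hF; elim: l => [|j l IH].
  rewrite (_ : (fun n => _) = fun=> 0); first exact: log_span0.
  by apply/funext => n; rewrite big_nil.
rewrite (_ : (fun n => _) = fun n => F j n + \sum_(k <- l) F k n).
  exact: Log_add.
by apply/funext => n; rewrite big_cons.
Qed.

Lemma log_spanM s s' t t' : log_span s t -> log_span s' t' ->
  log_span (s + s') (fun n => t n * t' n).
Proof.
move=> ht ht'; elim: ht => [chi i r hchi sr|f g _ IHf _ IHg]; last first.
  rewrite (_ : (fun n => _) = fun n => f n * t' n + g n * t' n); first exact: Log_add.
  by apply/funext => n; rewrite mulrDl.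
elim: ht' => [chi' i' r' hchi' sr'|f g _ IHf _ IHg]; last first.
  pose u n := chi n * ln n%:R ^+ i / n%:R ^+ r.
  rewrite (_ : (fun n => _) = fun n => u n * f n + u n * g n); first exact: Log_add.
  by apply/funext => n; rewrite mulrDr.
rewrite (_ : (fun n => _) = fun n =>
  (chi n * chi' n) * ln n%:R ^+ (i + i') / n%:R ^+ (r + r')).
  by apply: Log_term; [exact: periodic_comb|exact: leq_add].
by apply/funext => n; rewrite !exprD invfM; ring.
Qed.

Lemma log_span_bound s t eps : 0 < eps -> log_span s t ->
  exists2 C, 0 <= C & forall n, `|t n| <= C * wt (eps - s%:R) n.
Proof.
move=> e0; elim => [chi i r hchi sr|f g _ [C C0 hC] _ [D D0 hD]]; last first.
  exists (C + D) => [|n]; first exact: addr_ge0.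
  by rewrite mulrDl (le_trans (ler_normD _ _)) // lerD.
have [B B0 hB] := periodic_seq_bounded hchi.
have [C C0 hC] := ln_nat_bound i e0.
exists (B * C * 2 ^+ r) => [|n]; first by rewrite !mulr_ge0.
rewrite !normrM !normrX normfV normrX (ger0_norm (ln_nat_ge0 n)) (ger0_norm (ler0n R n)).
rewrite wtD [X in _ <= X](_ : _ = (B * (C * wt eps n)) * (2 ^+ r * wt (- s%:R) n)); last by ring.
apply: ler_pM; rewrite ?mulr_ge0 ?invr_ge0 ?exprn_ge0 ?ln_nat_ge0 //.
  by rewrite ler_pM ?exprn_ge0 ?ln_nat_ge0.
apply: (@le_trans _ _ (2 ^+ r * wt (- r%:R) n)).
  rewrite wtN wtn; case: n => [|n].
    rewrite expr1n invr1 mulr1; case: r {sr} => [|r]; first by rewrite expr0 invr1.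
    by rewrite expr0n invr0 exprn_ge0.
  rewrite ler_pdivlMr ?exprn_gt0 // mulrC ler_pdivrMr ?exprn_gt0 //.
  rewrite -exprMn lerXn2r ?nnegrE ?mulr_ge0 // -natrM ler_nat; lia.
by rewrite ler_wpM2l ?exprn_ge0 // wt_le // lerN2 ler_nat.
Qed.

Lemma wsum_mul a c C t e : 0 <= C -> (forall n, `|t n| <= C * wt c n) ->
  wsum (a + c) e -> wsum a (fun n => t n * e n).
Proof.
move=> C0 ht [D hD]; exists (C * D) => N.
apply: (le_trans _ (ler_wpM2l C0 (hD N))); rewrite mulr_sumr.
apply: ler_sum => n _; rewrite normrM wtD.
rewrite [X in _ <= X](_ : _ = C * wt c n * `|e n| * wt a n); last by ring.
by rewrite !ler_wpM2r ?wt_ge0.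
Qed.

(** The approximant may change entirely with the accuracy [a]; that the different ones agree is a
    separate matter, settled by uniqueness. *)
Definition log_expansion s f :=
  forall a, exists2 t, log_span s t & wsum a (fun n => f n - t n).

Lemma log_expansion_span s t : log_span s t -> log_expansion s t.
Proof.
move=> ht a; exists t => //.
by under [X in wsum _ X]funext do rewrite subrr; exact: wsum0.
Qed.

Lemma log_expansionD s f g : log_expansion s f -> log_expansion s g ->
  log_expansion s (fun n => f n + g n).
Proof.
move=> hf hg a; have [t ht ft] := hf a; have [u hu gu] := hg a.
exists (fun n => t n + u n); first exact: Log_add.
rewrite (_ : (fun n => _) = fun n => (f n - t n) + (g n - u n)); first exact: wsumD.
by apply/funext => n; ring.
Qed.

Lemma log_expansion_le s s' f : (s' <= s)%N -> log_expansion s f -> log_expansion s' f.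
Proof. by move=> ss hf a; have [t ht ft] := hf a; exists t => //; exact: log_span_le ht. Qed.

Lemma log_expansion_wsum s f : (forall a, wsum a f) -> log_expansion s f.
Proof.
move=> hf a; exists (fun=> 0); first exact: log_span0.
by under [X in wsum _ X]funext do rewrite subr0.
Qed.

Lemma log_expansion_eventually s f g n0 : (forall n, (n0 <= n)%N -> f n = g n) ->
  log_expansion s f -> log_expansion s g.
Proof.
move=> fg hf a; have [t ht ft] := hf a; exists t => //.
by apply: (@wsum_eventually _ _ _ _ n0 _ ft) => n n0n; rewrite fg.
Qed.

Lemma log_expansionM s s' f g : log_expansion s f -> log_expansion s' g ->
  log_expansion (s + s') (fun n => f n * g n).
Proof.
(* The surplus 1 pays for the growth of [t] and [u], bounded by [wt 1]; [b >= 0] makes one error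
   bounded in the product of the two errors. *)
move=> hf hg a; pose b := Num.max a 0 + 1.
have ab : a + 1 <= b by rewrite lerD2r le_max lexx.
have b0 : 0 <= b by rewrite addr_ge0 // le_max lexx orbT.
have [t ht ft] := hf b; have [u hu gu] := hg b.
exists (fun n => t n * u n); first exact: log_spanM.
have [C C0 hC] := log_span_bound ltr01 ht; have [D D0 hD] := log_span_bound ltr01 hu.
have b1 s1 K v : (forall n, `|v n| <= K * wt (1 - s1%:R) n) -> 0 <= K ->
    forall n : nat, `|v n : R| <= K * wt 1 n.
  by move=> hv K0 n; apply: le_trans (hv n) _; rewrite ler_wpM2l // wt_le // gerBl.
rewrite (_ : (fun n => _) = fun n => t n * (g n - u n) + u n * (f n - t n)
  + (f n - t n) * (g n - u n)); last by apply/funext => n; ring.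
apply: wsumD; first apply: wsumD.
- by apply: wsum_mul C0 (b1 _ _ _ hC C0) _; exact: wsum_le gu.
- by apply: wsum_mul D0 (b1 _ _ _ hD D0) _; exact: wsum_le ft.
- have [E E0 hE] := wsum_pointwise ft.
  apply: (@wsum_mul _ 0 E) => //.
    by move=> n; apply: le_trans (hE n) _; rewrite ler_wpM2l // wt_le // oppr_le0.
  by apply: wsum_le gu; rewrite addr0; apply: le_trans ab; rewrite lerDl.
Qed.

Lemma log_expansionZ s c f : log_expansion s f -> log_expansion s (fun n => c * f n).
Proof.
move=> hf; apply: (@log_expansionM 0 s (fun=> c) f _ hf).
by apply: log_expansion_span; apply: log_span_per; exact: periodic_cst.
Qed.

Lemma log_expansionB s f g : log_expansion s f -> log_expansion s g ->
  log_expansion s (fun n => f n - g n).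
Proof.
move=> hf hg; rewrite (_ : (fun n => _) = fun n => f n + -1 * g n).
  by apply: log_expansionD => //; exact: log_expansionZ.
by apply/funext => n; rewrite mulN1r.
Qed.

Lemma log_expansion_divn s f : log_expansion s f -> log_expansion s.+1 (divn_seq f).
Proof.
move=> hf; rewrite (_ : divn_seq f = fun n => f n * (ln n%:R ^+ 0 / n%:R ^+ 1)).
  by rewrite -addn1; apply: log_expansionM => //; apply: log_expansion_span; exact: log_spanE.
by apply/funext => n; rewrite /divn_seq expr0 div1r expr1.
Qed.

End LogExpansion.

(** * Expansions of [1 / (n - 1)] and [ln (n - 1)] in terms of [n] *)

Section Shift.
Variable R : realType.
Implicit Types (a b c : R) (e f g t chi : nat -> R) (s r i p : nat).

Lemma is_derive_ln1B (J : nat) (x : R) : x < 1 ->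
  is_derive x 1 (fun y : R => ln (1 - y) + \sum_(j < J) y ^+ j.+1 / j.+1%:R)
    (- (x ^+ J / (1 - x))).
Proof.
move=> x1; elim: J => [|J IH].
  rewrite (_ : (fun y => _) = @ln R \o (fun y => 1 - y)); last first.
    by apply/funext => y; rewrite big_ord0 addr0.
  have h1 : is_derive (1 - x) 1 (@ln R) (1 - x)^-1 by apply: is_derive1_ln; lra.
  apply: is_derive_eq. rewrite expr0 div1r; ring.
rewrite (_ : (fun y => _) = (fun y : R => ln (1 - y) + \sum_(j < J) y ^+ j.+1 / j.+1%:R)
    + (fun y : R => y ^+ J.+1 / J.+1%:R)); last first.
  by apply/funext => y; rewrite big_ord_recr addrA.
have h2 : is_derive x 1 (fun y : R => y ^+ J.+1 / J.+1%:R) (x ^+ J).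
  have hX := is_deriveZ J.+1%:R^-1 (is_deriveX J.+1 (is_derive_id x 1)).
  rewrite (_ : (fun y => _) = J.+1%:R^-1 \*: (id ^+ J.+1 : R -> R)); last first.
    by apply/funext => y; rewrite /= exprfctE mulrC.
  apply: is_derive_eq; rewrite /GRing.scale /= mulr1 mulrA mulVf ?mul1r ?pnatr_eq0//.
have h := is_deriveD IH h2; apply: is_derive_eq.
by rewrite exprS; field; lra.
Qed.

(** The remainder has derivative [- y^J / (1 - y)] by the geometric series, so the mean value
    theorem bounds it; [1 / (1 - c) <= 2] as [c < x <= 1/2]. *)
Lemma ln1B_expansion (J : nat) (x : R) : 0 <= x <= 2^-1 ->
  `|ln (1 - x) + \sum_(j < J) x ^+ j.+1 / j.+1%:R| <= 2 * x ^+ J.+1.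
Proof.
move=> /andP[x0 x2].
pose F (y : R) := ln (1 - y) + \sum_(j < J) y ^+ j.+1 / j.+1%:R.
have F0 : F 0 = 0.
  by rewrite /F subr0 ln1 add0r big1 // => j _; rewrite expr0n mul0r.
have hd (y : R) : y < 1 -> is_derive y 1 F (- (y ^+ J / (1 - y))) by exact: is_derive_ln1B.
have [||c] := @MVT_segment R F (fun y => - (y ^+ J / (1 - y))) 0 x x0.
- by move=> y hy; apply: hd; move: hy; rewrite in_itv /= => /andP[_]; lra.
- apply: derivable_within_continuous => y hy.
  have y1 : y < 1 by move: hy; rewrite in_itv /= => /andP[_]; lra.
  by have [] := hd y y1.
rewrite in_itv /= => /andP[c0 cx]; rewrite F0 subr0 /F => ->.
rewrite subr0 normrM normrN normf_div normrX !ger0_norm //; last lra.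
rewrite exprSr mulrA ler_wpM2r // ler_pdivrMr; last lra.
have h : c ^+ J <= x ^+ J by rewrite lerXn2r // nnegrE.
have h0 : 0 <= c ^+ J by rewrite exprn_ge0.
by nra.
Qed.

Lemma wsum_inv_power a (C : R) (J n0 : nat) (e : nat -> R) : a + 1 < J%:R ->
  (forall n, (n0 < n)%N -> `|e n| <= C / n%:R ^+ J) -> wsum a e.
Proof.
move=> aJ he.
apply: (@wsum_eventually _ _ (fun n => if (n0 < n)%N then e n else 0) _ n0.+1).
  by move=> n ->.
have C0 : 0 <= C.
  have := le_trans (normr_ge0 _) (he n0.+1 (ltnSn _)).
  by rewrite pmulr_lge0 // invr_gt0 exprn_gt0.
apply: (@wsum_power _ _ J%:R (C * 2 ^+ J) _ aJ) => n.
case: ifP => [nn|_]; last by rewrite normr0 !mulr_ge0 ?wt_ge0 ?exprn_ge0.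
apply: le_trans (he n nn) _; rewrite -mulrA ler_wpM2l // wtN wtn.
have n1 : (0 < n)%N by exact: leq_ltn_trans nn.
rewrite ler_pdivlMr ?exprn_gt0 // mulrC ler_pdivrMr ?exprn_gt0 ?ltr0n //.
by rewrite -exprMn lerXn2r ?nnegrE ?mulr_ge0 // -natrM ler_nat; lia.
Qed.

Lemma exists_nat_gt a (m : nat) : exists2 J : nat, (m <= J)%N & a < J%:R.
Proof.
exists (maxn m (Num.truncn a).+1); first exact: leq_maxl.
by apply: lt_le_trans (truncnS_gt a) _; rewrite ler_nat leq_maxr.
Qed.

Lemma log_expansion_pow s r : (s <= r)%N -> log_expansion s (fun n => (n%:R ^+ r : R)^-1).
Proof.
move=> sr; apply: log_expansion_span.
rewrite (_ : (fun n => _) = fun n => ln n%:R ^+ 0 / n%:R ^+ r); first exact: log_spanE.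
by apply/funext => n; rewrite expr0 div1r.
Qed.

Lemma log_expansion_ln i : log_expansion 0 (fun n => ln (n%:R : R) ^+ i).
Proof.
apply: log_expansion_span.
rewrite (_ : (fun n => _) = fun n => ln n%:R ^+ i / n%:R ^+ 0); first exact: log_spanE.
by apply/funext => n; rewrite expr0 divr1.
Qed.

(** The geometric series has the exact remainder [1 / ((n - 1) n^J)] for [n >= 2]. *)
Lemma inv_pred_expansion : log_expansion 1 (fun n => (n.-1%:R : R)^-1).
Proof.
move=> a; have [J J1 aJ] := exists_nat_gt (a + 1) 1.
exists (fun n => \sum_(j < J) (n%:R ^+ j.+1)^-1).
  apply: log_span_sum => j.
  rewrite (_ : (fun n => _) = fun n => ln n%:R ^+ 0 / n%:R ^+ j.+1); first exact: log_spanE.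
  by apply/funext => n; rewrite expr0 div1r.
apply: (@wsum_inv_power a 2 J 1) => // -[//|[//|n]] _ /=.
rewrite (_ : _ - _ = (n.+1%:R)^-1 / n.+2%:R ^+ J).
  rewrite normrM !normfV normrX !ger0_norm // ler_wpM2r ?invr_ge0 ?exprn_ge0 //.
  by rewrite (@le_trans _ _ 1) ?ler1n // invf_le1 // ler1n.
have n1 : n.+1%:R != 0 :> R by rewrite pnatr_eq0.
have n2 : 1 + n.+1%:R != 0 :> R by rewrite addrC natr1 pnatr_eq0.
rewrite -[n.+2%:R]natr1 [_ + 1]addrC; elim: J {J1 aJ} => [|J IH].
  by rewrite big_ord0 subr0 expr0 divr1.
rewrite big_ord_recr /= opprD addrA IH !exprS.
have hJ : (1 + n.+1%:R) ^+ J != 0 :> R by rewrite expf_neq0.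
field; rewrite hJ /=; have := ler0n R n => ?; apply/andP; split; lra.
Qed.

Lemma ln_pred_expansion :
  log_expansion 2 (fun n => ln (n.-1%:R : R) - ln n%:R + n%:R^-1).
Proof.
move=> a; have [J J1 aJ] := exists_nat_gt (a + 1) 1.
exists (fun n => - \sum_(j < J.-1) (n%:R ^+ j.+2)^-1 / j.+2%:R).
  rewrite (_ : (fun n => _) = fun n => \sum_(j < J.-1)
      - (j.+2%:R)^-1 * (ln n%:R ^+ 0 / n%:R ^+ j.+2)).
    by apply: log_span_sum => j; apply: log_spanZ; exact: log_spanE.
  apply/funext => n; rewrite -sumrN; apply: eq_bigr => j _.
  by rewrite expr0; ring.
apply: (@wsum_inv_power a 2 J 1) => // -[//|[//|n]] _.
have n2 : n.+2%:R != 0 :> R by rewrite pnatr_eq0.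
rewrite (_ : _ - _ = ln (1 - n.+2%:R^-1) + \sum_(j < J) n.+2%:R^-1 ^+ j.+1 / j.+1%:R).
  apply: le_trans (ln1B_expansion J _) _.
    rewrite invr_ge0 ler0n /= lef_pV2 ?posrE ?ltr0n // ler_nat //.
  rewrite ler_wpM2l // exprVn lef_pV2 ?posrE ?exprn_gt0 //.
  by rewrite exprS ler_peMl ?exprn_ge0 // ler1n.
rewrite -(prednK J1) big_ord_recl /= expr1 divr1.
have -> : 1 - n.+2%:R^-1 = n.+1%:R / n.+2%:R :> R.
  rewrite -[n.+2%:R]natr1 -[n.+1%:R]natr1; field; have := ler0n R n => ?; lra.
rewrite ln_div ?posrE ?ltr0Sn // opprK addrA.
by congr (_ + _); apply: eq_bigr => j _; rewrite exprVn.
Qed.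

End Shift.

(** * Partial sums and periodic convolutions of log-power sequences *)

Section EulerMaclaurin.
Variable R : realType.
Implicit Types (a b c : R) (e f g t chi : nat -> R) (s r i p : nat).

Lemma log_expansionM_le s s1 s2 f g : (s <= s1 + s2)%N ->
  log_expansion s1 f -> log_expansion s2 g -> log_expansion s (fun n => f n * g n).
Proof. by move=> hs hf hg; apply: (log_expansion_le hs); exact: log_expansionM. Qed.

Let L n : R := ln n%:R.
Let q n : R := n%:R^-1.

Lemma log_expansion_invX s r : (s <= r)%N -> log_expansion s (fun n => q n ^+ r).
Proof.
move=> sr; rewrite (_ : (fun n => _) = fun n => (n%:R ^+ r)^-1).
  exact: log_expansion_pow.
by apply/funext => n; rewrite /q exprVn.
Qed.

(** Induction on [r]: [q n.-1] is [q n + q n ^ 2] up to the term [y] of order 3, and multiplying by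
    it raises the power by one. *)
Lemma pow_pred_expansion r :
  log_expansion r.+2 (fun n => q n.-1 ^+ r - q n ^+ r - r%:R * q n ^+ r.+1).
Proof.
elim: r => [|r IH].
  rewrite (_ : (fun n => _) = fun=> 0).
    by apply: log_expansion_wsum => a; exact: wsum0.
  by apply/funext => n; rewrite !expr0 mul0r subrr subr0.
pose x n := q n.-1 ^+ r - q n ^+ r - r%:R * q n ^+ r.+1.
pose y n := q n.-1 - q n - q n ^+ 2.
have hy : log_expansion 3 y.
  apply: (@log_expansion_eventually _ _ (fun n => q n ^+ 2 * q n.-1) _ 2).
    move=> [//|[//|n]] _; rewrite /y /q /= -[n.+2%:R]natr1 -[n.+1%:R]natr1.
    by field; have := ler0n R n => ?; apply/andP; split; lra.
  by apply: (@log_expansionM_le _ 2 1); [by []|exact: log_expansion_invX|exact: inv_pred_expansion].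
rewrite (_ : (fun n => _) = fun n => r%:R * q n ^+ r.+3 + q n ^+ r * y n
   + r%:R * (q n ^+ r.+1 * y n) + x n * q n.-1); last first.
  apply/funext => n; rewrite /x /y -[r.+1%:R]natr1 !exprS expr0; ring.
apply: log_expansionD; first apply: log_expansionD; first apply: log_expansionD.
- by apply: log_expansionZ; exact: log_expansion_invX.
- by apply: (@log_expansionM_le _ r 3) => //; [rewrite addnC|exact: log_expansion_invX].
- apply: log_expansionZ; apply: (@log_expansionM_le _ r.+1 3) => //; first lia.
  exact: log_expansion_invX.
- apply: (@log_expansionM_le _ r.+2 1) => //; first lia.
  exact: inv_pred_expansion.
Qed.

Lemma ln_pow_pred_expansion i :
  log_expansion 2 (fun n => L n.-1 ^+ i - L n ^+ i + i%:R * (L n ^+ i.-1 * q n)).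
Proof.
elim: i => [|i IH].
  rewrite (_ : (fun n => _) = fun=> 0).
    by apply: log_expansion_wsum => a; exact: wsum0.
  by apply/funext => n; rewrite !expr0 mul0r subrr addr0.
pose w n := L n.-1 ^+ i - L n ^+ i + i%:R * (L n ^+ i.-1 * q n).
pose z n := L n.-1 - L n + q n.
have hz : log_expansion 2 z by exact: ln_pred_expansion.
have hL k : log_expansion 0 (fun n => L n ^+ k) by exact: log_expansion_ln.
have hq : log_expansion 1 q by have := @log_expansion_invX 1 1 (leqnn 1).
rewrite (_ : (fun n => _) = fun n => L n ^+ i * z n + i%:R * (L n ^+ i.-1 * q n ^+ 2)
   - i%:R * (L n ^+ i.-1 * (q n * z n)) + w n * (L n ^+ 1 - q n + z n)); last first.
  apply/funext => n; rewrite /w /z /=; case: i {IH w} => [|i]; rewrite ?expr0 /=; first by ring.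
  by rewrite -[i.+2%:R]natr1 !exprS expr0; ring.
apply: log_expansionD; first apply: log_expansionB; first apply: log_expansionD.
- exact: (@log_expansionM_le _ 0 2).
- apply: log_expansionZ; apply: (@log_expansionM_le _ 0 2) => //.
  exact: log_expansion_invX.
- apply: log_expansionZ; apply: (@log_expansionM_le _ 0 3) => //.
  by apply: (@log_expansionM_le _ 1 2).
- apply: (@log_expansionM_le _ 2 0) => //; apply: log_expansionD.
    by apply: log_expansionB => //; exact: log_expansion_le hq.
  exact: log_expansion_le hz.
Qed.

(** The backward difference of [(ln x)^i / x^r] against its derivative: the difference gains two
    orders, since the derivative has order [r + 1]. *)
Lemma diff_expansion i r : log_expansion r.+2 (fun n => L n ^+ i * q n ^+ r
  - L n.-1 ^+ i * q n.-1 ^+ r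
  - (i%:R * (L n ^+ i.-1 * q n ^+ r.+1) - r%:R * (L n ^+ i * q n ^+ r.+1))).
Proof.
pose w n := L n.-1 ^+ i - L n ^+ i + i%:R * (L n ^+ i.-1 * q n).
pose x n := q n.-1 ^+ r - q n ^+ r - r%:R * q n ^+ r.+1.
have hw : log_expansion 2 w by exact: ln_pow_pred_expansion.
have hx : log_expansion r.+2 x by exact: pow_pred_expansion.
have hL k : log_expansion 0 (fun n => L n ^+ k) by exact: log_expansion_ln.
have hq s k : (s <= k)%N -> log_expansion s (fun n => q n ^+ k) by exact: log_expansion_invX.
have hp : log_expansion r (fun n => q n ^+ r + r%:R * q n ^+ r.+1 + x n).
  apply: log_expansionD; first apply: log_expansionD; first exact: hq.
    by apply: log_expansionZ; exact: hq.
  by apply: log_expansion_le hx; lia.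
rewrite (_ : (fun n => _) = fun n =>
   (i * r)%:R * (L n ^+ i.-1 * q n ^+ r.+2) + i%:R * (L n ^+ i.-1 * (q n ^+ 1 * x n))
   - L n ^+ i * x n - w n * (q n ^+ r + r%:R * q n ^+ r.+1 + x n)); last first.
  apply/funext => n; rewrite /w /x natrM !exprS expr0; ring.
apply: log_expansionB; first apply: log_expansionB; first apply: log_expansionD.
- by apply: log_expansionZ; apply: (@log_expansionM_le _ 0 r.+2) => //; exact: hq.
- apply: log_expansionZ; apply: (@log_expansionM_le _ 0 r.+3) => //.
  by apply: (@log_expansionM_le _ 1 r.+2) => //; exact: hq.
- exact: (@log_expansionM_le _ 0 r.+2).
- by apply: (@log_expansionM_le _ 2 r).
Qed.

Definition near_log a f := exists2 t, log_span 0 t & wsum a (fun n => f n - t n).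

Lemma near_log_span a t : log_span 0 t -> near_log a t.
Proof. by move/log_expansion_span; exact. Qed.

Lemma near_logD a f g : near_log a f -> near_log a g -> near_log a (fun n => f n + g n).
Proof.
move=> [t ht ft] [u hu gu]; exists (fun n => t n + u n); first exact: Log_add.
rewrite (_ : (fun n => _) = fun n => (f n - t n) + (g n - u n)); first exact: wsumD.
by apply/funext => n; ring.
Qed.

Lemma near_log_periodic a chi f : periodic_seq chi -> near_log a f ->
  near_log a (fun n => chi n * f n).
Proof.
move=> hchi [t ht ft]; exists (fun n => chi n * t n); first exact: log_span_periodic.
have [C C0 hC] := periodic_seq_bounded hchi.
rewrite (_ : (fun n => _) = fun n => chi n * (f n - t n)).
  by apply: wsum_dom C0 _ ft => n; rewrite normrM ler_wpM2r.
by apply/funext => n; rewrite mulrBr.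
Qed.

Lemma near_logZ a c f : near_log a f -> near_log a (fun n => c * f n).
Proof. by apply: near_log_periodic; exact: periodic_cst. Qed.

Lemma near_logB a f g : near_log a f -> near_log a g -> near_log a (fun n => f n - g n).
Proof.
move=> hf hg; rewrite (_ : (fun n => _) = fun n => f n + -1 * g n).
  by apply: near_logD => //; exact: near_logZ.
by apply/funext => n; rewrite mulN1r.
Qed.

Lemma near_log_sum a I (l : seq I) (F : I -> nat -> R) :
  (forall j, near_log a (F j)) -> near_log a (fun n => \sum_(j <- l) F j n).
Proof.
move=> hF; elim: l => [|j l IH].
  rewrite (_ : (fun n => _) = fun=> 0); first exact/near_log_span/log_span0.
  by apply/funext => n; rewrite big_nil.
rewrite (_ : (fun n => _) = fun n => F j n + \sum_(k <- l) F k n).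
  exact: near_logD.
by apply/funext => n; rewrite big_cons.
Qed.

Lemma near_log_conv_wsum a chi e : periodic_seq chi -> wsum (a + 3 / 2) e ->
  near_log a (conv chi e).
Proof.
move=> hchi he.
have [|per hper hp] := @conv_periodic R chi e (a + 3 / 2) 2^-1 hchi _ he; first lra.
exists per; first exact: log_span_per.
by apply: wsum_le hp; lra.
Qed.

Definition psum f n : R := \sum_(k < n.+1) f k.

Lemma psum_conv f : psum f = conv (fun=> 1) f.
Proof. by rewrite convC; apply/funext => n; apply: eq_bigr => k _; rewrite mulr1. Qed.

Lemma psumD f g : psum (fun n => f n + g n) = fun n => psum f n + psum g n.
Proof. by apply/funext => n; rewrite /psum big_split. Qed.

Lemma psumZ c f : psum (fun n => c * f n) = fun n => c * psum f n.
Proof. by apply/funext => n; rewrite /psum mulr_sumr. Qed.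

Lemma psumB f g : psum (fun n => f n - g n) = fun n => psum f n - psum g n.
Proof. by apply/funext => n; rewrite /psum sumrB. Qed.

Lemma psum_diff g : psum (fun n => g n - g n.-1) = fun n => g n - g 0%N.
Proof.
apply/funext; elim => [|n IH]; first by rewrite /psum big_ord1 subrr.
transitivity (psum (fun n => g n - g n.-1) n + (g n.+1 - g n)).
  by rewrite /psum big_ord_recr.
by rewrite IH; ring.
Qed.

Lemma psum_by_parts (psi g : nat -> R) :
  psum (fun n => (psi n - psi n.-1) * g n)
  = fun n => psi n * g n - psi 0%N * g 0%N - psum (fun k => psi k.-1 * (g k - g k.-1)) n.
Proof.
rewrite (_ : (fun n => (psi n - psi n.-1) * g n) = fun n =>
  (psi n * g n - psi n.-1 * g n.-1) - psi n.-1 * (g n - g n.-1)); last first.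
  by apply/funext => n; ring.
by rewrite psumB (psum_diff (fun n => psi n * g n)).
Qed.

Lemma near_log_cst a c : near_log a (fun=> c).
Proof. by apply/near_log_span/log_span_per/periodic_cst. Qed.

Lemma periodic_pred chi : periodic_seq chi ->
  exists2 psi, periodic_seq psi & forall n, psi n.+1 = chi n.
Proof.
move=> [p p0 hp]; exists (fun n => chi (n + p.-1)%N).
  by exists p => // n; rewrite addnAC hp.
by move=> n; rewrite addSnnS prednK // hp.
Qed.

(** With [c] the mean, [chi - c] sums to zero over a period, so its partial sums are periodic. The
    mean carries the main part of a sum, and the rest is open to summation by parts. *)
Lemma periodic_mean chi : periodic_seq chi -> exists c psi,
  periodic_seq psi /\ forall n, chi n.+1 = c + psi n.+1 - psi n.
Proof.
move=> [p p0 hp]; pose c := (\sum_(j < p) chi j) / p%:R.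
exists c, (fun n => \sum_(k < n.+1) (chi k - c)); split; last first.
  by move=> n; rewrite [X in _ = _ + X - _]big_ord_recr /=; ring.
have p_neq0 : p%:R != 0 :> R by rewrite pnatr_eq0 -lt0n.
exists p => // n; elim: n => [|n IH].
  rewrite add0n big_ord_recr /= big_ord1 -[in RHS]hp add0n sumrB sumr_const card_ord.
  by rewrite -mulr_natr /c divfK // subrr add0r.
by rewrite addSn big_ord_recr /= IH [in RHS]big_ord_recr /= -addSn hp.
Qed.

(* Descending induction on the order [r]; accuracy [a] makes all large orders
   negligible. *)
Lemma psum_log_span a m r t : (0 < r)%N -> a + 4 <= (r + m)%:R -> log_span r t ->
  near_log a (psum t).
Proof.
elim: m r t => [|m IH] r t r0 ar ht.
  rewrite psum_conv; apply: near_log_conv_wsum; first exact: periodic_cst.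
  have [C C0 hC] := log_span_bound ltr01 ht.
  apply: (@wsum_power _ _ (r%:R - 1) C); first by move: ar; rewrite addn0; lra.
  by move=> n; rewrite opprB.
have {}IH f : log_expansion r.+1 f -> near_log a (psum f).
  move=> /(_ (a + 3 / 2))[u hu fu].
  rewrite (_ : f = fun n => u n + (f n - u n)); last by apply/funext => n; ring.
  rewrite psumD; apply: near_logD.
    by apply: IH hu => //; rewrite addSnnS.
  by rewrite psum_conv; apply: near_log_conv_wsum => //; exact: periodic_cst.
pose G i k n := L n ^+ i * q n ^+ k.
have near_G i k : near_log a (G i k).
  rewrite (_ : G i k = fun n => ln n%:R ^+ i / n%:R ^+ k).
    by apply: near_log_span; exact: log_spanE.
  by apply/funext => n; rewrite /G /q exprVn.
have cst i : near_log a (psum (G i r)).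
  (* Summing [diff_expansion j r.-1] telescopes the differences and relates two sums of the same
     order [r]; its error has order [r.+1] and falls under [IH]. *)
  have key j : near_log a (fun n => j%:R * psum (G j.-1 r) n - r.-1%:R * psum (G j r) n).
    have hd := diff_expansion j r.-1; rewrite prednK // in hd.
    have := near_logB (near_logB (near_G j r.-1) (near_log_cst a (G j r.-1 0%N))) (IH _ hd).
    rewrite psumB (psum_diff (G j r.-1)) psumB !psumZ.
    by congr near_log; apply/funext => n; ring.
  (* For [r = 1] the second coefficient in [key] vanishes and [key i.+1] gives the sum directly:
     here summation raises the power of the logarithm. For [r > 1] the relation is solved for the
     higher power of the logarithm, by induction on [i]. *)
  have [r1|r1] := eqVneq r 1%N.
    have := near_logZ (i.+1%:R^-1) (key i.+1).
    congr near_log; by apply/funext => n; rewrite r1 /= mul0r subr0 mulrA mulVf ?mul1r //.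
  have rr : r.-1%:R != 0 :> R by rewrite pnatr_eq0 -lt0n -ltnS prednK //; lia.
  have solve j : near_log a (fun n => j%:R * psum (G j.-1 r) n) -> near_log a (psum (G j r)).
    move=> hj; have := near_logZ (r.-1%:R^-1) (near_logB hj (key j)).
    by congr near_log; apply/funext => n; field.
  elim: i => [|i IHi]; apply: solve; last exact: near_logZ.
  rewrite (_ : (fun n => _) = fun=> 0); first exact: near_log_cst.
  by apply/funext => n; rewrite mul0r.
have {ht ar} : log_span r t by [].
suff term chi i k : periodic_seq chi -> (r <= k)%N ->
    near_log a (psum (fun n => chi n * ln n%:R ^+ i / n%:R ^+ k)).
  elim => [chi i k hchi rk|f g _ hf _ hg]; first exact: term.
  by rewrite psumD; exact: near_logD.
move=> hchi rk; have [kr|kr] := eqVneq k r; last first.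
  by apply: IH; apply: log_expansion_span; apply: Log_term => //; lia.
rewrite {k rk}kr; have [c [psi [hpsi psiE]]] := periodic_mean hchi.
rewrite (_ : (fun n => _) = fun n => c * G i r n + (psi n - psi n.-1) * G i r n); last first.
  apply/funext => -[|n].
    by rewrite /G /q !expr0n invr0 expr0n gtn_eqF // !mulr0 invr0 !mulr0 addr0.
  by rewrite psiE /G /q /L exprVn; ring.
rewrite psumD psumZ; apply: near_logD; first exact: near_logZ.
rewrite psum_by_parts; apply: near_logB.
  by apply: near_logB; [exact: near_log_periodic|exact: near_log_cst].
(* The differences of [G i r] have order [r.+1]. As [0.-1 = 0], the sequence [psi n.-1] is periodic
   only from [n = 1] on; [phi] is its periodic extension. *)
apply: IH; have [phi hphi phiE] := periodic_pred hpsi.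
apply: (@log_expansion_eventually _ _ (fun n => phi n * (G i r n - G i r n.-1)) _ 1).
  by move=> [//|n] _; rewrite phiE.
apply: (@log_expansionM_le _ 0 r.+1) => //; first exact/log_expansion_span/log_span_per.
pose E n := L n ^+ i * q n ^+ r - L n.-1 ^+ i * q n.-1 ^+ r
  - (i%:R * (L n ^+ i.-1 * q n ^+ r.+1) - r%:R * (L n ^+ i * q n ^+ r.+1)).
have hE : log_expansion r.+2 E := diff_expansion i r.
have hL k : log_expansion 0 (fun n => L n ^+ k) by exact: log_expansion_ln.
rewrite (_ : (fun n => _) = fun n => E n + (i%:R * (L n ^+ i.-1 * q n ^+ r.+1) - r%:R * (L n ^+ i * q n ^+ r.+1))); last first.
  by apply/funext => n; rewrite /E /G; ring.
apply: log_expansionD; first by apply: log_expansion_le hE.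
by apply: log_expansionB; apply: log_expansionZ; apply: (@log_expansionM_le _ 0 r.+1) => //;
  exact: log_expansion_invX.
Qed.

Lemma psum_expansion f : log_expansion 1 f -> forall a, near_log a (psum f).
Proof.
move=> hf a; have [t ht ft] := hf (a + 3 / 2).
rewrite (_ : f = fun n => t n + (f n - t n)); last by apply/funext => n; ring.
rewrite psumD; apply: near_logD; last first.
  by rewrite psum_conv; apply: near_log_conv_wsum => //; exact: periodic_cst.
have [m _ am] := exists_nat_gt (a + 4) 0.
by apply: (@psum_log_span a m 1) => //; apply: le_trans (ltW am) _; rewrite ler_nat leq_addl.
Qed.

(* Sorting the summation index by its residue turns [conv chi f] into partial sums. *)
Lemma conv_expansion chi f : periodic_seq chi -> log_expansion 1 f ->
  log_expansion 0 (conv chi f).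
Proof.
move=> [p p0 hp] hf a.
pose ind j n : R := ((n %% p)%N == j)%:R.
have hind j : periodic_seq (ind j) by exists p => // n; rewrite /ind modnDr.
rewrite (_ : conv chi f = fun n => \sum_(j < p) chi (n + (p - j))%N * psum (fun k => ind j k * f k) n).
  apply: near_log_sum => j; apply: near_log_periodic.
    by exists p => // n; rewrite addnAC hp.
  apply: psum_expansion; apply: (@log_expansionM_le _ 0 1) => //.
  exact/log_expansion_span/log_span_per.
apply/funext => n; rewrite convC /conv /psum.
under [RHS]eq_bigr do rewrite mulr_sumr.
rewrite exchange_big /=; apply: eq_bigr => k _.
rewrite (bigD1 (Ordinal (ltn_pmod k p0))) //= /ind eqxx mul1r big1 ?addr0.
  rewrite mulrC; congr (_ * _).
  have kn : (k <= n)%N by rewrite -ltnS.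
  have mp : (k %% p < p)%N by rewrite ltn_mod.
  have -> : (n + (p - k %% p) = (n - k) + (k %/ p).+1 * p)%N.
    by have := divn_eq k p; nia.
  elim: (k %/ p).+1 (n - k)%N => [|j IH] m; first by rewrite addn0.
  by rewrite mulSn addnCA addnC hp.
move=> j jk; rewrite (_ : (k %% p == j)%N = false) ?mul0r ?mulr0 //.
by apply: contraNF jk => /eqP jk; apply/eqP/val_inj.
Qed.

Lemma polylog_expansion (v : nat -> R) : polylog_span v -> log_expansion 1 v.
Proof.
elim => {v} [|v _ IH|chi v hchi _ IH|c v w _ IHv _ IHw].
- by apply: log_expansion_wsum => a; exact: wsum_unit0.
- by apply: log_expansion_divn; exact: log_expansion_le IH.
- by apply: log_expansion_divn; exact: conv_expansion.
- by apply: log_expansionD => //; exact: log_expansionZ.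
Qed.

Lemma near_polylog_expansion (W : nat -> R) : (forall a, near_polylog a W) -> log_expansion 1 W.
Proof.
move=> hW a; have [v hv Wv] := hW a; have [t ht vt] := polylog_expansion hv a.
exists t => //; rewrite (_ : (fun n => _) = fun n => (W n - v n) + (v n - t n)).
  exact: wsumD.
by apply/funext => n; ring.
Qed.

End EulerMaclaurin.

(** * Uniqueness of oscillating expansions *)

Section Uniqueness.
Variable R : realType.
Implicit Types (a b c : R) (f t W : nat -> R) (Q : nat -> {poly R}) (P : nat -> nat -> {poly R}).

(** A polynomial with positive leading coefficient is eventually at least that coefficient. *)
Lemma poly_arbitrarily_small (p : {poly R}) :
  (forall eps M, 0 < eps -> exists2 x, M <= x & `|p.[x]| <= eps) -> p = 0.
Proof.
move=> hp; apply/eqP/negP => /negP p0.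
wlog lp : p hp p0 / 0 < lead_coef p.
  move=> H; have [/(H _ hp p0)//|lp] := ltP 0 (lead_coef p).
  apply: (H (- p)); rewrite ?oppr_eq0 // ?lead_coefN ?oppr_gt0.
    move=> eps M e0; have [x Mx px] := hp eps M e0; exists x => //.
    by rewrite hornerN normrN.
  by rewrite lt_neqAle lp lead_coef_eq0 p0.
have [M hM] := polyrcf.poly_pinfty_gt_lc lp.
have l2 : 0 < lead_coef p / 2 by rewrite divr_gt0.
have [x Mx px] := hp _ M l2.
by have := hM x Mx; have := ler_norm p.[x]; lra.
Qed.

(** The degree bound leaves finitely many coefficients, so the product of their periods is a common
    one. *)
Lemma poly_with_periodic_coefs_periodic Q : poly_with_periodic_coefs Q ->
  exists2 p, (0 < p)%N & forall n, Q (n + p)%N = Q n.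
Proof.
move=> [[d hd] hQ].
have [p p0 hp] : exists2 p, (0 < p)%N &
    forall j, (j < d)%N -> forall n, (Q (n + p)%N)`_j = (Q n)`_j.
  elim: d {hd} => [|d [p p0 IH]]; first by exists 1%N.
  have [q q0 hq] := hQ d; exists (p * q)%N; first by rewrite muln_gt0 p0.
  move=> j; rewrite ltnS leq_eqVlt => /orP[/eqP ->|jd] n.
    by elim: p {p0 IH} n => [|p IH] n; rewrite ?mul0n ?addn0 // mulSn addnA IH hq.
  by elim: q {q0 hq} n => [|q IHq] n; rewrite ?muln0 ?addn0 // mulnS addnA IHq IH.
exists p => // n; apply/polyP => j; have [jd|dj] := ltnP j d; first exact: hp.
by rewrite !nth_default // (leq_trans (hd _)).
Qed.

Lemma poly_with_periodic_coefs_bound Q eps : 0 < eps -> poly_with_periodic_coefs Q ->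
  exists2 C, 0 <= C & forall n, `|(Q n).[ln n%:R]| <= C * wt eps n.
Proof.
move=> e0 [[d hd] hQ].
suff [C C0 hC] : exists2 C, 0 <= C &
    forall n, \sum_(j < d) `|(Q n)`_j * ln n%:R ^+ j| <= C * wt eps n.
  by exists C => // n; rewrite (horner_coef_wide _ (hd n)) (le_trans (ler_norm_sum _ _ _)).
elim: d {hd} => [|d [C C0 hC]]; first by exists 0 => // n; rewrite big_ord0 mul0r.
have [B B0 hB] := periodic_seq_bounded (hQ d).
have [D D0 hD] := ln_nat_bound d e0.
exists (C + B * D) => [|n]; first by rewrite addr_ge0 ?mulr_ge0.
rewrite big_ord_recr /= mulrDl lerD // normrM -mulrA ler_pM // ger0_norm //.
by rewrite exprn_ge0 // ln_nat_ge0.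
Qed.

Lemma poly_with_periodic_coefsD Q Q' : poly_with_periodic_coefs Q ->
  poly_with_periodic_coefs Q' -> poly_with_periodic_coefs (fun n => Q n + Q' n).
Proof.
move=> [[d hd] hQ] [[d' hd'] hQ']; split.
  exists (maxn d d') => n; apply: leq_trans (size_polyD _ _) _.
  by rewrite geq_max !leq_max hd hd' orbT.
move=> j; rewrite (_ : (fun n => _) = fun n => (Q n)`_j + (Q' n)`_j).
  exact: periodic_comb.
by apply/funext => n; rewrite coefD.
Qed.

Lemma poly_with_periodic_coefs_term chi i : periodic_seq chi ->
  poly_with_periodic_coefs (fun n => (chi n)%:P * 'X^i : {poly R}).
Proof.
move=> hchi; split.
  exists i.+1 => n; rewrite mul_polyC; apply: leq_trans (size_scale_leq _ _) _.
  by rewrite size_polyXn.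
move=> j; have [p p0 hp] := hchi; exists p => // n.
by rewrite !mul_polyC !coefZ hp.
Qed.

Lemma poly_with_periodic_coefsN Q : poly_with_periodic_coefs Q ->
  poly_with_periodic_coefs (fun n => - Q n).
Proof.
move=> [[d hd] hQ]; split; first by exists d => n; rewrite size_polyN.
by move=> j; have [p p0 hp] := hQ j; exists p => // n; rewrite !coefN hp.
Qed.

Lemma poly_with_periodic_coefs0 : poly_with_periodic_coefs (fun _ => 0 : {poly R}).
Proof.
by split; [exists 0%N => n; rewrite size_poly0|move=> j; exists 1%N].
Qed.

Definition osc_sum (P : nat -> nat -> {poly R}) (D n : nat) : R :=
  \sum_(r < D) (P r n).[ln n%:R] / n%:R ^+ r.

Lemma log_span_osc_sum t : log_span 0 t -> exists D (P : nat -> nat -> {poly R}),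
  [/\ forall r, poly_with_periodic_coefs (P r), forall r n, (D <= r)%N -> P r n = 0 &
      forall n, t n = osc_sum P D n].
Proof.
elim => [chi i r hchi _|f g _ [D [P [hP P0 fE]]] _ [D' [P' [hP' P0' gE]]]].
  exists r.+1, (fun k n => if k == r then (chi n)%:P * 'X^i else 0); split.
  - move=> k; case: eqP => _; first exact: poly_with_periodic_coefs_term.
    exact: poly_with_periodic_coefs0.
  - by move=> k n rk; rewrite gtn_eqF.
  - move=> n; rewrite /osc_sum big_ord_recr /= eqxx big1 ?add0r.
      by rewrite hornerM hornerC hornerXn.
    by move=> k _; rewrite ltn_eqF // horner0 mul0r.
exists (maxn D D'), (fun k n => P k n + P' k n); split.
- by move=> r; exact: poly_with_periodic_coefsD.
- by move=> r n; rewrite geq_max => /andP[? ?]; rewrite P0 // P0' // addr0.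
- move=> n; rewrite fE gE /osc_sum.
  have widen E (S : nat -> nat -> {poly R}) : (forall r n, (E <= r)%N -> S r n = 0) ->
      (E <= maxn D D')%N -> osc_sum S E n = osc_sum S (maxn D D') n.
    move=> S0 EM; rewrite /osc_sum -!(big_mkord xpredT (fun r => (S r n).[ln n%:R] / n%:R ^+ r)).
    rewrite [RHS](big_cat_nat (leq0n E) EM) /= [X in _ + X]big_nat_cond.
    rewrite [X in _ + X]big1 ?addr0 // => r /andP[/andP[Er _] _].
    by rewrite S0 // horner0 mul0r.
  rewrite -![\sum_(r < _) _]/(osc_sum _ _ n) (widen D P) ?leq_maxl //.
  rewrite (widen D' P') ?leq_maxr // /osc_sum -big_split; apply: eq_bigr => r _.
  by rewrite hornerD mulrDl.
Qed.

Lemma inv_pow_wt (r n : nat) : (0 < n)%N -> (n%:R ^+ r : R)^-1 <= 2 ^+ r * wt (- r%:R) n.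
Proof.
move=> n0; rewrite wtN wtn ler_pdivlMr ?exprn_gt0 // mulrC ler_pdivrMr ?exprn_gt0 ?ltr0n //.
by rewrite -exprMn lerXn2r ?nnegrE ?mulr_ge0 // -natrM ler_nat; lia.
Qed.

(* The terms of index [r0 <= r < D] are negligible against [n ^ (eps - r0)]. *)
Lemma osc_sum_tail_bound P D r0 eps : 0 < eps ->
  (forall r, poly_with_periodic_coefs (P r)) ->
  exists2 C, 0 <= C & forall n, (0 < n)%N ->
    `|\sum_(r < D | (r0 <= r)%N) (P r n).[ln n%:R] / n%:R ^+ r| <= C * wt (eps - r0%:R) n.
Proof.
move=> e0 hP.
suff [C C0 hC] : exists2 C, 0 <= C & forall n, (0 < n)%N ->
    \sum_(r < D | (r0 <= r)%N) `|(P r n).[ln n%:R] / n%:R ^+ r| <= C * wt (eps - r0%:R) n.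
  by exists C => // n n0; apply: le_trans (ler_norm_sum _ _ _) _; exact: hC.
elim: D => [|D [C C0 hC]]; first by exists 0 => // n _; rewrite big_ord0 mul0r.
have [B B0 hB] := poly_with_periodic_coefs_bound e0 (hP D).
exists (C + B * 2 ^+ D) => [|n n0]; first by rewrite addr_ge0 ?mulr_ge0 ?exprn_ge0.
rewrite big_mkcond big_ord_recr -big_mkcond /= mulrDl lerD ?hC //.
case: leqP => [rD|_]; last by rewrite !mulr_ge0 ?exprn_ge0 ?wt_ge0.
rewrite wtD normrM normfV (ger0_norm (exprn_ge0 D (ler0n R n))).
rewrite [X in _ <= X](_ : _ = (B * wt eps n) * (2 ^+ D * wt (- r0%:R) n)); last by ring.
apply: ler_pM; rewrite ?hB ?invr_ge0 ?exprn_ge0 //.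
apply: le_trans (inv_pow_wt D n0) _.
by rewrite ler_wpM2l ?exprn_ge0 // wt_le // lerN2 ler_nat.
Qed.

(** Multiplied by [n^r0], the sum is [(P r0 n).[ln n]] plus decaying terms. Along [n + k * p] the
    polynomial does not change while the logarithm tends to infinity, so [poly_arbitrarily_small]
    applies. *)
Lemma osc_sum_uniq P D r0 b C : (forall r, poly_with_periodic_coefs (P r)) ->
  (r0 < D)%N -> (forall r n, (r < r0)%N -> P r n = 0) -> r0%:R < b ->
  (forall n, `|osc_sum P D n| <= C * wt (- b) n) -> forall n, P r0 n = 0.
Proof.
move=> hP rD Plow rb hC n.
have [p p0 hp] := poly_with_periodic_coefs_periodic (hP r0).
have hpk k : P r0 (n + k * p)%N = P r0 n.
  by elim: k => [|k IH]; rewrite ?addn0 // mulSn addnCA addnC hp.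
have e2 : 0 < 2^-1 :> R by [].
have [B B0 hB] := osc_sum_tail_bound D r0.+1 e2 hP.
(* The rate of decay is limited by the hypothesis, to [b - r0], and by the next orders, to [1/2]
   once their logarithms are paid with [n^(1/2)]. *)
pose d := Num.min (b - r0%:R) 2^-1.
have d0 : 0 < d by rewrite lt_min subr_gt0 rb.
have d1 : d <= b - r0%:R by rewrite ge_min lexx.
have d2 : d <= 2^-1 by rewrite ge_min lexx orbT.
have C0 : 0 <= C.
  have := le_trans (normr_ge0 _) (hC 0%N).
  by rewrite pmulr_lge0 // wt_gt0.
have key m : (0 < m)%N -> `|(P r0 m).[ln m%:R]| <= (C + B) * wt (- d) m.
  move=> m0; have mr : 0 < m%:R ^+ r0 :> R by rewrite exprn_gt0 // ltr0n.
  have -> : (P r0 m).[ln m%:R] = m%:R ^+ r0 *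
      (osc_sum P D m - \sum_(r < D | (r0 < r)%N) (P r m).[ln m%:R] / m%:R ^+ r).
    rewrite /osc_sum (bigID (fun r : 'I_D => (r0 < r)%N)) /= addrAC subrr add0r.
    rewrite (bigD1 (Ordinal rD)) ?ltnn //= big1 ?addr0.
      by rewrite mulrC divfK // gt_eqF.
    move=> r /andP[]; rewrite -leqNgt leq_eqVlt => /orP[/eqP rr|rr] hr.
      by case/eqP: hr; apply/val_inj.
    by rewrite Plow // horner0 mul0r.
  rewrite normrM ger0_norm ?(ltW mr) // mulrDl.
  apply: (@le_trans _ _ (wt r0%:R m * (C * wt (- b) m + B * wt (2^-1 - r0.+1%:R) m))).
    rewrite ler_pM ?(ltW mr) //.
      by rewrite wtn lerXn2r ?nnegrE // ler_nat.
    by apply: le_trans (ler_normB _ _) _; rewrite lerD // hB.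
  rewrite mulrDr !(mulrCA (wt r0%:R m)) -!wtD; apply: lerD; rewrite ler_wpM2l // wt_le //.
    by move: d1; clear; lra.
  by move: d2; rewrite -[r0.+1%:R]natr1; clear; lra.
apply: poly_arbitrarily_small => eps M eps0.
have [k1 _ hk1] := exists_nat_gt (((C + B) / eps) `^ d^-1) 1.
have [k2 _ hk2] := exists_nat_gt (expR M) 1.
pose k := maxn 1 (maxn k1 k2); exists (ln (n + k * p)%:R).
  rewrite -[M]expRK ler_ln ?posrE ?expR_gt0 //.
    apply: le_trans (ltW hk2) _; rewrite ler_nat /k; nia.
  by rewrite ltr0n /k; nia.
rewrite -(hpk k); apply: le_trans (key _ _) _; first by rewrite /k; nia.
rewrite wtN ler_pdivrMr ?wt_gt0 // mulrC -ler_pdivrMr //.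
have CB : 0 <= (C + B) / eps by rewrite divr_ge0 ?addr_ge0 // ltW.
rewrite -[X in X <= _]powRr1 // -(@mulVf _ d) ?gt_eqF // powRrM.
rewrite /wt ge0_ler_powR ?nnegrE ?powR_ge0 ?(ltW d0) //.
apply: le_trans (ltW hk1) _; rewrite ler_nat /k; nia.
Qed.

(** Approximants of accuracy [N + 1] and [M + 1] have the same polynomials up to order [min(N, M)]
    by uniqueness, so the diagonal family [P r r] serves all truncations, with exponents
    [alpha r = r]. *)
Lemma log_expansion_full W : log_expansion 0 W -> full_oscillating_expansion W.
Proof.
move=> hW.
have H (N : nat) : exists DP : nat * (nat -> nat -> {poly R}),
    [/\ forall r, poly_with_periodic_coefs (DP.2 r),
        forall r n, (DP.1 <= r)%N -> DP.2 r n = 0 &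
        exists C, forall n, `|W n - osc_sum DP.2 DP.1 n| <= C * wt (- (N%:R + 1)) n].
  have [t ht Wt] := hW (N%:R + 1); have [D [P [hP P0 tE]]] := log_span_osc_sum ht.
  exists (D, P); split => //=; have [C _ hC] := wsum_pointwise Wt.
  by exists C => n; rewrite -tE.
have {H}[F hF] := choice H.
pose D N := (F N).1; pose P N := (F N).2.
have hP N r : poly_with_periodic_coefs (P N r) by have [h _ _] := hF N; exact: h.
have P0 N r n : (D N <= r)%N -> P N r n = 0 by have [_ h _] := hF N; exact: h.
have hC N : exists C, forall n, `|W n - osc_sum (P N) (D N) n| <= C * wt (- (N%:R + 1)) n.
  by have [_ _] := hF N.
have widen N M n : (D N <= M)%N -> osc_sum (P N) (D N) n = osc_sum (P N) M n.
  move=> DM; rewrite /osc_sum -!(big_mkord xpredT (fun r => (P N r n).[ln n%:R] / n%:R ^+ r)).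
  rewrite [RHS](big_cat_nat (leq0n (D N)) DM) /= [X in _ + X]big_nat_cond.
  rewrite [X in _ + X]big1 ?addr0 // => r /andP[/andP[Er _] _].
  by rewrite P0 // horner0 mul0r.
have uniq N M r : (r <= N)%N -> (r <= M)%N -> forall n, P N r n = P M r n.
  elim/ltn_ind: r => r IH rN rM n.
  apply/eqP; rewrite -subr_eq0; apply/eqP.
  pose K := maxn r.+1 (maxn (D N) (D M)).
  have [C hCN] := hC N; have [E hCM] := hC M.
  apply: (@osc_sum_uniq (fun k n => P N k n - P M k n) K r (r%:R + 1) (C + E)).
  - by move=> k; apply: poly_with_periodic_coefsD => //; exact: poly_with_periodic_coefsN.
  - by rewrite leq_maxl.
  - by move=> k m kr; rewrite (IH k kr) ?subrr //; lia.
  - by rewrite ltrDl.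
  - move=> m.
    have -> : osc_sum (fun k n => P N k n - P M k n) K m =
        (W m - osc_sum (P M) (D M) m) - (W m - osc_sum (P N) (D N) m).
      rewrite (widen N K) ?(widen M K) /K ?leq_max ?leqnn ?orbT //.
      rewrite [RHS](_ : _ = osc_sum (P N) K m - osc_sum (P M) K m); last by ring.
      rewrite /osc_sum -sumrB; apply: eq_bigr => k _.
      by rewrite hornerD hornerN mulrBl.
    apply: le_trans (ler_normB _ _) _; rewrite addrC mulrDl.
    apply: lerD; [apply: le_trans (hCN m) _|apply: le_trans (hCM m) _].
      rewrite ler_wpM2l ?wt_le ?lerN2 ?lerD2r ?ler_nat //.
      have := le_trans (normr_ge0 _) (hCN 0%N).
      by rewrite pmulr_lge0 // wt_gt0.
    rewrite ler_wpM2l ?wt_le ?lerN2 ?lerD2r ?ler_nat //.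
    have := le_trans (normr_ge0 _) (hCM 0%N).
    by rewrite pmulr_lge0 // wt_gt0.
exists (fun r => r%:R), (fun r => P r r); split.
- by move=> r s; rewrite ltr_nat.
- exact: cvgr_idn.
- by move=> r; exact: hP.
move=> N; apply/eqoP => eps eps0.
have [C hCN] := hC N.
have e2 : 0 < 2^-1 :> R by [].
have [B B0 hB] := osc_sum_tail_bound (maxn N.+1 (D N)) N.+1 e2 (hP N).
have C0 : 0 <= C.
  by have := le_trans (normr_ge0 _) (hCN 0%N); rewrite pmulr_lge0 // wt_gt0.
(* The margin over [n^-N] is [n^(-1/2)], whence the square. *)
have [k _ hk] := exists_nat_gt (((C + B) / eps) `^ 2) 1.
exists (maxn 1 k) => // n /= kn.
have n0 : (0 < n)%N by apply: leq_trans kn; rewrite leq_maxl.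
rewrite powR_mulrn // [X in _ <= _ * X]ger0_norm ?invr_ge0 ?exprn_ge0 //.
have -> : W n - \sum_(r < N.+1) (P r r n).[ln n%:R] / n%:R `^ r%:R =
    (W n - osc_sum (P N) (D N) n)
    + \sum_(r < maxn N.+1 (D N) | (N.+1 <= r)%N) (P N r n).[ln n%:R] / n%:R ^+ r.
  rewrite (widen N (maxn N.+1 (D N))) ?leq_maxr // /osc_sum.
  rewrite [X in _ = _ - X + _](bigID (fun r : 'I_(maxn N.+1 (D N)) => (N < r)%N)) /=.
  have E (x y z : R) : x - (y + z) + y = x - z by ring.
  rewrite E.
  congr (_ - _).
  rewrite (big_ord_widen (maxn N.+1 (D N)) (fun r => (P r r n).[ln n%:R] / n%:R `^ r%:R)) ?leq_maxl //.
  apply: eq_big => [r|r rN]; first by rewrite -leqNgt ltnS.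
  by rewrite powR_mulrn // (uniq r N) // -ltnS.
apply: le_trans (ler_normD _ _) _.
apply: (@le_trans _ _ ((C + B) * wt (- 2^-1) n * wt (- N%:R) n)).
  rewrite -mulrA -wtD mulrDl; apply: lerD.
    by apply: le_trans (hCN n) _; rewrite ler_wpM2l // wt_le //; lra.
  by apply: le_trans (hB n n0) _; rewrite ler_wpM2l // wt_le // -[N.+1%:R]natr1; lra.
apply: ler_pM; rewrite ?mulr_ge0 ?addr_ge0 ?wt_ge0 //; last first.
  by rewrite wtN wtn lef_pV2 ?posrE ?exprn_gt0 ?ltr0n // lerXn2r ?nnegrE // ler_nat.
rewrite wtN ler_pdivrMr ?wt_gt0 // mulrC -ler_pdivrMr //.
have CB : 0 <= (C + B) / eps by rewrite divr_ge0 ?addr_ge0 // ltW.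
have -> : (C + B) / eps = (((C + B) / eps) `^ 2) `^ 2^-1.
  by rewrite -powRrM divff ?powRr1 // pnatr_eq0.
rewrite /wt ge0_ler_powR ?nnegrE ?powR_ge0 //.
by apply: le_trans (ltW hk) _; rewrite ler_nat; lia.
Qed.

End Uniqueness.

(** * The probability as a sum over cycle types *)

Section CycleTypeProbability.
Local Close Scope classical_set_scope.
Variable n : nat.
Implicit Types (s t : 'S_n) (f : {ffun 'I_n -> 'I_n.+1}).

Definition cycle_count s j : nat := #|[set c in porbits s | #|c| == j]|.

Lemma count_mem_cycle_sizes s j :
  count_mem j [seq #|c| | c : {set 'I_n} <- enum (porbits s)] = cycle_count s j.
Proof.
rewrite count_map /cycle_count cardE -size_filter; apply/perm_size/uniq_perm.
- exact/filter_uniq/enum_uniq.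
- exact: enum_uniq.
- by move=> c; rewrite mem_filter !mem_enum andbC finset.in_set.
Qed.

Lemma cycle_typeP s t : reflect (forall j, cycle_count s j = cycle_count t j)
  (cycle_type s == cycle_type t).
Proof.
apply: (iffP eqP) => [st j|st].
  rewrite -!count_mem_cycle_sizes.
  by have /seq.permP -> := introT (eq_seq_msetP _ _) st.
apply: (elimT (eq_seq_msetP _ _)); apply/allP => j _ /=.
by rewrite !count_mem_cycle_sizes st.
Qed.

Lemma points_of_size_cycle s j : points_of_size [set: 'I_n] s j = (j * cycle_count s j)%N.
Proof.
rewrite /points_of_size -sum1_card (partition_big (porbit s) (mem (porbits s))) /=; last first.
  by move=> z _; apply: finset.imset_f.
rewrite /cycle_count mulnC -sum_nat_const big_mkcond [RHS]big_mkcond /=.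
apply: eq_bigr => c _; rewrite inE; case cs: (c \in porbits s) => //=.
have /imsetP[x _ cE] := cs; case: eqP => cj.
  rewrite -[RHS]cj -[RHS]sum1_card; apply: eq_bigl => z.
  have -> : (z \in c) = (porbit s z == c) by rewrite cE eq_porbit_mem.
  by rewrite !inE; have [->|_] := eqVneq (porbit s z) c; rewrite ?andbF // cj eqxx.
apply: big_pred0 => z; rewrite !inE; apply/negbTE/andP => -[/eqP zj /eqP zc].
by apply: cj; rewrite -zc zj.
Qed.

Lemma cycle_count0 s : cycle_count s 0 = 0%N.
Proof.
apply/eqP; rewrite cards_eq0; apply/eqP/finset.setP => c; rewrite !inE.
apply/negbTE/andP => -[/imsetP[x _ ->]]; exact/negP/card_porbit_neq0.
Qed.

Lemma cycle_count_gt s j : (n < j)%N -> cycle_count s j = 0%N.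
Proof.
move=> nj; apply/eqP; rewrite cards_eq0; apply/eqP/finset.setP => c; rewrite !inE.
apply/negbTE/andP => -[_ /eqP cj]; have := max_card (mem c).
by rewrite cj card_ord leqNgt nj.
Qed.

Lemma cycle_count_le s j : (cycle_count s j <= n)%N.
Proof.
case: j => [|j]; first by rewrite cycle_count0.
apply: (@leq_trans (j.+1 * cycle_count s j.+1)); first by rewrite leq_pmull.
rewrite -points_of_size_cycle; apply: leq_trans (max_card _) _.
by rewrite card_ord.
Qed.

(** Types are encoded by finite functions, [f i] being the number of cycles of length [i.+1], so
    that one can sum over them; [type_of] extends such a code by zero. *)
Definition type_of f (j : nat) : nat :=
  if j is j'.+1 then oapp (fun o => f o : nat) 0%N (insub j') else 0%N.

Lemma type_ofE f (i : 'I_n) : type_of f i.+1 = f i.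
Proof. by rewrite /type_of valK. Qed.

Lemma type_of_gt f j : (n < j)%N -> type_of f j = 0%N.
Proof. by case: j => // j nj; rewrite /type_of insubF // ltnNge -ltnS nj. Qed.

Definition type_code s : {ffun 'I_n -> 'I_n.+1} := [ffun i : 'I_n => inord (cycle_count s i.+1)].

Lemma type_codeE s j : type_of (type_code s) j = cycle_count s j.
Proof.
have [nj|jn] := ltnP n j; first by rewrite type_of_gt // cycle_count_gt.
case: j jn => [|j] jn; first by rewrite cycle_count0.
by rewrite (type_ofE _ (Ordinal jn)) ffunE inordK // ltnS cycle_count_le.
Qed.

Lemma type_of_inj f g : (forall j, type_of f j = type_of g j) -> f = g.
Proof. by move=> fg; apply/ffunP => i; apply/val_inj; rewrite /= -!type_ofE fg. Qed.

Lemma cycle_type_code s t : (cycle_type s == cycle_type t) = (type_code s == type_code t).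
Proof.
apply/cycle_typeP/eqP => [st|st j]; last by rewrite -!type_codeE st.
by apply: type_of_inj => j; rewrite !type_codeE.
Qed.

Lemma has_type_code s f : has_type n [set: 'I_n] s (type_of f) = (type_code s == f).
Proof.
apply/forallP/eqP => [H|<- j]; last by rewrite points_of_size_cycle type_codeE.
apply: type_of_inj => j; rewrite type_codeE.
have [nj|jn] := ltnP n j; first by rewrite type_of_gt // cycle_count_gt.
case: j jn => [|j] jn; first by rewrite cycle_count0.
have := H (Ordinal (jn : (j.+1 < n.+1)%N)).
by rewrite points_of_size_cycle eqn_pmul2l // => /eqP.
Qed.

Lemma sum_points_of_size s : (\sum_(j < n.+1) points_of_size [set: 'I_n] s j = n)%N.
Proof.
rewrite -[RHS]card_ord -cardsT -sum1_card.
have h (z : 'I_n) : (#|porbit s z| < n.+1)%N.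
  by rewrite ltnS; apply: leq_trans (max_card _) _; rewrite card_ord.
rewrite (partition_big (fun z => Ordinal (h z)) xpredT) //=.
apply: eq_bigr => j _; rewrite /points_of_size -sum1_card; apply: eq_bigl => z.
by rewrite !inE -val_eqE.
Qed.

Lemma card_type_code f :
  (#|[set s | type_code s == f]| * type_weight n (type_of f))%N =
  if type_size n (type_of f) == n then n`! else 0%N.
Proof.
have NE : #|[set s | type_code s == f]| =
    (\sum_(s | perm_on [set: 'I_n] s) has_type n [set: 'I_n] s (type_of f))%N.
  rewrite -sum1_card [LHS]big_mkcond [RHS]big_mkcond /=; apply: eq_bigr => s _.
  rewrite inE has_type_code (_ : perm_on [set: 'I_n] s); last by apply/fintype.subsetP.
  by case: eqP.
have [fn|fn] := eqVneq (type_size n (type_of f)) n.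
  rewrite NE -[in RHS](card_ord n) -cardsT count_type ?card_ord //.
  by rewrite fn cardsT card_ord.
rewrite (_ : [set s | _] = finset.set0) ?cards0 //; apply/finset.setP => s; rewrite !inE.
apply: contraNF fn => /eqP <-; apply/eqP; rewrite -[RHS](sum_points_of_size s).
by apply: eq_bigr => j _; rewrite type_codeE points_of_size_cycle.
Qed.

Lemma card_same_cycle_type :
  #|[pred st : 'S_n * 'S_n | cycle_type st.1 == cycle_type st.2]| =
  (\sum_f #|[set s | type_code s == f]| ^ 2)%N.
Proof.
rewrite -sum1_card.
transitivity (\sum_(s : 'S_n) \sum_(t : 'S_n | type_code s == type_code t) 1)%N.
  rewrite pair_big_dep /=; apply: eq_bigl => -[s t]; rewrite inE /=.
  exact: cycle_type_code.
rewrite (partition_big type_code xpredT) //=; apply: eq_bigr => f _.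
rewrite -mulnn -sum_nat_const; apply: eq_big => [s|s /eqP ->]; first by rewrite inE.
by rewrite -sum1_card; apply: eq_bigl => t; rewrite inE eq_sym.
Qed.

Lemma type_weightE f :
  type_weight n (type_of f) = (\prod_(i < n) (i.+1 ^ f i * (f i)`!))%N.
Proof.
rewrite /type_weight big_ord_recl /= mul1n; apply: eq_bigr => i _.
by rewrite -type_ofE.
Qed.

Lemma type_sizeE f : type_size n (type_of f) = (\sum_(i < n) i.+1 * f i)%N.
Proof.
rewrite /type_size big_ord_recl /= add0n; apply: eq_bigr => i _.
by rewrite -type_ofE.
Qed.

Variable R : realType.

(** A conjugacy class has proportion [1 / type_weight] by Cauchy's formula, and two independent
    permutations both fall into it with the square of this probability. *)
Lemma same_cycle_type_prob_types : same_cycle_type_prob R n =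
  \sum_(f : {ffun 'I_n -> 'I_n.+1} | (\sum_(i < n) i.+1 * f i == n)%N)
    \prod_(i < n) ((i.+1%:R ^+ f i * (f i)`!%:R) ^+ 2)^-1.
Proof.
rewrite /same_cycle_type_prob card_same_cycle_type card_prod.
have -> : #|{: 'S_n}| = n`!.
  transitivity #|perm_on [set: 'I_n]|; last by rewrite card_perm cardsT card_ord.
  by apply: eq_card => s; rewrite !inE; apply/esym/fintype.subsetP.
have nf : n`!%:R != 0 :> R by rewrite pnatr_eq0 -lt0n fact_gt0.
rewrite natr_sum mulr_suml [RHS]big_mkcond; apply: eq_bigr => f _.
have := card_type_code f; rewrite type_sizeE type_weightE.
set N := #|_|; set w := (\prod_(_ < _) _)%N.
have w0 : w%:R != 0 :> R.
  rewrite pnatr_eq0 -lt0n; apply: prodn_gt0 => i.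
  by rewrite muln_gt0 expn_gt0 fact_gt0.
have -> : \prod_(i < n) ((i.+1%:R ^+ f i * (f i)`!%:R) ^+ 2)^-1 = (w%:R ^+ 2)^-1 :> R.
  rewrite prodfV prodrXl natr_prod; congr (_ ^+ 2)^-1.
  by apply: eq_bigr => i _; rewrite natrM natrX.
case: ifP => _ E; last first.
  have -> : N = 0%N by apply/eqP; move/eqP: E; rewrite muln_eq0 => /orP[//|/eqP w00]; rewrite w00 eqxx in w0.
  by rewrite mul0r.
by rewrite natrX natrM -E natrM; move: w0 nf; rewrite -E natrM mulf_eq0 negb_or => w0 /andP[N0 _]; field; rewrite N0 w0.
Qed.

End CycleTypeProbability.

(** * The product formula for the generating function *)

Section EulerProduct.
Local Close Scope classical_set_scope.
Variable R : realType.

(** The coefficient of [z^k] in [I(z^j / j^2)]. *)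
Definition cycle_term (j k : nat) : R :=
  if (j %| k)%N then ((j%:R ^+ (k %/ j) * (k %/ j)`!%:R) ^+ 2)^-1 else 0.

Fixpoint cycle_prod (K : nat) : nat -> R :=
  if K is K'.+1 then conv (cycle_prod K') (cycle_term K) else @unit0 R.

(** Up to degree [n] the factors are polynomials, and distributing their product over the sums
    produces one term for each code [f] of a type. *)
Lemma same_cycle_type_prob_prod n : same_cycle_type_prob R n = cycle_prod n n.
Proof.
pose P (i : 'I_n) : {poly R} :=
  \sum_(k < n.+1) ((i.+1%:R ^+ k * k`!%:R) ^+ 2)^-1 *: 'X^(i.+1 * k).
have coefP (i : 'I_n) l : (l <= n)%N -> (P i)`_l = cycle_term i.+1 l.
  move=> ln; rewrite /P coef_sum /cycle_term.
  case: ifP => [/dvdnP[k lE]|il].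
    have kn : (k < n.+1)%N by rewrite ltnS (leq_trans _ ln) // lE leq_pmulr.
    rewrite (bigD1 (Ordinal kn)) //= coefZ coefXn lE mulnC eqxx mulr1 big1 ?addr0.
      by rewrite mulKn.
    move=> k' /eqP kk'; rewrite coefZ coefXn eqn_pmul2l //.
    by case: eqP => [E|]; rewrite ?mulr0 //; case: kk'; apply/val_inj.
  rewrite big1 // => k _; rewrite coefZ coefXn.
  by case: eqP => [lE|]; rewrite ?mulr0 //; rewrite lE dvdn_mulr in il.
transitivity (\prod_(i < n) P i)`_n.
  rewrite same_cycle_type_prob_types /P bigA_distr_bigA /= coef_sum [LHS]big_mkcond.
  apply: eq_bigr => f _.
  under [X in _ = (polyseq X)`_n]eq_bigr do rewrite -mul_polyC.
  rewrite [in RHS]big_split [X in _ = (polyseq X)`_n]/= -(rmorph_prod (@polyC R)) mul_polyC coefZ.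
  rewrite -(big_morph _ (exprD 'X) (expr0 _)) coefXn eq_sym.
  by case: eqP; rewrite ?mulr1 ?mulr0.
suff H K (Kn : (K <= n)%N) l : (l <= n)%N ->
    (\prod_(i < K) P (widen_ord Kn i))`_l = cycle_prod K l.
  rewrite -(H n (leqnn n) n (leqnn n)); apply: (congr1 (fun q : {poly R} => q`_n)).
  by apply: eq_bigr => i _; congr P; apply/val_inj.
elim: K Kn l => [|K IH] Kn l ln; first by rewrite big_ord0 coef1.
rewrite big_ord_recr /= coefM; apply: eq_bigr => j _.
have KW : (K <= n)%N by exact: ltnW.
rewrite coefP ?(leq_trans (leq_subr _ _)) //=; congr (_ * _).
have jn : (j <= n)%N by apply: leq_trans ln; rewrite -ltnS.
rewrite -(IH KW) //.
Qed.

End EulerProduct.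

(** * The logarithmic derivative of [I] and the decay of its coefficients *)

Section LogDerivative.
Variable R : realType.
Implicit Types (f g : nat -> R) (c : R).

(** Each coefficient of the quotient needs all the previous ones, hence a recursion on lists of
    coefficients. *)
Fixpoint conv_quot_seq (a f : nat -> R) n : seq R :=
  if n is n'.+1 then
    let l := conv_quot_seq a f n' in
    rcons l (f n' - \sum_(i < n') nth 0 l i * a (n' - i)%N)
  else [::].

Lemma conv_quot (a f : nat -> R) : a 0%N = 1 -> exists b, conv b a = f.
Proof.
move=> a0; exists (fun n => nth 0 (conv_quot_seq a f n.+1) n).
have sz n : size (conv_quot_seq a f n) = n.
  by elim: n => //= n IH; rewrite size_rcons IH.
have nthE n i : (i < n)%N -> nth 0 (conv_quot_seq a f n) i = nth 0 (conv_quot_seq a f i.+1) i.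
  elim: n => // n IH; rewrite ltnS leq_eqVlt => /orP[/eqP ->//|ni].
  by rewrite -(IH ni) [in LHS]/= nth_rcons sz ni.
apply/funext => n; rewrite /conv big_ord_recr /= subnn a0 mulr1.
rewrite nth_rcons sz ltnn eqxx.
rewrite [X in X + _](_ : _ = \sum_(i < n) nth 0 (conv_quot_seq a f n) i * a (n - i)%N).
  by rewrite addrC subrK.
by apply: eq_bigr => i _; rewrite [in RHS]nthE.
Qed.

(** The coefficients of [f(c z^k)]. *)
Definition dilate (k : nat) c f n : R := if (k %| n)%N then f (n %/ k)%N * c ^+ (n %/ k) else 0.

Lemma sum_multiples (k q : nat) (F : nat -> R) : (0 < k)%N ->
  \sum_(i < (q * k).+1 | (k %| i)%N) F i = \sum_(j < q.+1) F (j * k)%N.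
Proof.
move=> k0.
have bnd (j : 'I_q.+1) : (j * k < (q * k).+1)%N by rewrite ltnS leq_mul2r -ltnS ltn_ord orbT.
rewrite (reindex_onto (fun j => Ordinal (bnd j)) (fun i => inord (i %/ k))) /=; last first.
  move=> i ki; apply/val_inj; rewrite /= inordK ?divnK //.
  by rewrite ltnS leq_divLR // -ltnS.
apply: eq_bigl => j; rewrite dvdn_mull //= mulnK //.
by apply/eqP/val_inj; rewrite /= inordK.
Qed.

Lemma conv_dilate k c f g : (0 < k)%N ->
  conv (dilate k c f) (dilate k c g) = dilate k c (conv f g).
Proof.
move=> k0; apply/funext => n; rewrite /conv {3}/dilate.
case: ifP => [/dvdnP[q ->]|kn].
  pose F i := f (i %/ k)%N * g (q - i %/ k)%N * c ^+ q.
  transitivity (\sum_(i < (q * k).+1 | (k %| i)%N) F i).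
    rewrite [RHS]big_mkcond; apply: eq_bigr => i _ /=; rewrite /dilate.
    have iq : (i <= q * k)%N by rewrite -ltnS.
    case: ifP => ki; last by rewrite mul0r.
    rewrite dvdn_sub ?dvdn_mull // divnBr // mulnK // mulrACA -exprD /F.
    by rewrite subnKC // leq_divLR.
  rewrite sum_multiples // mulr_suml mulnK //; apply: eq_bigr => j _.
  by rewrite /F mulnK.
rewrite big1 // => i _; rewrite /dilate; have iq : (i <= n)%N by rewrite -ltnS.
case: ifP => ki; last by rewrite mul0r.
case: ifP => ki'; last by rewrite mulr0.
by have := dvdn_add ki ki'; rewrite subnKC // kn.
Qed.

Lemma theta_dilate k c f :
  theta (dilate k c f) = fun n => k%:R * dilate k c (theta f) n.
Proof.
apply/funext => n; rewrite /theta /dilate; case: ifP => [/dvdnP[q ->]|]; last by rewrite !mulr0.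
have [->|k0] := posnP k; first by rewrite muln0 !mul0r.
by rewrite mulnK // natrM; ring.
Qed.

Definition inv_fact_sq (n : nat) : R := (n`!%:R ^+ 2)^-1.

Lemma cycle_term_dilate j : cycle_term R j = dilate j (j%:R ^- 2) inv_fact_sq.
Proof.
apply/funext => k; rewrite /cycle_term /dilate /inv_fact_sq; case: ifP => // _.
by rewrite exprMn invfM mulrC exprVn -!exprM mulnC.
Qed.

Lemma inv_fact_sq_le n : inv_fact_sq n.+1 <= 4^-1 ^+ n.
Proof.
elim: n => [|n IH]; first by rewrite /inv_fact_sq factS fact0 muln1 expr1n invr1.
rewrite /inv_fact_sq factS natrM exprMn invfM [X in _ <= X]exprS.
apply: ler_pM => //; rewrite ?invr_ge0 ?exprn_ge0 //.
rewrite lef_pV2 ?posrE ?exprn_gt0 // -natrX ler_nat; nia.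
Qed.

Lemma inv_fact_sq_le9 n : inv_fact_sq n.+2 <= 4^-1 * 9^-1 ^+ n.
Proof.
elim: n => [|n IH]; first by rewrite expr0 mulr1; exact: (inv_fact_sq_le 1).
rewrite /inv_fact_sq factS natrM exprMn invfM [X in _ <= _ * X]exprS [X in _ <= X]mulrCA.
apply: ler_pM => //; rewrite ?invr_ge0 ?exprn_ge0 //.
rewrite lef_pV2 ?posrE ?exprn_gt0 // -natrX ler_nat; nia.
Qed.

Lemma inv_fact_sq_ge0 n : 0 <= inv_fact_sq n.
Proof. by rewrite /inv_fact_sq invr_ge0 exprn_ge0. Qed.

Lemma inv_fact_sqS n : inv_fact_sq n.+1 = inv_fact_sq n / n.+1%:R ^+ 2.
Proof. by rewrite /inv_fact_sq factS natrM exprMn invfM mulrC. Qed.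

(* [I] has no zero in the disk of radius [rho]: there [|(1 - 7z/10) I(z) - 1| < 1]. *)
Let rho : R := 101 / 100.
Let lin (n : nat) : R := if n == 0 then 1 else if n == 1 then - (7 / 10) else 0.
Let eps : nat -> R := conv inv_fact_sq lin.

Let epsS n : eps n.+1 = inv_fact_sq n.+1 - 7 / 10 * inv_fact_sq n.
Proof.
rewrite /eps convC /conv big_ord_recl big_ord_recl /= big1 ?addr0.
  by rewrite subn0 mul1r subSS subn0 /bump /= mulNr.
by move=> i _; rewrite /lin /= mul0r.
Qed.

(** The bare [I] would fail this test, as its coefficients beyond the constant one already sum to
    more than 1; the factor [1 - 7z/10] cancels most of the linear term. *)
Let eps_sum n : \sum_(i < n) `|eps i.+1| * rho ^+ i.+1 <= 97 / 100.
Proof.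
have rho0 : 0 <= rho by rewrite /rho; lra.
have e1 : eps 1 = 3 / 10.
  by rewrite epsS /inv_fact_sq /= fact0 expr1n invr1; field.
have e2 : eps 2 = - (45 / 100).
  by rewrite epsS /inv_fact_sq /= !factS fact0 !muln1 expr1n invr1; field.
(* From index 3 on, the first term of [eps] is at most a ninth of [inv_fact_sq m.+2], so [7/10]
   times the latter bounds the difference. Then [7/10 * 1/4 * rho^3 <= 181/1000] and
   [rho / 9 <= 1/8]. *)
have e3 m : `|eps m.+3| * rho ^+ m.+3 <= 181 / 1000 * 8^-1 ^+ m.
  rewrite epsS inv_fact_sqS.
  have m9 : m.+3%:R ^+ 2 >= 9 :> R by rewrite -natrX ler_nat; nia.
  have i0 := inv_fact_sq_ge0 m.+2; have i9 := inv_fact_sq_le9 m.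
  set x := inv_fact_sq m.+2 in i0 i9 *.
  have x9 : 0 <= x / m.+3%:R ^+ 2 <= x / 9.
    rewrite divr_ge0 ?exprn_ge0 //= ler_wpM2l // lef_pV2 ?posrE //.
  have h1 : `|x / m.+3%:R ^+ 2 - 7 / 10 * x| <= 7 / 10 * x.
    move/andP: x9 => []; set y := x / _ => y0 y9.
    by rewrite ler_norml; apply/andP; split; lra.
  apply: le_trans (ler_wpM2r (exprn_ge0 _ rho0) h1) _.
  have h2 : 9^-1 ^+ m * rho ^+ m <= 8^-1 ^+ m.
    by rewrite -exprMn lerXn2r ?nnegrE ?mulr_ge0 // /rho; lra.
  have h3 : rho ^+ 3 <= 1031 / 1000 by rewrite /rho !exprS expr0; lra.
  have h4 : 0 <= 8^-1 ^+ m :> R by rewrite exprn_ge0.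
  have h5 : 0 <= rho ^+ m by rewrite exprn_ge0.
  rewrite -[m.+3]addn3 exprD.
  have h6 : 0 <= rho ^+ 3 by rewrite exprn_ge0.
  have A := ler_wpM2r h6 (ler_wpM2r h5 i9).
  have B := ler_wpM2r h6 h2.
  have C := ler_wpM2l h4 h3.
  move: A B C h4; move: (rho ^+ 3) (rho ^+ m) (8^-1 ^+ m) (9^-1 ^+ m) => w v t u A B C t0.
  by clear -A B C t0; lra.
have geo m : \sum_(i < m) 8^-1 ^+ i <= 8 / 7 * (1 - 8^-1 ^+ m) :> R.
  elim: m => [|m IH]; first by rewrite big_ord0 expr0; lra.
  rewrite big_ord_recr /= exprS.
  have h : 0 <= 8^-1 ^+ m :> R by rewrite exprn_ge0.
  by lra.
case: n => [|[|n]]; rewrite ?big_ord0 ?big_ord1; first by lra.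
  by rewrite e1 ger0_norm ?expr1 /rho; lra.
rewrite big_ord_recl big_ord_recl /= /bump /= e1 e2 normrN !ger0_norm ?divr_ge0 //.
apply: (@le_trans _ _ (3 / 10 * rho ^+ 1 + (45 / 100 * rho ^+ 2 + 181 / 1000 * (8 / 7)))).
  rewrite lerD2l lerD2l; apply: (@le_trans _ _ (\sum_(i < n) 181 / 1000 * 8^-1 ^+ i)).
    by apply: ler_sum => i _; exact: e3.
  rewrite -mulr_sumr; apply: ler_wpM2l; first by lra.
  apply: le_trans (geo n) _; have : 0 <= 8^-1 ^+ n :> R by rewrite exprn_ge0.
  by lra.
by rewrite /rho !exprS expr0; lra.
Qed.

Lemma bernoulli_expr c n : 0 <= c -> 1 + n%:R * c <= (1 + c) ^+ n.
Proof.
move=> c0; elim: n => [|n IH]; first by rewrite mul0r addr0 expr0.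
rewrite exprS -natr1; have := ler_wpM2l (addr_ge0 ler01 c0) IH; apply: le_trans.
have h : 0 <= n%:R * c * c by rewrite !mulr_ge0.
by lra.
Qed.

(** With [q = n %/ J], Bernoulli bounds [q.+1] by a multiple of [(1 + c)^q]; the [J]-th power of
    this bounds [n.+1 ^ J] by a multiple of [(1 + c)^n]. *)
Lemma wsum_geometric a c C f : 0 < c -> (forall n, `|f n| * (1 + c) ^+ n <= C) -> wsum a f.
Proof.
move=> c0 hf; have c1 : 0 <= 1 + c by rewrite addr_ge0 // ltW.
have [J J1 aJ] := exists_nat_gt (a + 1) 1.
apply: (@wsum_power _ _ J%:R (C * (J%:R / Num.min c 1) ^+ J) _ aJ) => n.
set d := Num.min c 1.
have d0 : 0 < d by rewrite lt_min c0 ltr01.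
have d1 : d <= 1 by rewrite ge_min lexx orbT.
have dc : d <= c by rewrite ge_min lexx.
rewrite wtN wtn ler_pdivlMr ?exprn_gt0 //.
have key : n.+1%:R ^+ J <= (J%:R / d) ^+ J * (1 + c) ^+ n.
  pose q := (n %/ J)%N.
  have h1 : n.+1%:R <= J%:R * q.+1%:R :> R.
    by rewrite -natrM ler_nat mulnC /q ltn_ceil.
  have h2 : q.+1%:R * d <= (1 + c) ^+ q.
    apply: le_trans (bernoulli_expr q (ltW c0)).
    rewrite -natr1 mulrDl mul1r addrC lerD // ler_wpM2l //.
  have h3 : ((1 + c) ^+ q) ^+ J <= (1 + c) ^+ n.
    rewrite -exprM [X in _ <= _ ^+ X](divn_eq n J) exprD ler_peMr ?exprn_ge0 //.
    by rewrite exprn_ege1 // lerDl ltW.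
  have J0 : 0 <= J%:R / d by rewrite divr_ge0 // ltW.
  apply: le_trans (ler_wpM2l (exprn_ge0 J J0) h3).
  rewrite -exprMn lerXn2r ?nnegrE ?(mulr_ge0 J0) ?exprn_ge0 //.
  apply: le_trans h1 _; rewrite -mulrA ler_wpM2l // mulrC ler_pdivlMr //.
apply: le_trans (ler_wpM2l (normr_ge0 _) key) _.
by rewrite mulrCA mulrC ler_wpM2r ?exprn_ge0 // divr_ge0 // ltW.
Qed.

Let n_inv_fact_sq n : n%:R * inv_fact_sq n * rho ^+ n <= 2.
Proof.
case: n => [|n]; first by rewrite !mul0r.
have n2 : n.+1%:R <= 2 ^+ n :> R by rewrite -natrX ler_nat; exact: ltn_expl.
apply: (@le_trans _ _ (2 ^+ n * 4^-1 ^+ n * rho ^+ n.+1)).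
  rewrite ler_wpM2r ?exprn_ge0 /rho // ?divr_ge0 //.
  by apply: ler_pM => //; [exact: inv_fact_sq_ge0|exact: inv_fact_sq_le].
rewrite exprS mulrCA -!exprMn.
have h : (2 * 4^-1 * rho) ^+ n <= 1 by rewrite exprn_ile1 // /rho; lra.
have h0 : 0 <= (2 * 4^-1 * rho) ^+ n by rewrite exprn_ge0 // /rho; lra.
by rewrite /rho in h h0 *; lra.
Qed.

(** Multiplying [conv b I = theta I] by [1 - 7z/10] replaces [I] by [eps], which is 1 plus a
    sequence of norm below 1 at radius [rho]; strong induction then bounds [|b n| * rho^n]. *)
Lemma log_deriv_exists : exists b : nat -> R,
  [/\ conv b inv_fact_sq = theta inv_fact_sq, b 0%N = 0, b 1%N = 1 & forall a, wsum a b].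
Proof.
have a0 : inv_fact_sq 0 = 1 by rewrite /inv_fact_sq fact0 expr1n invr1.
have [b bE] := conv_quot (theta inv_fact_sq) a0; exists b.
have b0 : b 0%N = 0.
  by have := congr1 (fun f => f 0%N) bE; rewrite conv_coef0 /theta a0 mulr1 mul0r.
split => //.
  have := congr1 (fun f => f 1%N) bE; rewrite /conv big_ord_recr big_ord1 /=.
  by rewrite b0 mul0r add0r a0 mulr1 /theta mul1r inv_fact_sqS a0 expr1n divr1.
(* The constant [134] satisfies [4 + 97/100 * 134 <= 134], where [4] is the bound [g_bound] of the
   right-hand side. *)
move=> a; apply: (@wsum_geometric a (1 / 100) 134) => //.
rewrite (_ : 1 + 1 / 100 = rho); last by rewrite /rho; field.
have rho0 : 0 <= rho by rewrite /rho; lra.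
have eps0 : eps 0%N = 1 by rewrite /eps conv_coef0 a0 mul1r.
have gE : conv b eps = conv (theta inv_fact_sq) lin by rewrite /eps convA bE.
have g_bound n : `|conv (theta inv_fact_sq) lin n| * rho ^+ n <= 4.
  case: n => [|n].
    by rewrite conv_coef0 /theta !mul0r normr0 mul0r.
  have -> : conv (theta inv_fact_sq) lin n.+1 =
      theta inv_fact_sq n.+1 - 7 / 10 * theta inv_fact_sq n.
    rewrite convC /conv big_ord_recl big_ord_recl /= big1 ?addr0.
      by rewrite subn0 mul1r subSS subn0 /bump /= mulNr.
    by move=> i _; rewrite /lin /= mul0r.
  have t0 k : 0 <= theta inv_fact_sq k by rewrite mulr_ge0 // inv_fact_sq_ge0.
  have hN : `|theta inv_fact_sq n.+1 - 7 / 10 * theta inv_fact_sq n| <=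
      theta inv_fact_sq n.+1 + 7 / 10 * theta inv_fact_sq n.
    by have := t0 n; have := t0 n.+1; rewrite ler_norml => x0 y0; apply/andP; split; lra.
  apply: le_trans (ler_wpM2r (exprn_ge0 n.+1 rho0) hN) _; rewrite mulrDl.
  have h1 := n_inv_fact_sq n.+1; have h2 := n_inv_fact_sq n.
  have h3 : 7 / 10 * theta inv_fact_sq n * rho ^+ n.+1 <= 7 / 10 * rho * 2.
    rewrite exprS [X in X <= _](_ : _ = 7 / 10 * rho * (theta inv_fact_sq n * rho ^+ n)).
      by rewrite ler_wpM2l // mulr_ge0.
    by ring.
  apply: le_trans (lerD h1 h3) _; rewrite /rho; lra.
elim/ltn_ind => n IH.
have -> : b n = conv (theta inv_fact_sq) lin n - \sum_(i < n) b i * eps (n - i)%N.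
  by rewrite -gE /conv big_ord_recr /= subnn eps0 mulr1 addrC addrK.
apply: le_trans (ler_wpM2r (exprn_ge0 _ rho0) (ler_normB _ _)) _; rewrite mulrDl.
apply: (@le_trans _ _ (4 + 134 * (97 / 100))); last by lra.
apply: lerD => //; apply: le_trans (ler_wpM2l _ (eps_sum n)) => //.
rewrite mulr_sumr (reindex_inj rev_ord_inj) /=.
apply: le_trans (ler_wpM2r (exprn_ge0 _ rho0) (ler_norm_sum _ _ _)) _.
rewrite mulr_suml; apply: ler_sum => i _; rewrite normrM.
have E : (n - (n - i.+1) = i.+1)%N by rewrite subKn.
have -> : rho ^+ n = rho ^+ (n - i.+1) * rho ^+ i.+1 by rewrite -exprD subnK.
rewrite E mulrACA.
rewrite ler_wpM2r ?mulr_ge0 ?exprn_ge0 // IH //.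
by have := ltn_ord i; lia.
Qed.

End LogDerivative.

(** * The logarithmic derivative [h] of [W] and its approximation by polylogarithms *)

Section Recurrence.
Variable R : realType.
Variable b : nat -> R.
Hypothesis bE : conv b (inv_fact_sq R) = theta (inv_fact_sq R).
Hypothesis b0 : b 0%N = 0.
Hypothesis bsum : forall a, wsum a b.

(** The coefficients of [k B(z^k / k^2)], the logarithmic derivative of the factor
    [I(z^k / k^2)]. *)
Definition cycle_log_deriv (k : nat) n : R := k%:R * dilate k (k%:R ^- 2) b n.

Definition log_deriv (n : nat) : R := \sum_(k < n) cycle_log_deriv k.+1 n.

Lemma theta_cycle_term k : (0 < k)%N ->
  theta (cycle_term R k) = conv (cycle_log_deriv k) (cycle_term R k).
Proof.
by move=> k0; rewrite cycle_term_dilate theta_dilate /cycle_log_deriv convZl conv_dilate // bE.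
Qed.

Lemma theta_cycle_prod K :
  theta (cycle_prod R K) = conv (fun n => \sum_(k < K) cycle_log_deriv k.+1 n) (cycle_prod R K).
Proof.
elim: K => [|K IH].
  apply/funext => n; rewrite /= convf1 big_ord0 /theta /unit0.
  by case: n => [|n]; rewrite ?mul0r ?mulr0.
rewrite [cycle_prod R K.+1]/= theta_conv IH theta_cycle_term //.
rewrite (_ : (fun n => \sum_(k < K.+1) cycle_log_deriv k.+1 n) =
    fun n => \sum_(k < K) cycle_log_deriv k.+1 n + cycle_log_deriv K.+1 n); last first.
  by apply/funext => n; rewrite big_ord_recr.
rewrite convDl -convA; apply/funext => n; congr (_ + _).
by rewrite convA (convC (cycle_prod R K)) -convA.
Qed.

Lemma cycle_log_deriv_gt (k n : nat) : (n < k)%N -> cycle_log_deriv k n = 0.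
Proof.
move=> nk; rewrite /cycle_log_deriv /dilate; case: n nk => [|n] nk.
  by rewrite dvdn0 div0n b0 mul0r mulr0.
by rewrite gtnNdvd // mulr0.
Qed.

Lemma sum_cycle_log_deriv K n : (n <= K)%N -> \sum_(k < K) cycle_log_deriv k.+1 n = log_deriv n.
Proof.
move=> nK; rewrite /log_deriv (big_ord_widen K (fun k => cycle_log_deriv k.+1 n) nK).
rewrite [RHS]big_mkcond /=; apply: eq_bigr => k _; case: ltnP => // nk.
by rewrite cycle_log_deriv_gt.
Qed.

Lemma cycle_prod_stable K n : (n <= K)%N -> cycle_prod R K n = cycle_prod R n n.
Proof.
elim: K => [|K IH]; first by rewrite leqn0 => /eqP ->.
rewrite leq_eqVlt => /orP[/eqP -> //|]; rewrite ltnS => nK.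
rewrite -IH //= /conv big_ord_recr /= subnn big1 ?add0r.
  by rewrite /cycle_term dvdn0 div0n fact0 expr0 mulr1 expr1n invr1 mulr1.
move=> i _; rewrite /cycle_term gtnNdvd ?mulr0 //; have := ltn_ord i; first by lia.
by move=> ?; apply: leq_ltn_trans (leq_subr _ _) _.
Qed.

Lemma theta_same_cycle_type_prob :
  theta (same_cycle_type_prob R) = conv log_deriv (same_cycle_type_prob R).
Proof.
apply/funext => n.
have WE m : (m <= n)%N -> same_cycle_type_prob R m = cycle_prod R n m.
  by move=> mn; rewrite same_cycle_type_prob_prod cycle_prod_stable.
rewrite /theta WE //; have := congr1 (fun f => f n) (theta_cycle_prod n).
rewrite /theta => ->; apply: eq_bigr => i _.
by rewrite sum_cycle_log_deriv ?WE ?leq_subr // -ltnS.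
Qed.

(** The contribution of the factorization [n = m.+1 * k.+1]: [k.+1 / k.+1^(2 m.+1)] leaves the
    exponent [2 m + 1]. Keeping both factors visible lets the divisor sum be sorted by [m]. *)
Definition log_deriv_pair (m k : nat) : R := b m.+1 / k.+1%:R ^+ m.*2.+1.
Definition log_deriv_part (n m : nat) : R := \sum_(k < n) (m.+1 * k.+1 == n)%N%:R * log_deriv_pair m k.

Lemma log_deriv_part_le n m : (n <= m)%N -> log_deriv_part n m = 0.
Proof.
move=> nm; rewrite /log_deriv_part big1 // => k _; case: eqP => [mk|]; last by rewrite mul0r.
by exfalso; move: nm; rewrite -{1}mk; nia.
Qed.

Lemma log_derivE n M : (n <= M)%N -> log_deriv n = \sum_(m < M) log_deriv_part n m.
Proof.
move=> nM; transitivity (\sum_(m < n) log_deriv_part n m); last first.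
  rewrite (big_ord_widen M (fun m => log_deriv_part n m) nM) big_mkcond /=; apply: eq_bigr => m _.
  by case: ltnP => // nm; rewrite log_deriv_part_le.
rewrite /log_deriv_part exchange_big /=; apply: eq_bigr => -[k kn] _; rewrite /cycle_log_deriv /dilate.
rewrite [nat_of_ord (Ordinal kn)]/=; case: ifP => [/dvdnP[q nE]|kn']; last first.
  rewrite mulr0 big1 // => m _; case: eqP => [mk|]; last by rewrite mul0r.
  by exfalso; move: kn'; rewrite -mk dvdn_mull.
have q0 : (0 < q)%N.
  by case: q nE => // nE; move: kn; rewrite nE mul0n.
have qn : (q.-1 < n)%N by rewrite prednK // nE leq_pmulr.
rewrite (bigD1 (Ordinal qn) isT) big1; last first.
  move=> m mq; case: eqP => [mk|]; last by rewrite mul0r.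
  exfalso; move/eqP: mq; apply; apply/val_inj => /=.
  have : (m.+1 * k.+1 = q * k.+1)%N := etrans mk nE.
  by move/eqP; rewrite eqn_pmul2r // => /eqP <-.
rewrite [RHS]addr0 [nat_of_ord (Ordinal qn)]/= prednK //. rewrite -nE eqxx mul1r {1 2}nE mulnK // /log_deriv_pair prednK //.
rewrite mulrCA; congr (_ * _); rewrite exprVn -exprM.
have k0 : k.+1%:R != 0 :> R by rewrite pnatr_eq0.
have -> : (2 * q = q.-1.*2.+1.+1)%N by lia.
by rewrite [in LHS]exprS invfM mulrA divff ?mul1r.
Qed.

Lemma log_deriv_partE n m : log_deriv_part n m =
  b m.+1 * m.+1%:R ^+ m.*2.+1 * ((m.+1 %| n)%N%:R / n%:R ^+ m.*2.+1).
Proof.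
have [->|n0] := posnP n; first by rewrite /log_deriv_part big_ord0 expr0n invr0 !mulr0.
case: (boolP (m.+1 %| n)%N) => [/dvdnP[q nE]|mn]; last first.
  rewrite mul0r mulr0 /log_deriv_part big1 // => k _; case: eqP => [mk|]; last by rewrite mul0r.
  by rewrite -mk dvdn_mulr in mn.
have q0 : (0 < q)%N by move: n0; rewrite nE; case: q {nE}.
have qn : (q.-1 < n)%N by rewrite prednK // nE leq_pmulr.
rewrite /log_deriv_part (bigD1 (Ordinal qn) isT) big1; last first.
  move=> [k kn] kq; rewrite [nat_of_ord (Ordinal kn)]/=; case: eqP => [mk|]; last by rewrite mul0r.
  exfalso; move/eqP: kq; apply; apply/val_inj => /=.
  have : (k.+1 * m.+1 = q * m.+1)%N := etrans (mulnC _ _) (etrans mk nE).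
  by move/eqP; rewrite eqn_pmul2r // => /eqP <-.
rewrite [LHS]addr0 [nat_of_ord (Ordinal qn)]/= prednK // mulnC -nE eqxx !mul1r /log_deriv_pair prednK //.
rewrite nE natrM exprMn.
by field; rewrite !expf_neq0 ?pnatr_eq0 -?lt0n.
Qed.

Lemma polylog_log_deriv_part m : polylog_span (fun n => log_deriv_part n m).
Proof.
have iterE j f k : iter j (@divn_seq R) f k = f k / k%:R ^+ j.
  elim: j => [|j IH] /=; first by rewrite expr0 divr1.
  by rewrite /divn_seq IH exprSr invfM mulrA.
rewrite (_ : (fun n => _) = fun n => b m.+1 * m.+1%:R ^+ m.*2.+1 *
    iter m.*2 (@divn_seq R) (divn_seq (fun j => (m.+1 %| j)%N%:R)) n).
  apply: polylogZ; elim: (m.*2) => [|j IH] /=; last exact: Polylog_divn.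
  rewrite -[X in divn_seq X]convf1; apply: Polylog_conv; last exact: Polylog_unit0.
  by exists m.+1 => // n; rewrite dvdn_addl.
apply/funext => n; rewrite log_deriv_partE iterE /divn_seq.
by rewrite -[_ / n%:R / _]mulrA -invfM -exprS.
Qed.

Lemma log_deriv_part_bound n m : (0 < n)%N -> (0 < m)%N ->
  `|log_deriv_part n m| * n%:R ^+ 2 <= `|b m.+1| * m.+1%:R ^+ 2.
Proof.
move=> n0 m0; rewrite log_deriv_partE.
have n1 : 0 < n%:R :> R by rewrite ltr0n.
case: (boolP (m.+1 %| n)%N) => [mn|_]; last first.
  by rewrite mul0r mulr0 normr0 mul0r mulr_ge0 ?exprn_ge0.
rewrite mul1r -mulrA -exprVn -exprMn normrM -mulrA ler_wpM2l //.
set x : R := _ / _; have x0 : 0 <= x by rewrite divr_ge0.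
have x1 : x <= 1 by rewrite ler_pdivrMr // mul1r ler_nat dvdn_leq.
rewrite ger0_norm ?exprn_ge0 // -ler_pdivlMr ?exprn_gt0 // -exprVn -exprMn.
by apply: ler_wiXn2l => //; lia.
Qed.

(** The parts [m < M] are words. For [m >= M] a pair contributes at most [|b m.+1| / k.+1^M], and
    [wt a n <= wt a m.+1 * wt a k.+1] splits the error into a sum over [m], finite by the decay of
    [b], and a sum over [k], finite as [M > a + 1]. *)
Lemma near_polylog_log_deriv a : near_polylog a log_deriv.
Proof.
suff H c : 0 <= c -> near_polylog c log_deriv.
  have := H (Num.max a 0); rewrite le_max lexx orbT => /(_ isT).
  by apply: near_polylog_le; rewrite le_max lexx.
move: c {a} => a a0.
have [M _ aM] := exists_nat_gt (a + 1) 1.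
exists (fun n => \sum_(m < M) log_deriv_part n m).
  elim: M {aM} => [|M IH].
    rewrite (_ : (fun n => _) = fun=> 0); first exact: polylog0.
    by apply/funext => n; rewrite big_ord0.
  rewrite (_ : (fun n => _) = fun n => \sum_(m < M) log_deriv_part n m + log_deriv_part n M).
    by apply: polylogD => //; exact: polylog_log_deriv_part.
  by apply/funext => n; rewrite big_ord_recr.
have [B Bge0 hB] := wsum_ge0 (bsum a).
have : wsum a (fun n => (n%:R ^+ M)^-1 : R).
  apply: (@wsum_inv_power _ a 1 M 0 _ aM) => n n0.
  by rewrite normfV normrX ger0_norm // mul1r.
move=> /wsum_ge0[D D0 hD]; exists (B * D) => N.
pose F m k := `|b m.+1| * wt a m.+1 * (`|(k.+1%:R ^+ M)^-1| * wt a k.+1).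
have F0 m k : 0 <= F m k by rewrite !mulr_ge0 ?wt_ge0.
pose B' := maxn M N.
apply: (@le_trans _ _ (\sum_(n < N) \sum_(m < B') \sum_(k < N)
    (m.+1 * k.+1 == n)%N%:R * F m k)).
  apply: ler_sum => n _.
  have nB : (n <= B')%N by rewrite leq_max (ltnW (ltn_ord n)) orbT.
  have -> : log_deriv n - \sum_(m < M) log_deriv_part n m =
      \sum_(m < B') (log_deriv_part n m - (if (m < M)%N then log_deriv_part n m else 0)).
    rewrite (log_derivE nB) sumrB -big_mkcond.
    by rewrite -(big_ord_widen B' (fun m => log_deriv_part n m)) ?leq_maxl.
  apply: le_trans (ler_wpM2r (wt_ge0 _ _) (ler_norm_sum _ _ _)) _.
  rewrite mulr_suml; apply: ler_sum => m _.
  have F1 k : 0 <= (m.+1 * k.+1 == n)%N%:R * F m k by rewrite mulr_ge0.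
  case: ltnP => mM; first by rewrite subrr normr0 mul0r sumr_ge0.
  rewrite subr0 /log_deriv_part; apply: (@le_trans _ _ (\sum_(k < n) (m.+1 * k.+1 == n)%N%:R * F m k)).
    apply: le_trans (ler_wpM2r (wt_ge0 _ _) (ler_norm_sum _ _ _)) _.
    rewrite mulr_suml; apply: ler_sum => k _; case: eqP => [mk|]; last first.
      by rewrite !mul0r normr0 mul0r.
    rewrite !mul1r /log_deriv_pair /F normrM !normfV !normrX (ger0_norm (ler0n R k.+1)).
    have h1 : wt a n <= wt a m.+1 * wt a k.+1.
      rewrite /wt -powRM // ge0_ler_powR ?nnegrE ?mulr_ge0 //.
      by rewrite -natrM ler_nat; move: mk => /= mk; nia.
    have h2 : (k.+1%:R ^+ m.*2.+1)^-1 <= (k.+1%:R ^+ M)^-1 :> R.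
      rewrite lef_pV2 ?posrE ?exprn_gt0 // ler_weXn2l ?ler1n //.
      by apply: leq_trans mM _; rewrite -addnn leqW // leq_addr.
    rewrite -mulrA [X in _ <= X](_ : _ = `|b m.+1| *
        ((k.+1%:R ^+ M)^-1 * (wt a m.+1 * wt a k.+1))); last by ring.
    by rewrite ler_wpM2l // ler_pM ?wt_ge0 ?invr_ge0 ?exprn_ge0.
  by apply: (ler_sum_widen F1); exact: ltnW.
rewrite exchange_big /=; under eq_bigr do rewrite exchange_big /=.
have at_most1 x : \sum_(n < N) (x == n :> nat)%:R <= 1 :> R.
  have [xN|Nx] := ltnP x N.
    rewrite (bigD1 (Ordinal xN)) //= eqxx big1 ?addr0 // => n nx.
    by rewrite (_ : (x == n) = false) //; apply: contraNF nx => /eqP xn; apply/eqP/val_inj.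
  rewrite big1 ?ler01 // => n _; rewrite (_ : (x == n) = false) //.
  by apply/eqP => xn; have := ltn_ord n; rewrite -xn ltnNge Nx.
apply: (@le_trans _ _ (\sum_(m < B') \sum_(k < N) F m k)).
  apply: ler_sum => m _; apply: ler_sum => k _; rewrite -mulr_suml.
  by rewrite ler_piMl.
under eq_bigr do rewrite -mulr_sumr.
rewrite -mulr_suml; apply: ler_pM; rewrite ?sumr_ge0 //.
- by move=> i _; rewrite mulr_ge0 ?wt_ge0.
- by move=> i _; rewrite mulr_ge0 ?wt_ge0.
- apply: le_trans (hB B'.+1); rewrite [X in _ <= X]big_ord_recl lerDr.
  by rewrite mulr_ge0 ?wt_ge0.
- apply: le_trans (hD N.+1); rewrite [X in _ <= X]big_ord_recl lerDr.
  by rewrite mulr_ge0 ?wt_ge0.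
Qed.

End Recurrence.

(** * Convergence of the infinite product to [W(1)] *)

Section EulerProductLimit.
Variable R : realType.
Implicit Types (f g : nat -> R) (z : R).

(** The sum as least upper bound of the partial sums: in this form sums are compared without
    convergence arguments. *)
Definition nonneg_sum f (A : R) :=
  [/\ forall n, 0 <= f n, forall N, \sum_(n < N) f n <= A &
      forall B, (forall N, \sum_(n < N) f n <= B) -> A <= B].

Lemma nonneg_sum_cvg f A : nonneg_sum f A -> series f @ \oo --> A.
Proof.
move=> [f0 fA Amin].
have nd : nondecreasing_seq (series f) by exact: nondecreasing_series.
have cv : cvgn (series f).
  apply: nondecreasing_is_cvgn => //; exists A => _ [N _ <-].
  by rewrite seriesEord; exact: fA.
suff -> : A = limn (series f) by [].
apply/eqP; rewrite eq_le; apply/andP; split.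
  by apply: Amin => N; have := nondecreasing_cvgn_le nd cv N; rewrite seriesEord.
by apply: (@limn_le _ (series f) _ _ 0) => // n _; rewrite seriesEord; exact: fA.
Qed.

Lemma nonneg_sum_bounded f C : (forall n, 0 <= f n) ->
  (forall N, \sum_(n < N) f n <= C) -> nonneg_sum f (limn (series f)).
Proof.
move=> f0 fC.
have nd : nondecreasing_seq (series f) by exact: nondecreasing_series.
have cv : cvgn (series f).
  apply: nondecreasing_is_cvgn => //; exists C => _ [N _ <-].
  by rewrite seriesEord; exact: fC.
split=> // [N|B fB].
  by have := nondecreasing_cvgn_le nd cv N; rewrite seriesEord.
by apply: (@limn_le _ (series f) _ _ 0) => // n _; rewrite seriesEord; exact: fB.
Qed.

(** The triangle of side [N] lies in the square of side [N], which lies in the triangle of side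
    [2 N]. *)
Lemma nonneg_sum_conv f g A B : nonneg_sum f A -> nonneg_sum g B ->
  nonneg_sum (conv f g) (A * B).
Proof.
move=> [f0 fA Amin] [g0 gB Bmin].
have A0 : 0 <= A by have := fA 0%N; rewrite big_ord0.
have B0 : 0 <= B by have := gB 0%N; rewrite big_ord0.
split=> [n|N|C hC].
- by apply: sumr_ge0 => i _; rewrite mulr_ge0.
- apply: (@le_trans _ _ (\sum_(j < N) \sum_(k < N) f j * g k)).
    by apply: (@sum_triangle_le R (fun j k => f j * g k)) => j k; rewrite mulr_ge0.
  under eq_bigr do rewrite -mulr_sumr.
  by rewrite -mulr_suml ler_pM ?sumr_ge0.
have C0 : 0 <= C by have := hC 0%N; rewrite big_ord0.
have key N : (\sum_(j < N) f j) * (\sum_(k < N) g k) <= C.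
  apply: le_trans (hC (N + N)%N).
  rewrite /conv (@sum_triangle R (fun j k => f j * g k)).
  apply: (@le_trans _ _ (\sum_(j < N) \sum_(k < N + N - j) f j * g k)).
    rewrite mulr_suml; apply: ler_sum => j _; rewrite mulr_sumr.
    apply: (@ler_sum_widen R (fun k => f j * g k)); first by move=> k; rewrite mulr_ge0.
    by have := ltn_ord j; lia.
  apply: (@ler_sum_widen R (fun j => \sum_(k < N + N - j) f j * g k)); last by lia.
  by move=> j; apply: sumr_ge0 => k _; rewrite mulr_ge0.
have cf := nonneg_sum_cvg (And3 f0 fA Amin); have cg := nonneg_sum_cvg (And3 g0 gB Bmin).
apply: (@limn_le _ (fun n => series f n * series g n) _ _ 0); first exact: cvgM.
by move=> n _; rewrite !seriesEord; exact: key.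
Qed.

Lemma nonneg_sum_unit0 : nonneg_sum (@unit0 R) 1.
Proof.
have h N : \sum_(n < N.+1) unit0 R n = 1.
  by rewrite big_ord_recl /unit0 /= big1 ?addr0.
split=> [n|[|N]|B hB]; rewrite /unit0 ?ler0n //; first by rewrite big_ord0.
  by rewrite h.
by rewrite -(h 0%N).
Qed.

Lemma nonneg_sum_dilate k c f A : (0 < k)%N -> 0 <= c ->
  nonneg_sum (fun n => f n * c ^+ n) A -> nonneg_sum (dilate k c f) A.
Proof.
move=> k0 c0 [f0 fA Amin].
have d0 n : 0 <= dilate k c f n by rewrite /dilate; case: ifP.
have h q : \sum_(n < (q * k).+1) dilate k c f n = \sum_(j < q.+1) f j * c ^+ j.
  transitivity (\sum_(n < (q * k).+1 | (k %| n)%N) f (n %/ k)%N * c ^+ (n %/ k)).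
    by rewrite [RHS]big_mkcond.
  rewrite (sum_multiples _ (fun n => f (n %/ k)%N * c ^+ (n %/ k)) k0).
  by apply: eq_bigr => j _; rewrite mulnK.
split=> // [N|B hB].
  apply: le_trans (fA N.+1); rewrite -h; apply: ler_sum_widen => //.
  by rewrite leqW // leq_pmulr.
apply: Amin => -[|N]; last by rewrite -h.
by rewrite big_ord0; have := hB 0%N; rewrite big_ord0.
Qed.

Lemma sum_inv_fact_sq_le z N : 0 <= z <= 1 -> \sum_(n < N) inv_fact_sq R n * z ^+ n <= 1 + 2 * z.
Proof.
move=> /andP[z0 z1]; case: N => [|N].
  by rewrite big_ord0 addr_ge0 // mulr_ge0.
have a0 : inv_fact_sq R 0 = 1 by rewrite /inv_fact_sq fact0 expr1n invr1.
rewrite big_ord_recl a0 mulr1 lerD2l.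
apply: (@le_trans _ _ (\sum_(n < N) 2^-1 ^+ n * z)).
  apply: ler_sum => n _; rewrite [z ^+ _]exprS [z * _]mulrC mulrA ler_wpM2r //.
  rewrite -[X in _ <= X]mulr1; apply: ler_pM; rewrite ?exprn_ge0 ?exprn_ile1 //.
    by rewrite invr_ge0 exprn_ge0.
  apply: le_trans (inv_fact_sq_le R n) _; rewrite lerXn2r ?nnegrE //; lra.
rewrite -mulr_suml ler_wpM2r //.
have -> : \sum_(n < N) 2^-1 ^+ n = 2 - 2 * 2^-1 ^+ N :> R.
  elim: N => [|N IH]; first by rewrite big_ord0 expr0; lra.
  by rewrite big_ord_recr /= IH exprS; lra.
by rewrite gerBl mulr_ge0 // exprn_ge0.
Qed.

Lemma I_fun_sum z : 0 <= z <= 1 -> nonneg_sum (fun n => inv_fact_sq R n * z ^+ n) (I_fun z).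
Proof.
move=> z01; rewrite /I_fun.
rewrite (_ : (fun n => z ^+ n / _) = fun n => inv_fact_sq R n * z ^+ n); last first.
  by apply/funext => n; rewrite mulrC.
apply: nonneg_sum_bounded => [n|N]; last exact: sum_inv_fact_sq_le.
by rewrite mulr_ge0 ?inv_fact_sq_ge0 ?exprn_ge0 //; case/andP: z01.
Qed.

Lemma I_fun_le z : 0 <= z <= 1 -> I_fun z <= 1 + 2 * z.
Proof. by move=> z01; have [_ _] := I_fun_sum z01; apply => N; exact: sum_inv_fact_sq_le. Qed.

Lemma I_fun_ge1 z : 0 <= z <= 1 -> 1 <= I_fun z.
Proof.
move=> z01; have [_ /(_ 1%N) h _] := I_fun_sum z01.
by move: h; rewrite big_ord1 /inv_fact_sq fact0 !expr1n invr1 mulr1.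
Qed.

Lemma inv_sq01 (k : nat) : 0 <= 1 / (k%:R : R) ^+ 2 <= 1.
Proof.
rewrite divr_ge0 ?exprn_ge0 //=; case: k => [|k]; first by rewrite expr0n invr0 mulr0.
by rewrite ler_pdivrMr ?exprn_gt0 // mul1r exprn_ege1 // ler1n.
Qed.

Definition I_prod K : R := \prod_(1 <= k < K.+1) I_fun (1 / k%:R ^+ 2).

Lemma cycle_prod_sum K : nonneg_sum (cycle_prod R K) (I_prod K).
Proof.
elim: K => [|K IH]; first by rewrite /I_prod big_geq //; exact: nonneg_sum_unit0.
rewrite /I_prod big_nat_recr //=; apply: nonneg_sum_conv => //.
rewrite cycle_term_dilate; apply: nonneg_sum_dilate => //.
by have := I_fun_sum (inv_sq01 K.+1); rewrite div1r.
Qed.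

(** Each factor satisfies [I(1/k^2) <= 1 + 2/k^2 <= exp(2/k^2)]. *)
Lemma I_prod_bounded : exists C, forall K, I_prod K <= C.
Proof.
have [D hD] := @wsum_zeta R 1 ltr01.
exists (expR (2 * D)) => K.
apply: (@le_trans _ _ (expR (2 * \sum_(n < K) wt (- (1 + 1)) n))); last first.
  by rewrite ler_expR ler_wpM2l.
elim: K => [|K IH]; first by rewrite /I_prod big_geq // big_ord0 mulr0 expR0.
rewrite /I_prod big_nat_recr //= big_ord_recr /= mulrDr expRD.
apply: ler_pM => //.
- apply: prodr_ge0 => k _; apply: le_trans (I_fun_ge1 (inv_sq01 k)); exact: ler01.
- by apply: le_trans (I_fun_ge1 (inv_sq01 K.+1)); exact: ler01.
- apply: le_trans (I_fun_le (inv_sq01 K.+1)) _.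
  apply: le_trans (expR_ge1Dx _); rewrite lerD2l ler_wpM2l //.
  by rewrite wtN div1r (wtn R 2).
Qed.

Let W := same_cycle_type_prob R.

Lemma cycle_term_ge0 j k : 0 <= cycle_term R j k.
Proof. by rewrite /cycle_term; case: ifP => // _; rewrite invr_ge0 exprn_ge0. Qed.

Lemma cycle_prod_ge0 K n : 0 <= cycle_prod R K n.
Proof. by have [] := cycle_prod_sum K. Qed.

Lemma cycle_prod_le K n : cycle_prod R K n <= W n.
Proof.
have [nK|Kn] := leqP n K.
  by rewrite cycle_prod_stable // /W same_cycle_type_prob_prod.
suff mono d : cycle_prod R K n <= cycle_prod R (K + d) n.
  by have := mono (n - K)%N; rewrite subnKC ?(ltnW Kn) // -same_cycle_type_prob_prod.
elim: d => [|d IH]; first by rewrite addn0.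
apply: le_trans IH _; rewrite addnS /= /conv big_ord_recr /= subnn.
have -> : cycle_term R (K + d).+1 0 = 1.
  by rewrite /cycle_term dvdn0 div0n fact0 expr0 mulr1 expr1n invr1.
rewrite mulr1 lerDr sumr_ge0 // => i _.
by rewrite mulr_ge0 ?cycle_prod_ge0 ?cycle_term_ge0.
Qed.

Lemma sum_prob_le_I_prod N : \sum_(n < N) W n <= I_prod N.
Proof.
have [_ h _] := cycle_prod_sum N; apply: le_trans (h N).
apply: ler_sum => n _; rewrite /W same_cycle_type_prob_prod cycle_prod_stable //.
exact: ltnW.
Qed.

Lemma same_cycle_type_prob_ge0 n : 0 <= W n.
Proof. by rewrite /W same_cycle_type_prob_prod cycle_prod_ge0. Qed.

Lemma gfE : (fun n => W n * 1 ^+ n) = W.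
Proof. by apply/funext => n; rewrite expr1n mulr1. Qed.

Lemma prob_sum : nonneg_sum W (same_cycle_type_gf (1 : R)).
Proof.
rewrite /same_cycle_type_gf gfE; have [C hC] := I_prod_bounded.
apply: (@nonneg_sum_bounded _ C) => [n|N]; first exact: same_cycle_type_prob_ge0.
exact: le_trans (sum_prob_le_I_prod N) (hC N).
Qed.

Lemma I_prod_le_gf K : I_prod K <= same_cycle_type_gf (1 : R).
Proof.
have [_ _ h] := cycle_prod_sum K; apply: h => N.
have [_ h _] := prob_sum; apply: le_trans (h N).
by apply: ler_sum => n _; exact: cycle_prod_le.
Qed.

Lemma gf_le C : (forall K, I_prod K <= C) -> same_cycle_type_gf (1 : R) <= C.
Proof.
move=> hC; have [_ _] := prob_sum; apply => N.
exact: le_trans (sum_prob_le_I_prod N) (hC N).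
Qed.

(** The coefficients of the [N]-th partial product equal those of [W] up to degree [N] and never
    exceed them, so its value at 1 lies between a partial sum of [W(1)] and [W(1)]. *)
Lemma cvg_I_prod : I_prod @ \oo --> same_cycle_type_gf (1 : R).
Proof.
apply: (@squeeze_cvgr _ _ _ _ (series W) (fun=> same_cycle_type_gf 1)).
- apply: nearW => N; rewrite I_prod_le_gf seriesEord andbT.
  exact: sum_prob_le_I_prod.
- exact: nonneg_sum_cvg prob_sum.
- exact: cvg_cst.
Qed.

Lemma wsum_prob : wsum 0 W.
Proof.
exists (same_cycle_type_gf 1) => N; have [_ h _] := prob_sum; apply: le_trans (h N).
by apply: ler_sum => n _; rewrite wt0 mulr1 ger0_norm ?same_cycle_type_prob_ge0.
Qed.

End EulerProductLimit.

(** * The leading term and its error bound *)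

Section LeadingTerm.
Variable R : realType.

Let H n : R := \sum_(k < n) k.+1%:R^-1.

Lemma harmonic_le_ln n : H n <= 1 + ln n%:R.
Proof.
case: n => [|n]; first by rewrite /H big_ord0 ln0 // addr0 ler01.
elim: n => [|n IH]; first by rewrite /H big_ord1 invr1 ln1 addr0.
have -> : H n.+2 = H n.+1 + n.+2%:R^-1 by rewrite /H big_ord_recr.
have h : n.+2%:R^-1 <= ln n.+2%:R - ln n.+1%:R :> R.
  rewrite -[X in _ <= X]opprB -ln_div ?posrE ?ltr0Sn // lerNr.
  have -> : n.+1%:R / n.+2%:R = 1 + - n.+2%:R^-1 :> R.
    rewrite -[n.+2%:R]natr1 -[n.+1%:R]natr1; field; have := ler0n R n => ?; lra.
  by apply: le_ln1Dx; rewrite ltrN2 invf_lt1 ?ltr1n // ltr0n.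
by apply: le_trans (lerD IH h) _; rewrite addrA addrAC addrK.
Qed.

Let Q n : R := \sum_(j < n) (j%:R^-1 / (n - j)%:R).

(** Partial fractions: [1 / (j (n - j)) = (1/j + 1/(n - j)) / n]. The term [j = 0] is 0 because the
    inverse of 0 is 0. *)
Lemma sum_inv_prod_le n : (0 < n)%N -> Q n <= 2 * (1 + ln n%:R) / n%:R.
Proof.
move=> n0; have n1 : n%:R != 0 :> R by rewrite pnatr_eq0 -lt0n.
apply: (@le_trans _ _ (n%:R^-1 * (H n + H n))); last first.
  by rewrite mulrC ler_pdivlMr ?ltr0n // divfK //; have := harmonic_le_ln n; lra.
apply: (@le_trans _ _ (\sum_(j < n) n%:R^-1 * (j%:R^-1 + (n - j)%:R^-1))).
  apply: ler_sum => j _; have nj : (n - j)%:R != 0 :> R.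
    by rewrite pnatr_eq0 -lt0n subn_gt0.
  have [->|j0] := posnP j; first by rewrite invr0 mul0r mulr_ge0 // addr_ge0.
  have j1 : j%:R != 0 :> R by rewrite pnatr_eq0 -lt0n.
  have nE : n%:R = j%:R + (n - j)%:R :> R by rewrite -natrD subnKC // ltnW.
  rewrite nE in n1 *; rewrite le_eqVlt; apply/orP; left; apply/eqP.
  by field; rewrite nj n1 j1.
rewrite -mulr_sumr ler_wpM2l // big_split lerD //=.
  have -> : H n = \sum_(j < n.+1) j%:R^-1 by rewrite big_ord_recl invr0 add0r.
  by apply: (@ler_sum_widen R (fun j => j%:R^-1)).
rewrite [X in X <= _](reindex_inj rev_ord_inj) /=.
by apply: ler_sum => j _; rewrite subKn.
Qed.

Lemma sum_inv_sq_le2 N : \sum_(k < N) (k.+1%:R ^+ 2)^-1 <= 2 :> R.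
Proof.
case: N => [|N]; first by rewrite big_ord0.
apply: (@le_trans _ _ (2 - N.+1%:R^-1)); last by rewrite gerBl.
elim: N => [|N IH]; first by rewrite big_ord1 expr1n invr1; lra.
rewrite big_ord_recr /=; apply: le_trans (lerD IH (lexx _)) _.
rewrite -[N.+2%:R]natr1; set x : R := N.+1%:R.
have x1 : 1 <= x by rewrite ler1n.
rewrite -addrA lerD2l -subr_ge0.
have -> : - (x + 1)^-1 - (- x^-1 + ((x + 1) ^+ 2)^-1) = (x * (x + 1) ^+ 2)^-1.
  by field; apply/andP; split; lra.
by rewrite invr_ge0 mulr_ge0 ?exprn_ge0 //; lra.
Qed.

Variable b : nat -> R.
Hypothesis bE : conv b (inv_fact_sq R) = theta (inv_fact_sq R).
Hypothesis b0 : b 0%N = 0.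
Hypothesis b1 : b 1%N = 1.
Hypothesis bsum : forall a, wsum a b.

Let h := log_deriv b.
Let W := same_cycle_type_prob R.
Let S : R := same_cycle_type_gf 1.

(** The part [m = 0] is [b 1 / n = 1 / n]; in the others [m.+1 / n <= 1] occurs to a power at least
    3, of which two factors are kept. *)
Lemma log_deriv_bound : exists2 D, 0 <= D &
  forall n, (0 < n)%N -> `|h n - n%:R^-1| <= D / n%:R ^+ 2.
Proof.
have [D D0 hD] := wsum_ge0 (bsum 2); exists D => // n n0.
have n1 : 0 < n%:R :> R by rewrite ltr0n.
case: n n0 n1 => // n _ n1.
rewrite /h (log_derivE b (leqnn n.+1)) big_ord_recl.
rewrite log_deriv_partE !expr1 mulr1 b1 mul1r dvd1n mul1r addrC addKr.
apply: le_trans (ler_norm_sum _ _ _) _.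
rewrite ler_pdivlMr ?exprn_gt0 // mulr_suml.
apply: le_trans (hD n.+2); rewrite [X in _ <= X]big_ord_recl ler_wpDl ?mulr_ge0 ?wt_ge0 //.
rewrite [X in _ <= X]big_ord_recl ler_wpDl ?mulr_ge0 ?wt_ge0 //.
apply: ler_sum => m _; rewrite (wtn R 2).
apply: le_trans (log_deriv_part_bound _ _ _) _ => //.
by rewrite ler_wpM2l // lerXn2r ?nnegrE // ler_nat.
Qed.

Lemma same_cycle_type_prob_sum n :
  n%:R * W n = \sum_(j < n) h (n - j)%N * W j.
Proof.
have := congr1 (fun f => f n) (theta_same_cycle_type_prob bE b0).
rewrite /theta => ->; rewrite convC /conv big_ord_recr /= subnn.
rewrite [log_deriv b 0]/log_deriv big_ord0 mulr0 addr0.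
by apply: eq_bigr => j _; rewrite mulrC.
Qed.

Lemma sum_inv_prod_small (c : R) : exists n0, forall n, (n0 <= n)%N -> c * Q n <= 2^-1.
Proof.
have [K K0 hK] := @ln_nat_bound R 1 2^-1 ltac:(lra).
pose c' := Num.max c 0; have c0 : 0 <= c' by rewrite le_max lexx orbT.
(* With [w = sqrt(n + 1)] one has [1 + ln n <= (1 + K) w] and [w^2 <= 2 n], so [8 c' (1 + K) <= w]
   is enough. *)
have [n0 n01 hn0] := exists_nat_gt ((8 * c' * (1 + K)) `^ 2) 1.
exists n0 => n nn; have n1 : (0 < n)%N by exact: leq_trans nn.
have Q0 : 0 <= Q n by apply: sumr_ge0 => j _; rewrite divr_ge0.
apply: (@le_trans _ _ (c' * Q n)); first by rewrite ler_wpM2r // le_max lexx.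
apply: le_trans (ler_wpM2l c0 (sum_inv_prod_le n1)) _.
have w1 : 1 <= wt 2^-1 n :> R.
  by have := @wt_le R 0 2^-1 n; rewrite wt0; apply; lra.
have hl : 1 + ln n%:R <= (1 + K) * wt 2^-1 n.
  by rewrite mulrDl mul1r lerD //; have := hK n; rewrite expr1.
have hw : 8 * c' * (1 + K) <= wt 2^-1 n.
  have X0 : 0 <= 8 * c' * (1 + K) by rewrite !mulr_ge0 // addr_ge0.
  have -> : 8 * c' * (1 + K) = ((8 * c' * (1 + K)) `^ 2) `^ 2^-1.
    by rewrite -powRrM divff ?powRr1 // pnatr_eq0.
  rewrite /wt ge0_ler_powR ?nnegrE ?powR_ge0 //.
  by apply: le_trans (ltW hn0) _; rewrite ler_nat leqW.
have ww : wt 2^-1 n * wt 2^-1 n = n.+1%:R :> R.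
  by rewrite -wtD -(wt1 R n); congr wt; field.
have nn1 : n.+1%:R <= 2 * n%:R :> R by rewrite -natrM ler_nat; lia.
rewrite mulrA ler_pdivrMr ?ltr0n // [2 * _]mulrC mulrA.
move: ww hw hl nn1 w1; move: (wt _ n) (ln _) => w l ww hw hl nn1 w1.
have := ler_wpM2l c0 hl; have := ler_wpM2r (le_trans ler01 w1) hw.
rewrite ww; nra.
Qed.

(** Writing [n = (n - j) + j] in [n * \sum_j h (n - j) W j], the first half gives at most [C S], and
    the second, by induction, at most [C B Q n <= B / 2] for large [n]; hence [B >= 2 C S] closes
    the induction. *)
Lemma same_cycle_type_prob_bound : exists2 B, 0 <= B & forall n, n%:R ^+ 2 * W n <= B.
Proof.
have [D D0 hD] := log_deriv_bound; pose C := 1 + D.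
have C0 : 0 <= C by rewrite addr_ge0.
have hC n : (0 < n)%N -> h n <= C / n%:R.
  move=> n0; have := hD n n0; rewrite ler_norml => /andP[_].
  rewrite lerBlDl => hn; apply: le_trans hn _; rewrite /C mulrDl mul1r lerD2l.
  rewrite ler_wpM2l // lef_pV2 ?posrE ?exprn_gt0 ?ltr0n //.
  by rewrite expr2 ler_peMl // ler1n.
have W0 := same_cycle_type_prob_ge0 R; have [_ WS _] := prob_sum R.
have S0 : 0 <= S by have := WS 0%N; rewrite big_ord0.
have [n0 hn0] := sum_inv_prod_small C.
pose B := Num.max (2 * (C * S)) (\sum_(n < n0) n%:R ^+ 2 * W n).
have B0 : 0 <= B by rewrite le_max !mulr_ge0.
exists B => //; elim/ltn_ind => n IH; have [nn|nn] := ltnP n n0.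
  rewrite le_max; apply/orP; right.
  rewrite (bigD1 (Ordinal nn)) //= lerDl sumr_ge0 // => i _.
  by rewrite mulr_ge0 ?exprn_ge0.
rewrite expr2 -mulrA same_cycle_type_prob_sum mulr_sumr.
apply: (@le_trans _ _ (\sum_(j < n) (C * W j + (C * B) * (j%:R^-1 / (n - j)%:R)))).
  apply: ler_sum => j _; have nj : (0 < n - j)%N by rewrite subn_gt0.
  have nj0 : 0 < (n - j)%:R :> R by rewrite ltr0n.
  rewrite mulrA; apply: (@le_trans _ _ (n%:R * (C / (n - j)%:R) * W j)).
    by rewrite ler_wpM2r ?W0 // ler_wpM2l // hC.
  have -> : n%:R = (n - j)%:R + j%:R :> R by rewrite -natrD subnK // ltnW.
  rewrite [X in X <= _](_ : _ = C * W j + C / (n - j)%:R * (j%:R * W j)); last first.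
    by field; rewrite gt_eqF.
  rewrite lerD2l [X in _ <= X](_ : _ = C / (n - j)%:R * (B / j%:R)); last by ring.
  rewrite ler_wpM2l ?divr_ge0 //; have := IH j (ltn_ord j).
  have [->|j0] := posnP j; first by rewrite invr0 mul0r mulr0.
  by rewrite expr2 -mulrA mulrC ler_pdivlMr ?ltr0n // mulrC mulrA.
rewrite big_split /= -!mulr_sumr -/(Q n).
apply: (@le_trans _ _ (C * S + B * 2^-1)).
  rewrite lerD ?ler_wpM2l //; first exact: WS.
  by rewrite (mulrC C) -mulrA ler_wpM2l // hn0.
have : 2 * (C * S) <= B by rewrite le_max lexx.
by lra.
Qed.

Lemma sum_inv_sq_conv n :
  \sum_(j < n) ((n - j)%:R ^+ 2)^-1 * (j.+1%:R ^+ 2)^-1 <= 8 / n.+1%:R ^+ 2 :> R.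
Proof.
have n1 : 0 < n.+1%:R :> R by rewrite ltr0n.
apply: (@le_trans _ _ (\sum_(j < n)
    2 / n.+1%:R ^+ 2 * (((n - j)%:R ^+ 2)^-1 + (j.+1%:R ^+ 2)^-1))).
  apply: ler_sum => j _; have nj : 0 < (n - j)%:R :> R by rewrite ltr0n subn_gt0.
  have j1 : 0 < j.+1%:R :> R by rewrite ltr0n.
  have -> : n.+1%:R = (n - j)%:R + j.+1%:R :> R.
    by rewrite -natrD addnS subnK // ltnW.
  set x : R := (n - j)%:R in nj *; set y : R := j.+1%:R in j1 *.
  have xy : 0 < x + y by rewrite addr_gt0.
  (* The inequality [1 / (x y)^2 <= 2 / (x + y)^2 * (1 / x^2 + 1 / y^2)] comes from a difference
     that is a square. *)
  rewrite -subr_ge0 [X in 0 <= X](_ : _ = ((x - y) / (x * y * (x + y))) ^+ 2).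
    by rewrite exprn_even_ge0.
  by field; rewrite !gt_eqF.
rewrite -mulr_sumr -[8 / _]mulrC big_split /=.
rewrite [X in _ <= X](_ : _ = 2 / n.+1%:R ^+ 2 * (2 + 2)); last by ring.
rewrite ler_wpM2l ?divr_ge0 ?exprn_ge0 // lerD ?sum_inv_sq_le2 //.
rewrite [X in X <= _](reindex_inj rev_ord_inj) /=; apply: le_trans (sum_inv_sq_le2 n).
by apply: ler_sum => j _; rewrite subKn.
Qed.

Lemma same_cycle_type_prob_asymp :
  exists2 C, 0 <= C & forall n, (0 < n)%N ->
    `|n%:R ^+ 2 * W n - S| <= C * (1 + ln n%:R) / n%:R.
Proof.
have [D D0 hD] := log_deriv_bound.
have [B B0 hB] := same_cycle_type_prob_bound.
have W0 := same_cycle_type_prob_ge0 R; have [_ WS Smin] := prob_sum R.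
have S0 : 0 <= S by have := WS 0%N; rewrite big_ord0.
have WB j : (0 < j)%N -> W j <= B / j%:R ^+ 2.
  by move=> j0; rewrite ler_pdivlMr ?exprn_gt0 ?ltr0n // mulrC.
(* This constant allows [j.+1] in the denominator, and so [j = 0]: [j.+1 <= 2 j] costs the 4, and
   [W 0 <= S]. *)
pose B' := 4 * B + S.
have B'0 : 0 <= B' by rewrite addr_ge0 // mulr_ge0.
have WB' j : W j <= B' / j.+1%:R ^+ 2.
  rewrite ler_pdivlMr ?exprn_gt0 ?ltr0n //.
  case: j => [|j].
    rewrite expr1n mulr1 /B'; apply: (@le_trans _ _ S).
      by have := WS 1%N; rewrite big_ord1.
    by rewrite lerDr mulr_ge0.
  apply: (@le_trans _ _ (4 * (j.+1%:R ^+ 2 * W j.+1))).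
    rewrite mulrC mulrA ler_wpM2r ?W0 // -!natrX -natrM ler_nat; nia.
  by apply: (@le_trans _ _ (4 * B)); rewrite ?ler_wpM2l // lerDl.
exists (2 * B + 2 * B + 8 * D * B') => [|n n0].
  by rewrite !addr_ge0 // !mulr_ge0.
have n1 : 0 < n%:R :> R by rewrite ltr0n.
have l0 : 0 <= ln (n%:R : R) by exact: ln_nat_ge0.
(* [T1] is the tail of [W(1)], [T2] comes from the splitting [n = (n - j) + j] with [h] replaced by
   [1 / n], and [T3] from this replacement. *)
pose T1 := S - \sum_(j < n) W j.
pose T2 := \sum_(j < n) j%:R * W j / (n - j)%:R.
pose T3 := n%:R * \sum_(j < n) (h (n - j)%N - (n - j)%:R^-1) * W j.
have -> : n%:R ^+ 2 * W n - S = - T1 + T2 + T3.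
  have -> : n%:R ^+ 2 * W n = \sum_(j < n) W j + T2 + T3.
    rewrite expr2 -mulrA same_cycle_type_prob_sum /T2 /T3 !mulr_sumr -!big_split.
    apply: eq_bigr => j _ /=.
    have nj : (n - j)%:R != 0 :> R by rewrite pnatr_eq0 -lt0n subn_gt0.
    have -> : n%:R = (n - j)%:R + j%:R :> R by rewrite -natrD subnK // ltnW.
    by field.
  by rewrite /T1; ring.
have h1 : `|T1| <= 2 * B / n%:R.
  rewrite ger0_norm; last by rewrite subr_ge0; exact: WS.
  rewrite lerBlDl; apply: Smin => N.
  have [Nn|nN] := leqP N n.
    apply: (@le_trans _ _ (\sum_(j < n) W j)); first exact: ler_sum_widen.
    by rewrite lerDl divr_ge0 ?mulr_ge0.
  rewrite -(subnKC (ltnW nN)).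
  (* Telescoping: [B / m^2 <= 2 B / m - 2 B / (m + 1)] for [m >= 1]. *)
  suff : forall d, \sum_(j < n + d) W j <= \sum_(j < n) W j + 2 * B / n%:R - 2 * B / (n + d)%:R.
    move=> /(_ (N - n)%N) /le_trans; apply.
    by rewrite gerBl divr_ge0 ?mulr_ge0.
  elim=> [|d IH]; first by rewrite addn0 addrK.
  rewrite addnS big_ord_recr /=; apply: le_trans (lerD IH (WB _ _)) _.
    by rewrite addn_gt0 n0.
  rewrite -addrA lerD2l; set m := (n + d)%N.
  have m1 : 1 <= m%:R :> R by rewrite ler1n /m addn_gt0 n0.
  rewrite -[m.+1%:R]natr1; set x : R := m%:R in m1 *.
  rewrite -subr_ge0 [X in 0 <= X](_ : _ = B * (x - 1) / (x ^+ 2 * (x + 1))).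
    by rewrite divr_ge0 ?mulr_ge0 ?exprn_ge0 ?subr_ge0 //; lra.
  by field; apply/andP; split; lra.
have h2 : `|T2| <= 2 * B * (1 + ln n%:R) / n%:R.
  rewrite ger0_norm; last by apply: sumr_ge0 => j _; rewrite divr_ge0 ?mulr_ge0 ?W0.
  rewrite [X in _ <= X](_ : _ = B * (2 * (1 + ln n%:R) / n%:R)); last by ring.
  apply: le_trans (ler_wpM2l B0 (sum_inv_prod_le n0)); rewrite mulr_sumr.
  apply: ler_sum => j _; rewrite [X in _ <= X]mulrA ler_wpM2r //.
  have [->|j0] := posnP j; first by rewrite invr0 mul0r mulr0.
  have j1 : 0 < j%:R :> R by rewrite ltr0n.
  by rewrite ler_pdivlMr // mulrC mulrA -expr2.
have h3 : `|T3| <= 8 * D * B' / n%:R.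
  rewrite normrM ger0_norm //.
  have -> : 8 * D * B' / n%:R = n%:R * (D * B' * (8 / n%:R ^+ 2)).
    by field; rewrite gt_eqF.
  rewrite ler_wpM2l //.
  apply: (@le_trans _ _ (D * B' * (8 / n.+1%:R ^+ 2))); last first.
    rewrite ler_wpM2l ?mulr_ge0 // ler_wpM2l // lef_pV2 ?posrE ?exprn_gt0 ?ltr0n //.
    by rewrite lerXn2r ?nnegrE // ler_nat.
  apply: le_trans (ler_norm_sum _ _ _) _.
  apply: le_trans (ler_wpM2l (mulr_ge0 D0 B'0) (sum_inv_sq_conv n)).
  rewrite mulr_sumr; apply: ler_sum => j _.
  rewrite normrM (ger0_norm (W0 j)) mulrACA ler_pM ?W0 //.
  by apply: hD; rewrite subn_gt0.
apply: le_trans (ler_normD _ _) _.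
apply: le_trans (lerD (ler_normD _ _) h3) _; rewrite normrN.
apply: le_trans (lerD (lerD h1 h2) (lexx _)) _.
rewrite -!mulrDl ler_wpM2r ?invr_ge0 //.
rewrite [X in _ <= X](_ : _ = 2 * B * (1 + ln n%:R) + 2 * B * (1 + ln n%:R)
   + 8 * D * B' * (1 + ln n%:R)); last by ring.
by rewrite !lerD // ler_peMr ?mulr_ge0 // lerDl.
Qed.

End LeadingTerm.

(* From integer bounds to the decimals of [W(1)] *)
Delimit Scope Z_scope with BZ.

Section Numerics.
Variable R : realType.

Definition ratZ (z : Z) : R := (int_of_Z z)%:~R.

Lemma ratZD x y : ratZ (x + y)%BZ = ratZ x + ratZ y.
Proof. by rewrite /ratZ -intrD; congr intmul; lia. Qed.

Lemma ratZM x y : ratZ (x * y)%BZ = ratZ x * ratZ y.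
Proof. by rewrite /ratZ -intrM; congr intmul; lia. Qed.

Lemma ratZ1 : ratZ 1 = 1. Proof. by []. Qed.

Lemma ratZ_le x y : (x <= y)%BZ -> ratZ x <= ratZ y.
Proof. by rewrite /ratZ ler_int; lia. Qed.

Lemma ratZ_lt x y : (x < y)%BZ -> ratZ x < ratZ y.
Proof. by rewrite /ratZ ltr_int; lia. Qed.

Lemma ratZ_nat n : ratZ (Z.of_nat n) = n%:R.
Proof. by rewrite /ratZ -[n%:R]/(n%:Z%:~R); congr intmul; lia. Qed.

Lemma ratZ_pow x n : ratZ (x ^ Z.of_nat n)%BZ = ratZ x ^+ n.
Proof.
elim: n => [|n IH]; first by [].
by rewrite Nat2Z.inj_succ Z.pow_succ_r ?ratZM ?IH ?exprS //; lia.
Qed.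

Lemma ratZ_gt0 x : (0 < x)%BZ -> 0 < ratZ x.
Proof. by move/ratZ_lt. Qed.

Lemma ratZ_div_le a d : (0 < d)%BZ -> ratZ (a / d) <= ratZ a / ratZ d.
Proof.
move=> d0; rewrite ler_pdivlMr ?ratZ_gt0 // mulrC -ratZM; apply: ratZ_le.
exact: Z.mul_div_le.
Qed.

Lemma ratZ_div_ge a d : (0 < d)%BZ -> ratZ a / ratZ d <= ratZ (a / d + 1).
Proof.
move=> d0; rewrite ler_pdivrMr ?ratZ_gt0 // mulrC -ratZM; apply: ratZ_le.
have := Z.mul_succ_div_gt a d d0; rewrite -Z.add_1_r; lia.
Qed.

Lemma I_fracS x j : let m := (Z.of_nat j.+1 * Z.of_nat j.+1 * x)%BZ in
  I_frac x j.+1 = ((I_frac x j).1 * m + 1, (I_frac x j).2 * m)%BZ.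
Proof. by move=> m; rewrite /m /=; case: (I_frac x j). Qed.

Lemma I_frac_pos x j : (0 < x)%BZ -> (0 < (I_frac x j).1)%BZ /\ (0 < (I_frac x j).2)%BZ.
Proof.
move=> x0; elim: j => [|j] //; rewrite I_fracS; case: (I_frac x j) => n d [n0 d0].
have j0 : (0 < Z.of_nat j.+1)%BZ by lia.
have m0 := Z.mul_pos_pos _ _ (Z.mul_pos_pos _ _ j0 j0) x0.
have nm := Z.mul_pos_pos _ _ n0 m0; have dm := Z.mul_pos_pos _ _ d0 m0.
by split=> //; apply: Z.lt_trans nm _; exact: Z.lt_succ_diag_r.
Qed.

Lemma I_frac_sum x j : (0 < x)%BZ ->
  ratZ (I_frac x j).1 / ratZ (I_frac x j).2 =
  \sum_(i < j.+1) inv_fact_sq R i * (1 / ratZ x) ^+ i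
  /\ (ratZ (I_frac x j).2)^-1 = inv_fact_sq R j * (1 / ratZ x) ^+ j.
Proof.
move=> x0; have rx := ratZ_gt0 x0.
elim: j => [|j].
  by rewrite big_ord1 /inv_fact_sq fact0 expr1n expr0 ratZ1 divr1 invr1 mulr1.
have [n0 d0] := I_frac_pos j x0; move: n0 d0.
rewrite I_fracS; case: (I_frac x j) => n d n0 d0 [].
have fE (p q : Z) : (p, q).1 = p by [].
have sE (p q : Z) : (p, q).2 = q by [].
rewrite !fE !sE => IH1 IH2.
have rd : 0 < ratZ d := ratZ_gt0 d0.
have mE : ratZ (Z.of_nat j.+1 * Z.of_nat j.+1 * x) = j.+1%:R ^+ 2 * ratZ x.
  by rewrite !ratZM ratZ_nat expr2.
move: mE; move: (_ * x)%BZ => m mE.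
have E2 : (ratZ (d * m))^-1 = inv_fact_sq R j.+1 * (1 / ratZ x) ^+ j.+1.
  rewrite ratZM mE invfM IH2 inv_fact_sqS [(1 / _) ^+ j.+1]exprS.
  have : 0 < j.+1%:R :> R by [].
  by move: (j.+1%:R) => J J0; field; rewrite !gt_eqF.
split=> //; rewrite big_ord_recr -IH1 -E2 /=.
have m0 : ratZ m != 0 by rewrite mE mulf_neq0 ?expf_neq0 ?gt_eqF.
by rewrite ratZD !ratZM ratZ1; field; rewrite m0 gt_eqF.
Qed.

(** The last term of the partial sum is the inverse of the denominator. Since its index is at least
    1, every later term is at most half of its predecessor, so the remainder is no larger than that
    last term. *)
Lemma I_fun_frac (k : nat) (j : nat) f : (0 < k)%N ->
  f = I_frac (Z.of_nat k * Z.of_nat k)%BZ j.+1 ->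
  ratZ f.1 / ratZ f.2 <= I_fun (1 / (k%:R : R) ^+ 2) <= ratZ (f.1 + 1) / ratZ f.2.
Proof.
move=> k0 ->; have x0 : (0 < Z.of_nat k * Z.of_nat k)%BZ by apply: Z.mul_pos_pos; lia.
have [E1 E2] := I_frac_sum j.+1 x0.
have xE : ratZ (Z.of_nat k * Z.of_nat k) = k%:R ^+ 2 by rewrite ratZM ratZ_nat expr2.
rewrite xE in E1 E2; have z01 := inv_sq01 R k.
move: E1 E2 z01; set z := 1 / _ => E1 E2 z01; have /andP[z0 z1] := z01.
have [a0 aI Imin] := I_fun_sum z01.
rewrite ratZD ratZ1 mulrDl E1 div1r E2 aI /=.
apply: Imin => N; set S := \sum_(_ < j.+2) _; set e := inv_fact_sq R _ * _.
have e0 : 0 <= e by exact: a0.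
suff H : forall d, \sum_(i < j.+2 + d) inv_fact_sq R i * z ^+ i <= S + e * (1 - 2^-1 ^+ d).
  apply: (@le_trans _ _ (S + e * (1 - 2^-1 ^+ N))).
    apply: (le_trans _ (H N)).
    by apply: (@ler_sum_widen R (fun i => inv_fact_sq R i * z ^+ i)) => //; lia.
  by rewrite lerD2l ler_piMr // gerBl exprn_ge0.
have dec d : inv_fact_sq R (j.+1 + d) * z ^+ (j.+1 + d) <= e * 2^-1 ^+ d.
  elim: d => [|d IH]; first by rewrite addn0 expr0 mulr1.
  rewrite addnS inv_fact_sqS [z ^+ _.+1]exprS [2^-1 ^+ d.+1]exprS.
  rewrite [X in X <= _](_ : _ = (inv_fact_sq R (j.+1 + d) * z ^+ (j.+1 + d)) *
      (z / (j.+1 + d).+1%:R ^+ 2)); last by ring.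
  rewrite [X in _ <= X](_ : _ = e * 2^-1 ^+ d * 2^-1); last by ring.
  apply: ler_pM => //; first by rewrite divr_ge0 ?exprn_ge0.
  rewrite ler_pdivrMr ?exprn_gt0 //; apply: le_trans z1 _.
  rewrite ler_pdivlMl // mulr1 -natrX ler_nat; nia.
elim=> [|d IH]; first by rewrite addn0 expr0 subrr mulr0 addr0.
rewrite addnS big_ord_recr /=; have := lerD IH (dec d.+1).
rewrite addnS addSn => /le_trans; apply.
by rewrite exprS; lra.
Qed.

Lemma I_prodS k : I_prod R k.+1 = I_prod R k * I_fun (1 / k.+1%:R ^+ 2).
Proof. by rewrite /I_prod big_nat_recr. Qed.

Lemma I_prod_ge0 k : 0 <= I_prod R k.
Proof.
by apply: prodr_ge0 => i _; apply: le_trans (I_fun_ge1 (inv_sq01 R i)); exact: ler01.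
Qed.

Lemma I_prod_le k d : I_prod R k <= I_prod R (k + d).
Proof.
elim: d => [|d IH]; first by rewrite addn0.
by rewrite addnS I_prodS (le_trans IH) // ler_peMr ?I_prod_ge0 // I_fun_ge1 ?inv_sq01.
Qed.

Lemma I_prod_bounds_correct k l u : I_prod_bounds k = (l, u) ->
  ratZ l <= ratZ fixed_one * I_prod R k <= ratZ u /\ (0 <= l)%BZ.
Proof.
elim: k l u => [|k IH] l' u'; first by case=> <- <-; rewrite /I_prod big_geq // mulr1 lexx.
case E : (I_prod_bounds k) => [l u]; have [/andP[hl hu] l0] := IH _ _ E.
have x0 : (0 < Z.of_nat k.+1 * Z.of_nat k.+1)%BZ by apply: Z.mul_pos_pos; lia.
case F : (I_frac (Z.of_nat k.+1 * Z.of_nat k.+1) 14) => [n d].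
have [n0 d0] : (0 < n)%BZ /\ (0 < d)%BZ by have := I_frac_pos 14 x0; rewrite F.
have /andP[h1 h2] : ratZ n / ratZ d <= I_fun (1 / (k.+1%:R : R) ^+ 2) <= ratZ (n + 1) / ratZ d.
  exact: (@I_fun_frac k.+1 13 (n, d) isT (esym F)).
rewrite (I_prod_boundsS _ _ _ _ _ E F) {E F} => -[<- <-].
have S0 : 0 <= ratZ fixed_one by exact/ltW/ratZ_gt0.
have P0 := I_prod_ge0 k; have rl : 0 <= ratZ l := ratZ_le l0.
rewrite I_prodS mulrA; move: (ratZ fixed_one) (I_prod R k) S0 P0 hl hu => s P S0 P0 hl hu.
have rd := ratZ_gt0 d0; have rn := ratZ_gt0 n0.
have q0 : 0 <= ratZ n / ratZ d by rewrite divr_ge0 // ltW.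
split; last by apply: Z.div_pos => //; apply: Z.mul_nonneg_nonneg => //; lia.
apply/andP; split.
  by apply: le_trans (ratZ_div_le _ d0) _; rewrite ratZM -mulrA ler_pM.
apply: le_trans (ratZ_div_ge _ d0); rewrite ratZM -[X in _ <= X]mulrA ler_pM ?mulr_ge0 //.
exact: le_trans q0 h1.
Qed.

Let tail w k : R :=
  ratZ (tail_num w (2 * Z.of_nat k + 1)) / ratZ (tail_den w (2 * Z.of_nat k + 1)).

Let tail_den_gt0 w k : (300 <= k)%N -> (0 <= w <= 22890)%BZ ->
  0 < ratZ (tail_den w (2 * Z.of_nat k + 1)).
Proof. by move=> hk hw; apply/ratZ_gt0/tail_den_pos => //; lia. Qed.

Let tail_num_gt0 w k : (300 <= k)%N -> (0 <= w <= 22890)%BZ ->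
  0 < ratZ (tail_num w (2 * Z.of_nat k + 1)).
Proof.
move=> hk hw; apply: lt_le_trans (tail_den_gt0 hk hw) _; apply/ratZ_le/tail_den_le_num; lia.
Qed.

Let tail_ge1 w k : (300 <= k)%N -> (0 <= w <= 22890)%BZ -> 1 <= tail w k.
Proof.
move=> hk hw; rewrite /tail ler_pdivlMr ?tail_den_gt0 // mul1r.
by apply/ratZ_le/tail_den_le_num; lia.
Qed.

Let frac_le (a b c e f n : R) : 0 < b -> 0 < e -> 0 < f ->
  a * f * e <= b * c * n -> a / b <= n / e * (c / f).
Proof.
move=> b0 e0 f0 h; rewrite ler_pdivrMr // (_ : _ * b = b * c * n / (f * e)).
  by rewrite ler_pdivlMr ?mulr_gt0 // mulrA.
by field; rewrite !gt_eqF.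
Qed.

Let frac_ge (a b c e f n : R) : 0 < b -> 0 < e -> 0 < f ->
  b * c * n <= a * f * e -> n / e * (c / f) <= a / b.
Proof.
move=> b0 e0 f0 h; rewrite ler_pdivlMr // (_ : _ * b = b * c * n / (f * e)).
  by rewrite ler_pdivrMr ?mulr_gt0 // mulrA.
by field; rewrite !gt_eqF.
Qed.

Let step_lower k : (300 <= k)%N -> tail 22888 k <= I_fun (1 / k.+1%:R ^+ 2) * tail 22888 k.+1.
Proof.
move=> k3; have hw : (0 <= 22888 <= 22890)%BZ by [].
have hk : (301 <= Z.of_nat k.+1)%BZ by lia.
have hn := tail_num_gt0 (leqW k3) hw; have hd := tail_den_gt0 (leqW k3) hw.
have hd' := tail_den_gt0 k3 hw.
have x0 : (0 < Z.of_nat k.+1 * Z.of_nat k.+1)%BZ by apply: Z.mul_pos_pos; lia.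
have H := tail_step_lower _ hk; move: H.
have -> : (2 * Z.of_nat k.+1 - 1 = 2 * Z.of_nat k + 1)%BZ by lia.
case F : (I_frac (Z.of_nat k.+1 * Z.of_nat k.+1) 4) => [n e].
have [n0 e0] : (0 < n)%BZ /\ (0 < e)%BZ by have := I_frac_pos 4 x0; rewrite F.
have /andP[h1 _] := @I_fun_frac k.+1 3 (n, e) isT (esym F).
move=> /ratZ_le; rewrite !ratZM => H.
apply: le_trans (ler_wpM2r (ltW (divr_gt0 hn hd)) h1).
exact: (frac_le hd' (ratZ_gt0 e0) hd H).
Qed.

Let step_upper k : (300 <= k)%N -> I_fun (1 / k.+1%:R ^+ 2) * tail 22890 k.+1 <= tail 22890 k.
Proof.
move=> k3; have hw : (0 <= 22890 <= 22890)%BZ by [].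
have hk : (301 <= Z.of_nat k.+1)%BZ by lia.
have hn := tail_num_gt0 (leqW k3) hw; have hd := tail_den_gt0 (leqW k3) hw.
have hd' := tail_den_gt0 k3 hw.
have x0 : (0 < Z.of_nat k.+1 * Z.of_nat k.+1)%BZ by apply: Z.mul_pos_pos; lia.
have H := tail_step_upper _ hk; move: H.
have -> : (2 * Z.of_nat k.+1 - 1 = 2 * Z.of_nat k + 1)%BZ by lia.
case F : (I_frac (Z.of_nat k.+1 * Z.of_nat k.+1) 4) => [n e].
have [n0 e0] : (0 < n)%BZ /\ (0 < e)%BZ by have := I_frac_pos 4 x0; rewrite F.
have /andP[_ h2] := @I_fun_frac k.+1 3 (n, e) isT (esym F).
move=> /ratZ_le; rewrite !ratZM => H.
apply: le_trans (ler_wpM2r (ltW (divr_gt0 hn hd)) h2) _.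
exact: (frac_ge hd' (ratZ_gt0 e0) hd H).
Qed.

(** For the parameter [22888] the corrected product increases with [k], for [22890] it decreases;
    both tend to [W(1)], which is thus enclosed at every [k >= 300]. *)
Lemma I_prod_tail_lower m k : (300 <= m)%N -> (m <= k)%N ->
  I_prod R m * tail 22888 m <= I_prod R k * tail 22888 k.
Proof.
move=> hm; elim: k => [|k IH]; first by rewrite leqn0 => /eqP ->.
rewrite leq_eqVlt ltnS => /predU1P[-> //|mk]; apply: le_trans (IH mk) _.
by rewrite I_prodS -mulrA ler_wpM2l ?I_prod_ge0 // step_lower // (leq_trans hm).
Qed.

Lemma I_prod_tail_upper m k : (300 <= m)%N -> (m <= k)%N ->
  I_prod R k * tail 22890 k <= I_prod R m * tail 22890 m.
Proof.
move=> hm; elim: k => [|k IH]; first by rewrite leqn0 => /eqP ->.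
rewrite leq_eqVlt ltnS => /predU1P[-> //|mk]; apply: le_trans (IH mk).
by rewrite I_prodS -mulrA ler_wpM2l ?I_prod_ge0 // step_upper // (leq_trans hm).
Qed.

Let S : R := same_cycle_type_gf 1.

Lemma gf_le_tail m : (300 <= m)%N -> S <= I_prod R m * tail 22890 m.
Proof.
move=> hm; apply: gf_le => k.
apply: le_trans (I_prod_le k m) _; rewrite addnC.
apply: le_trans (I_prod_tail_upper hm (leq_addr k m)).
by rewrite ler_peMr ?I_prod_ge0 // tail_ge1 // (leq_trans hm) ?leq_addr.
Qed.

(** The corrected product at a large [k] exceeds [S] by at most [4 S / k], since the tail factor is
    at most [1 + 4 / k]; [k > 4 S / e] makes this less than [e]. *)
Lemma gf_ge_tail m : (300 <= m)%N -> I_prod R m * tail 22888 m <= S.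
Proof.
move=> hm; have S0 : 0 <= S by exact: le_trans (I_prod_ge0 0) (I_prod_le_gf R 0).
apply/ler_addgt0Pr => e e0; have [k k1 hk] := exists_nat_gt (4 * S / e) m.
have mk : (m <= k)%N by lia.
have kR : 0 < k%:R :> R by rewrite ltr0n; lia.
have k3 := leq_trans hm mk; have hw : (0 <= 22888 <= 22890)%BZ by [].
apply: le_trans (I_prod_tail_lower hm mk) _.
have h1 : tail 22888 k <= 1 + 4 / k%:R.
  have y0 : (601 <= 2 * Z.of_nat k + 1)%BZ by lia.
  have yk : k%:R <= ratZ (2 * Z.of_nat k + 1) by rewrite -ratZ_nat; apply: ratZ_le; lia.
  have := ratZ_le (tail_num_le _ _ y0 hw); have := tail_den_gt0 k3 hw; rewrite /tail.
  rewrite !ratZM [ratZ (_ + 4)]ratZD (_ : ratZ 4 = 4) //.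
  move: (ratZ (tail_num _ _)) (ratZ (tail_den _ _)) (ratZ _) yk => n d y yk d0 h.
  have y1 : 0 < y := lt_le_trans kR yk.
  apply: (@le_trans _ _ (1 + 4 / y)); last by rewrite lerD2l ler_wpM2l // lef_pV2 ?posrE.
  rewrite ler_pdivrMr // -(ler_pM2r y1) (le_trans h) // le_eqVlt; apply/orP; left.
  by apply/eqP; field; rewrite gt_eqF.
have t0 : 0 <= tail 22888 k by exact: le_trans ler01 (tail_ge1 k3 hw).
apply: le_trans (ler_wpM2r t0 (I_prod_le_gf R k)) _.
apply: le_trans (ler_wpM2l S0 h1) _.
rewrite mulrDr mulr1 lerD2l mulrA [S * 4]mulrC ler_pdivrMr // [e * _]mulrC.
by move: hk; rewrite ltr_pdivrMr // => /ltW.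
Qed.

(** Stated for abstract integers, so that denominators are cleared without ever touching the large
    constants. *)
Let scaled_lower (N F T l n d : Z) P : (0 < F)%BZ -> (0 < T)%BZ -> 0 < ratZ d -> 0 < ratZ n ->
  (N * F * d <= l * n * T)%BZ -> ratZ l <= ratZ F * P -> P * (ratZ n / ratZ d) <= S ->
  ratZ N <= ratZ T * S.
Proof.
move=> /ratZ_gt0 F0 /ratZ_gt0 T0 d0 n0 /ratZ_le; rewrite !ratZM => h1 hl.
rewrite mulrA ler_pdivrMr // => h2.
rewrite -(ler_pM2r (mulr_gt0 F0 d0)) [X in X <= _]mulrA; apply: le_trans h1 _.
apply: (@le_trans _ _ (ratZ F * P * ratZ n * ratZ T)); first by rewrite !ler_wpM2r // ltW.
rewrite [X in X <= _](_ : _ = (P * ratZ n) * (ratZ F * ratZ T)); last by ring.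
rewrite [X in _ <= X](_ : _ = (S * ratZ d) * (ratZ F * ratZ T)); last by ring.
by rewrite ler_wpM2r // ltW // mulr_gt0.
Qed.

Let scaled_upper (N F T u n d : Z) P : (0 < F)%BZ -> (0 < T)%BZ -> 0 < ratZ d -> 0 < ratZ n ->
  (u * n * T < N * F * d)%BZ -> ratZ F * P <= ratZ u -> S <= P * (ratZ n / ratZ d) ->
  ratZ T * S < ratZ N.
Proof.
move=> /ratZ_gt0 F0 /ratZ_gt0 T0 d0 n0 /ratZ_lt; rewrite !ratZM => h1 hl.
rewrite mulrA ler_pdivlMr // => h2.
rewrite -(ltr_pM2r (mulr_gt0 F0 d0)) [X in _ < X]mulrA; apply: le_lt_trans h1.
apply: (@le_trans _ _ (ratZ F * P * ratZ n * ratZ T)); last by rewrite !ler_wpM2r // ltW.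
rewrite [X in _ <= X](_ : _ = (P * ratZ n) * (ratZ F * ratZ T)); last by ring.
rewrite [X in X <= _](_ : _ = (S * ratZ d) * (ratZ F * ratZ T)); last by ring.
by rewrite ler_wpM2r // ltW // mulr_gt0.
Qed.

Lemma gf_bounds :
  ratZ 4263403514152669 <= ratZ (10 ^ 15) * S < ratZ 4263403514152670.
Proof.
have y : (2 * Z.of_nat 300 + 1 = 601)%BZ by [].
have F0 : (0 < fixed_one)%BZ by [].
have T0 : (0 < 10 ^ 15)%BZ by [].
have hw : (0 <= 22888 <= 22890)%BZ by [].
have hw' : (0 <= 22890 <= 22890)%BZ by [].
have := gf_upper; have := gf_lower.
have := gf_le_tail (leqnn 300); have := gf_ge_tail (leqnn 300).
have := tail_num_gt0 (leqnn 300) hw; have := tail_den_gt0 (leqnn 300) hw.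
have := tail_num_gt0 (leqnn 300) hw'; have := tail_den_gt0 (leqnn 300) hw'.
rewrite /tail y => d0' n0' d0 n0 hge hle.
case E : (I_prod_bounds 300) => [l u] hl hu.
have [/andP[cl cu] _] := I_prod_bounds_correct E; apply/andP; split.
  exact: (scaled_lower F0 T0 d0 n0 hl cl hge).
exact: (scaled_upper F0 T0 d0' n0' hu cu hle).
Qed.

Let gf_approx (w : R) : ratZ 4263403514152669 = 10 ^+ 15 * w -> w <= S < w + 1 / 10 ^+ 15.
Proof.
move=> NE; have TE : ratZ (10 ^ 15) = 10 ^+ 15 by rewrite (ratZ_pow 10 15).
have := gf_bounds; rewrite -[4263403514152670%BZ]/(4263403514152669 + 1)%BZ.
rewrite ratZD ratZ1 NE TE; have : 0 < 10 ^+ 15 :> R by rewrite exprn_gt0 // ltr0n.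
move: (10 ^+ 15) {TE NE} => T T0 /andP[h1 h2].
by rewrite -(ler_pM2l T0) h1 -(ltr_pM2l T0) mulrDr div1r mulfV ?gt_eqF.
Qed.

Lemma gf_decimals :
  let w : R := 4 + 263 / 10 ^+ 3 + 403 / 10 ^+ 6 + 514 / 10 ^+ 9
                 + 152 / 10 ^+ 12 + 669 / 10 ^+ 15 in
  w <= S < w + 1 / 10 ^+ 15.
Proof.
apply: gf_approx.
(* Horner form in base 1000: after the passage to [nat] every numeral is unary and has to stay
   small. *)
have -> : (4263403514152669 = ((((Z.of_nat 4 * Z.of_nat 1000 + Z.of_nat 263) * Z.of_nat 1000
    + Z.of_nat 403) * Z.of_nat 1000 + Z.of_nat 514) * Z.of_nat 1000
    + Z.of_nat 152) * Z.of_nat 1000 + Z.of_nat 669)%BZ by [].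
rewrite !(ratZD, ratZM) !ratZ_nat.
have -> : 1000%:R = 10 ^+ 3 :> R by rewrite -natrX.
rewrite !(exprM 10 3 2, exprM 10 3 3, exprM 10 3 4, exprM 10 3 5).
have : 10 ^+ 3 != 0 :> R by rewrite expf_neq0 // pnatr_eq0.
by move: (10 ^+ 3) (263) (403) (514) (152) (669) => *; field.
Qed.

End Numerics.

(** * The error term in Landau notation, and the conclusion *)

Lemma same_cycle_type_prob_bigO (R : realType) (C : R) : 0 <= C ->
  (forall n, (0 < n)%N ->
     `|n%:R ^+ 2 * same_cycle_type_prob R n - same_cycle_type_gf 1| <= C * (1 + ln n%:R) / n%:R) ->
  (fun n => same_cycle_type_prob R n - same_cycle_type_gf 1 / n%:R ^+ 2)
    =O_\oo (fun n => ln n%:R / n%:R ^+ 3 : R).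
Proof.
move=> C0 hC; apply/eqO_exP; exists (2 * C + 1); first by rewrite ltr_wpDl ?mulr_ge0.
(* From [n >= e] on, [ln n >= 1] absorbs the 1 in [1 + ln n]. *)
have [m m1 hm] := exists_nat_gt (expR (1 : R)) 1.
exists m => // n /= mn; have n0 : (0 < n)%N by lia.
have nR : 0 < n%:R :> R by rewrite ltr0n.
have l1 : 1 <= ln (n%:R : R).
  rewrite -ler_expR lnK ?posrE //; apply: le_trans (ltW hm) _.
  by rewrite ler_nat.
have := hC n n0; move: (ln _) l1 => l l1; set W := same_cycle_type_prob R n.
set S := same_cycle_type_gf 1 => h.
have -> : W - S / n%:R ^+ 2 = (n%:R ^+ 2 * W - S) / n%:R ^+ 2 by field; rewrite gt_eqF.
rewrite normrM [ `|l / _|]ger0_norm ?divr_ge0 ?exprn_ge0 ?(ltW nR) ?(le_trans ler01) //.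
rewrite [ `|_^-1|]ger0_norm ?invr_ge0 ?exprn_ge0 ?(ltW nR) //.
rewrite ler_pdivrMr ?exprn_gt0 //; apply: le_trans h _.
rewrite [X in _ <= X](_ : _ = (2 * C + 1) * l / n%:R); last by field; rewrite gt_eqF.
rewrite ler_wpM2r ?invr_ge0 ?(ltW nR) //.
have := ler_wpM2l C0 l1; lra.
Qed.

Theorem proposition4 (R : realType) :
  [/\ (fun n => same_cycle_type_prob R n - same_cycle_type_gf 1 / n%:R ^+ 2)
        =O_\oo (fun n => ln n%:R / n%:R ^+ 3 : R),
      cvgn (series (fun n => same_cycle_type_prob R n * 1 ^+ n)) /\
      (fun N => \prod_(1 <= k < N.+1) I_fun (1 / k%:R ^+ 2))
        @ \oo --> same_cycle_type_gf (1 : R),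
      (let w : R := 4 + 263 / 10 ^+ 3 + 403 / 10 ^+ 6 + 514 / 10 ^+ 9
                      + 152 / 10 ^+ 12 + 669 / 10 ^+ 15 in
       w <= same_cycle_type_gf 1 < w + 1 / 10 ^+ 15) &
      full_oscillating_expansion (same_cycle_type_prob R)].
Proof.
have [b [bE b0 b1 bsum]] := log_deriv_exists R; split.
- have [C C0 hC] := same_cycle_type_prob_asymp bE b0 b1 bsum.
  exact: same_cycle_type_prob_bigO hC.
- split; last exact: cvg_I_prod.
  by rewrite gfE; apply: cvgP (nonneg_sum_cvg (prob_sum R)).
- exact: gf_decimals.
- apply: log_expansion_full; apply: (@log_expansion_le R 1 0) => //.
  apply: near_polylog_expansion.
  apply: (near_polylog_bootstrap (theta_same_cycle_type_prob bE b0) (wsum_prob R)).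
  exact: near_polylog_log_deriv.
Qed.
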